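(* Let $\mathbb{K}$ be a field of characteristic zero and let $1\le d\le 13$. For every integer $k>6$ the interpolation problem $(\{F_d\}_k,F)$ is generically correct for $F$ the diagram with at most $1$ step of cardinality $kd(d+1)/2$. Additionally, if $d\le 9$, then the problem $(\{F_d\}_6,F)$ is generically correct for $F$ the diagram with at most $1$ step of cardinality $6d(d+1)/2$.
   Context: $\mathbb{N}$ is the set of nonnegative integers; for $\alpha\in\mathbb{N}^2$, $|\alpha|=\alpha_1+\alpha_2$. $F_d=\{\alpha\in\mathbb{N}^2:|\alpha|<d\}$. A diagram with at most $1$ step is a set of the form $\{\alpha\in\mathbb{N}^2:|\alpha|<a\}\cup\{\alpha\in\mathbb{N}^2:|\alpha|=a,\ \alpha_2<b\}$ with integers $a\ge b\ge 0$; there is exactly one of each cardinality. Generic correctness: for $F$ with $\#F=kd(d+1)/2$, take $k$ nodes $p_1,\dots,p_k\in\mathbb{K}^2$ and let $M$ be the square matrix with rows indexed by pairs $(i,\beta)$, $1\le i\le k$, $\beta\in F_d$, columns indexed by $\alpha\in F$, and entry $\frac{\partial^{|\beta|}x^\alpha}{\partial x^\beta}(p_i)$. The problem $(\{F_d\}_k,F)$ is generically correct if $\det M$, as a polynomial in the $2k$ coordinates of the nodes, is nonzero. *)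

(* Defs.v *)
From mathcomp Require Import all_boot all_order all_algebra.
From mathcomp Require Import finmap.
From mathcomp.multinomials Require Import mpoly.

Set Implicit Arguments.
Unset Strict Implicit.
Unset Printing Implicit Defensive.

Import GRing.Theory.
Local Open Scope ring_scope.

(* Elements alpha of N^2 are bivariate multinomials 'X_{1..2}, with
   |alpha| = mdeg alpha, alpha_1 = alpha ord0 and alpha_2 = alpha ord_max. The
   set F_d = {alpha : |alpha| < d} is the finite type 'X_{1..2 < d}. *)

Definition at_most_one_step (F : {fset 'X_{1..2}}) : Prop :=
  exists a b : nat, (b <= a)%N /\
    forall alpha : 'X_{1..2},
      (alpha \in F) =
      (mdeg alpha < a)%N || (mdeg alpha == a) && (alpha ord_max < b)%N.

(* The i-th node is generic: its two coordinates are variables of the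
   polynomial ring in the k * 2 coordinates of all the nodes. *)
Definition node (K : fieldType) (k : nat) (i : 'I_k) :
    2.-tuple {mpoly K[k * 2]} :=
  [tuple 'X_(mxvec_index i j) | j < 2].

Definition interp_mx (K : fieldType) (d k : nat) (F : {fset 'X_{1..2}}) :
    'M[{mpoly K[k * 2]}]_(#|{: 'I_k * 'X_{1..2 < d}}|, #|{: F}|) :=
  \matrix_(r, c)
    let: (i, beta) := enum_val r : 'I_k * 'X_{1..2 < d} in
    let alpha := val (enum_val c : F) in
    'X_[K, alpha]^`M[beta] \mPo node K i.

(* The identity e says that the matrix is square, so that its determinant makes
   sense; whether the determinant vanishes depends neither on e nor on the
   enumerations chosen for the rows and the columns. *)
Definition generically_correct (K : fieldType) (d k : nat)
    (F : {fset 'X_{1..2}}) : Prop :=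
  exists e : #|{: F}| = #|{: 'I_k * 'X_{1..2 < d}}|,
    \det (castmx (erefl, e) (interp_mx K d k F)) != 0.

(* Main.v *)
Require Import Defs.
From Stdlib Require Import ZArith.
From mathcomp Require Import all_boot all_order all_algebra all_field.
From mathcomp Require Import finmap.
From mathcomp.multinomials Require Import mpoly.
From mathcomp Require Import zify ssrZ ring.

(* The matrix has integer entries, so K may be replaced by the field of algebraic numbers, and it
   suffices to find k nodes with nonzero coordinates at which the matrix is invertible.  Up to a
   triangular change of rows, the rows of a node p are the functions alpha |-> p^alpha q(alpha) with
   q in a basis of the polynomials of degree < d.  Hence the claim is that every function on F is a
   sum of k terms p_i^alpha q_i(alpha) with deg q_i < d.

   For one node with coordinates 1 this is interpolation by polynomials, which is proved by peeling
   off a line with d points, then a line with d - 1 points, and so on, or by linear algebra modulo a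
   prime.  Sets are assembled in two ways: if a line separates two sets, the nodes of one of them
   can be scaled along a one-parameter subgroup until the matrix is block diagonal in the limit;
   and roots of unity as nodes decouple the residue classes of a linear form.

   The diagram for k nodes is obtained from that for some k' < k by adding a strip, cut into k - k'
   cells.  When k is large, k' can be chosen so that the strip has 2i+1 cells and height d or d + 1;
   these strips arise from finitely many by inserting blocks of two cells.  The subdivisions of
   these strips, and those for small k, were found by computer. *)

Set Implicit Arguments.
Unset Strict Implicit.
Unset Printing Implicit Defensive.

Import Order.TTheory GRing.Theory Num.Theory.
Local Open Scope ring_scope.
Local Delimit Scope Z_scope with Z.

(** * Polynomial and exponential interpolation *)

(** Small k are a genuine obstacle: for d = 2 the problem fails for k = 2 and k = 5, because the
    doubled line or conic through the nodes vanishes to order two at them. So the induction may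
    never descend to 1, ..., 6 nodes; each k has to be reached from 0 or from some k' > 6. A cell
    has d(d+1)/2 points, and two cells tile a block of d rows of d + 1 points or of d + 1 rows of d
    points; hence the heights d and d + 1. In a strip whose rows grow by one point, the slanted end
    accounts for one more triangle 1 + ... + d, hence the odd number of cells. For large k, height d
    is used when b' <= b and height d + 1 when b' > b, where b and b' are the lengths of the
    incomplete rows of the larger and the smaller diagram. Lowering k' by 2 takes 2d(d+1) from twice
    the size of the smaller diagram; once the side is large, the admissible sizes form an interval
    at least that long, so the parity of k - k' can be prescribed, and only finitely many k are left
    to computation. *)

Definition point := (Z * Z)%type.

Definition zC (z : Z) : algC := (int_of_Z z)%:~R.

Lemma zCD (x y : Z) : zC (x + y)%Z = zC x + zC y.
Proof. by rewrite /zC -[(x + y)%Z]/(x + y) rmorphD /= intrD. Qed.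

Lemma zCM (x y : Z) : zC (x * y)%Z = zC x * zC y.
Proof. by rewrite /zC -[(x * y)%Z]/(x * y) rmorphM /= intrM. Qed.

Lemma zCN (x : Z) : zC (- x)%Z = - zC x.
Proof. by rewrite /zC -[(- x)%Z]/(- x) rmorphN /= mulrNz. Qed.

Lemma zCB (x y : Z) : zC (x - y)%Z = zC x - zC y.
Proof. by rewrite -Z.add_opp_r zCD zCN. Qed.

Lemma zC_eq0 (x : Z) : (zC x == 0) = (x == 0%Z).
Proof.
rewrite /zC intr_eq0; apply/eqP/eqP => [h|-> //].
by rewrite -[x]int_of_ZK h.
Qed.

Lemma zC_inj : injective zC.
Proof.
move=> x y /eqP; rewrite -subr_eq0 -zCB zC_eq0 => /eqP h; lia.
Qed.

(* Functions given by polynomials of total degree < d. *)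
Fixpoint polyfun (d : nat) (q : algC -> algC -> algC) : Prop :=
  if d is d'.+1 then
    exists c q1 q2, [/\ polyfun d' q1, polyfun d' q2 &
      forall x y, q x y = c + x * q1 x y + y * q2 x y]
  else forall x y, q x y = 0.

Lemma polyfun_eq d q q' :
  (forall x y, q x y = q' x y) -> polyfun d q -> polyfun d q'.
Proof.
case: d => [|d] e /=; first by move=> h x y; rewrite -e.
by move=> [c [q1 [q2 [h1 h2 h]]]]; exists c, q1, q2; split=> // x y; rewrite -e.
Qed.

Lemma polyfun_lin d a b q q' :
  polyfun d q -> polyfun d q' -> polyfun d (fun x y => a * q x y + b * q' x y).
Proof.
elim: d q q' => [|d IH] q q' /=; first by move=> h h' x y; rewrite h h' !mulr0 addr0.
move=> [c [q1 [q2 [h1 h2 h]]]] [c' [q1' [q2' [h1' h2' h']]]].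
exists (a * c + b * c'), (fun x y => a * q1 x y + b * q1' x y),
  (fun x y => a * q2 x y + b * q2' x y); split; [exact: IH|exact: IH|].
by move=> x y; rewrite h h'; ring.
Qed.

Lemma polyfunD d q q' :
  polyfun d q -> polyfun d q' -> polyfun d (fun x y => q x y + q' x y).
Proof.
move=> h h'; apply: (polyfun_eq _ (polyfun_lin 1 1 h h')) => x y.
by rewrite !mul1r.
Qed.

Lemma polyfunZ d a q : polyfun d q -> polyfun d (fun x y => a * q x y).
Proof.
move=> h; apply: (polyfun_eq _ (polyfun_lin a 0 h h)) => x y.
by rewrite mul0r addr0.
Qed.

Lemma polyfun0 d : polyfun d (fun _ _ => 0).
Proof.
elim: d => [//|d IH] /=; exists 0, (fun _ _ => 0), (fun _ _ => 0); split=> // x y.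
by rewrite !mulr0 !addr0.
Qed.

Lemma polyfunS d q : polyfun d q -> polyfun d.+1 q.
Proof.
elim: d q => [|d IH] q h.
  by apply: polyfun_eq (polyfun0 1) => x y; rewrite h.
case: h => c [q1 [q2 [h1 h2 h]]].
by exists c, q1, q2; split=> //; apply: IH.
Qed.

Lemma polyfun_affine d a b c q :
  polyfun d q -> polyfun d.+1 (fun x y => (a * x + b * y + c) * q x y).
Proof.
move=> h.
have h1 : polyfun d.+1 (fun x y => (a * x + b * y) * q x y).
  exists 0, (fun x y => a * q x y), (fun x y => b * q x y).
  by split; [exact: polyfunZ|exact: polyfunZ|move=> x y; ring].
by apply: polyfun_eq (polyfunD h1 (polyfunZ c (polyfunS h))) => x y; ring.
Qed.

Lemma polyfun_const d c : polyfun d.+1 (fun _ _ => c).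
Proof.
exists c, (fun _ _ => 0), (fun _ _ => 0).
by split; [exact: polyfun0|exact: polyfun0|move=> x y; rewrite !mulr0 !addr0].
Qed.

Lemma polyfun_shift d a b q :
  polyfun d q -> polyfun d (fun x y => q (x + a) (y + b)).
Proof.
elim: d q => [|d IH] q /= h; first by move=> x y; rewrite h.
case: h => c [q1 [q2 [/IH h1 /IH h2 h]]].
have h1' := polyfun_affine 1 0 a h1; have h2' := polyfun_affine 0 1 b h2.
apply: polyfun_eq (polyfunD (polyfun_const d c) (polyfunD h1' h2')) => x y.
by rewrite h; ring.
Qed.

Definition fits d (A : seq point) :=
  forall h : point -> algC, exists2 q, polyfun d q &
    {in A, forall a, q (zC a.1) (zC a.2) = h a}.

Lemma fits_sub d A B : {subset B <= A} -> fits d A -> fits d B.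
Proof.
by move=> sBA hA h; have [q hq e] := hA h; exists q => // a /sBA; apply: e.
Qed.

(* A product of linear forms, one through each point of A. *)
Lemma polyfun_separate d (a : point) A : a \notin A -> (size A <= d)%N ->
  exists2 r, polyfun d.+1 r & r (zC a.1) (zC a.2) != 0 /\
    {in A, forall b, r (zC b.1) (zC b.2) = 0}.
Proof.
elim: A d => [|b A IH] d.
  by exists (fun _ _ => 1); [exact: polyfun_const|rewrite oner_neq0].
case: d => [//|d]; rewrite inE negb_or => /andP [ab aA] sA.
have [r hr [ra rA]] := IH d aA sA.
have [e1|e1] := eqVneq a.1 b.1.
  exists (fun x y => (0 * x + 1 * y + - zC b.2) * r x y); first exact: polyfun_affine.
  split=> [|c]; last by rewrite inE => /orP [/eqP ->|/rA ->]; ring.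
  rewrite mulf_neq0 // mul0r add0r mul1r subr_eq0 (inj_eq zC_inj).
  by apply: contra ab => e2; rewrite -pair_eqE /pair_eq e1 e2 eqxx.
exists (fun x y => (1 * x + 0 * y + - zC b.1) * r x y); first exact: polyfun_affine.
split=> [|c]; last by rewrite inE => /orP [/eqP ->|/rA ->]; ring.
by rewrite mulf_neq0 // mul0r addr0 mul1r subr_eq0 (inj_eq zC_inj).
Qed.

Lemma fits_size d A : (size A <= d)%N -> fits d A.
Proof.
elim: A d => [|a A IH] d.
  by move=> _ h; exists (fun _ _ => 0) => //; exact: polyfun0.
case: d => [//|d] sA h.
have [q hq e] := IH d.+1 (leqW sA) h.
have [aA|aA] := boolP (a \in A).
  by exists q => // b; rewrite inE => /orP [/eqP ->|]; apply: e.
have [r hr [ra rA]] := polyfun_separate aA sA.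
pose t := (h a - q (zC a.1) (zC a.2)) / r (zC a.1) (zC a.2).
exists (fun x y => q x y + t * r x y); first exact: polyfunD (polyfunZ _ _).
move=> b; rewrite inE => /orP [/eqP ->|bA]; last by rewrite rA // e // mulr0 addr0.
by rewrite /t divfK // addrC subrK.
Qed.

Definition lin (u v : Z) (a : point) : Z := (u * a.1 + v * a.2)%Z.

(* Interpolate first on the line, then on the other points after division by its equation. *)
Lemma fits_peel d A (u v c : Z) :
    (count (fun a => lin u v a == c) A <= d.+1)%N ->
    fits d [seq a <- A | lin u v a != c] -> fits d.+1 A.
Proof.
move=> cA hA h.
have [q hq e] : exists2 q, polyfun d.+1 q &
    {in [seq a <- A | lin u v a == c], forall a, q (zC a.1) (zC a.2) = h a}.
  by apply: fits_size; rewrite size_filter.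
pose l x y := zC u * x + zC v * y + - zC c.
have lE a : l (zC a.1) (zC a.2) = zC (lin u v a) - zC c.
  by rewrite /l /lin zCD !zCM.
have [q' hq' e'] := hA (fun a => (h a - q (zC a.1) (zC a.2)) / l (zC a.1) (zC a.2)).
exists (fun x y => q x y + l x y * q' x y).
  by apply: polyfunD => //; apply: polyfun_affine.
move=> a aA; have [ac|ac] := eqVneq (lin u v a) c.
  by rewrite lE ac subrr mul0r addr0 e // mem_filter ac eqxx.
have l0 : l (zC a.1) (zC a.2) != 0 by rewrite lE subr_eq0 (inj_eq zC_inj).
rewrite e' ?mem_filter ?ac // mulrC divfK // addrC subrK //.
Qed.

(** * Exponential polynomials on the lattice and the two ways of assembling sets *)

Definition mono (p : algC * algC) (a : point) : algC :=
  p.1 ^ int_of_Z a.1 * p.2 ^ int_of_Z a.2.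

Definition torus (p : algC * algC) := (p.1 != 0) && (p.2 != 0).

(* Restrictions to Z^2 of the exponential polynomials with frequencies ps and coefficients
   of degree < d. *)
Fixpoint expfun (d : nat) (ps : seq (algC * algC)) (g : point -> algC) : Prop :=
  if ps is p :: ps' then
    exists q g', [/\ polyfun d q, expfun d ps' g' &
      forall a, g a = mono p a * q (zC a.1) (zC a.2) + g' a]
  else forall a, g a = 0.

Lemma expfun_eq d ps g g' : g =1 g' -> expfun d ps g -> expfun d ps g'.
Proof.
case: ps => [|p ps] e /=; first by move=> h a; rewrite -e.
by move=> [q [r [hq hr h]]]; exists q, r; split=> // a; rewrite -e.
Qed.

Lemma expfun_lin d ps s t g g' : expfun d ps g -> expfun d ps g' ->
  expfun d ps (fun a => s * g a + t * g' a).
Proof.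
elim: ps g g' => [|p ps IH] g g' /=; first by move=> h h' a; rewrite h h' !mulr0 addr0.
move=> [q [r [hq hr h]]] [q' [r' [hq' hr' h']]].
exists (fun x y => s * q x y + t * q' x y), (fun a => s * r a + t * r' a).
by split; [exact: polyfun_lin|exact: IH|move=> a; rewrite h h'; ring].
Qed.

Lemma expfun0 d ps : expfun d ps (fun=> 0).
Proof.
elim: ps => [//|p ps IH] /=; exists (fun _ _ => 0), (fun=> 0).
by split=> //; [exact: polyfun0|move=> a; rewrite mulr0 addr0].
Qed.

Lemma expfun_sum d ps (I : Type) (r : seq I) (t : I -> algC) (g : I -> point -> algC) :
  (forall i, expfun d ps (g i)) -> expfun d ps (fun a => \sum_(i <- r) t i * g i a).
Proof.
move=> hg; elim: r => [|i r IH].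
  by apply: expfun_eq (expfun0 d ps) => a; rewrite big_nil.
apply: expfun_eq (expfun_lin (t i) 1 (hg i) IH) => a.
by rewrite big_cons mul1r.
Qed.

Lemma expfun_cat d ps ps' g g' : expfun d ps g -> expfun d ps' g' ->
  expfun d (ps ++ ps') (fun a => g a + g' a).
Proof.
elim: ps g => [|p ps IH] g /=.
  by move=> h h'; apply: expfun_eq h' => a; rewrite h add0r.
move=> [q [r [hq hr h]]] h'; exists q, (fun a => r a + g' a).
by split; [|exact: IH|move=> a; rewrite h addrA].
Qed.

Lemma expfun_mono d ps g t :
  expfun d ps g -> torus t -> all torus ps ->
  expfun d [seq (p.1 * t.1, p.2 * t.2) | p <- ps] (fun a => mono t a * g a).
Proof.
move=> + /andP [t1 t2]; elim: ps g => [|p ps IH] g /=; first by move=> h _ a; rewrite h mulr0.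
move=> [q [r [hq hr h]]] /andP [/andP [p1 p2] tps].
exists q, (fun a => mono t a * r a); split=> //; first exact: IH.
by move=> a; rewrite h /mono /= !exprzMl ?unitfE //; ring.
Qed.

Lemma expfun_shift d ps g (v : point) : all torus ps ->
  expfun d ps g -> expfun d ps (fun a => g (a.1 - v.1, a.2 - v.2)%Z).
Proof.
elim: ps g => [|p ps IH] g /=; first by move=> _ h a; rewrite h.
move=> /andP [tp tps] [q [r [hq hr h]]].
exists (fun x y => (mono p v)^-1 * q (x + - zC v.1) (y + - zC v.2)),
  (fun a => r (a.1 - v.1, a.2 - v.2)%Z); split; last 1 first.
- move=> a; rewrite h /= !zCB; congr (_ + _); rewrite mulrA; congr (_ * _).
  case/andP: tp => p1 p2; rewrite /mono /= -[Z.sub a.1 _]/(a.1 - v.1) -[Z.sub a.2 _]/(a.2 - v.2).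
  by rewrite !rmorphB /= !expfzDr // -!invr_expz invfM; ring.
- by apply: polyfunZ; apply: polyfun_shift.
- exact: IH.
Qed.

(** Only surjectivity of interpolation is asked, which passes to subsets; points are counted against
    nodes only for the final square matrix. The finite list [A] carries the interpolation, while [P]
    is a predicate on the whole plane, so that regions are compared by integer arithmetic. Nodes lie
    in the torus because exponents in Z may be negative. *)
Definition solvable (d k : nat) (P : point -> bool) : Prop :=
  exists (A : seq point) (ps : seq (algC * algC)),
  [/\ forall a, P a -> a \in A, size ps = k, all torus ps &
    forall h : point -> algC, exists2 g, expfun d ps g & {in A, g =1 h}].

Lemma solvable_sub d k (P Q : point -> bool) :
  (forall a, Q a -> P a) -> solvable d k P -> solvable d k Q.
Proof. by move=> sQP [A [ps [sA sz t h]]]; exists A, ps; split=> // a /sQP; apply: sA. Qed.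

(** The nodes stay the same: translating p^alpha q(alpha) by [v] multiplies it by the constant
    p^(-v) and translates q, which keeps its degree. *)
Lemma solvable_shift d k (P : point -> bool) (v : point) :
  solvable d k P -> solvable d k (fun a => P (a.1 - v.1, a.2 - v.2)%Z).
Proof.
move=> [A [ps [sA sz t hA]]].
exists [seq (a.1 + v.1, a.2 + v.2)%Z | a <- A], ps; split=> //.
  move=> a /sA aA; apply/mapP; exists (a.1 - v.1, a.2 - v.2)%Z => //=.
  by rewrite !Z.sub_add -surjective_pairing.
move=> h; have [g hg e] := hA (fun a => h (a.1 + v.1, a.2 + v.2)%Z).
exists (fun a => g (a.1 - v.1, a.2 - v.2)%Z); first exact: expfun_shift.
move=> _ /mapP [a aA ->] /=; rewrite -e //; congr g.
by rewrite !Z.add_simpl_r -surjective_pairing.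
Qed.

Lemma solvable0 d (P : point -> bool) : (forall a, P a = false) -> solvable d 0 P.
Proof.
move=> P0; exists [::], [::]; split=> //; first by move=> a; rewrite P0.
by move=> h; exists (fun=> 0).
Qed.

Lemma polyfun_sum d (I : Type) (r : seq I) (t : I -> algC) q :
  (forall i, polyfun d (q i)) -> polyfun d (fun x y => \sum_(i <- r) t i * q i x y).
Proof.
move=> hq; elim: r => [|i r IH].
  by apply: polyfun_eq (polyfun0 d) => x y; rewrite big_nil.
apply: polyfun_eq (polyfun_lin (t i) 1 (hq i) IH) => x y.
by rewrite big_cons mul1r.
Qed.

Lemma expfun_big d (I : Type) (r : seq I) p q :
  (forall i, polyfun d (q i)) ->
  expfun d [seq p i | i <- r]
    (fun a => \sum_(i <- r) mono (p i) a * q i (zC a.1) (zC a.2)).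
Proof.
move=> hq; elim: r => [|i r IH] /=; first by move=> a; rewrite big_nil.
by exists (q i); eexists; split; [|exact: IH|move=> a; rewrite big_cons].
Qed.

Lemma sum_unity_root (m : nat) (x : algC) : x ^+ m = 1 -> x != 1 ->
  \sum_(i < m) x ^+ i = 0.
Proof.
move=> xm x1; have := subrX1 x m; rewrite xm subrr => /esym/eqP.
by rewrite mulf_eq0 subr_eq0 (negPf x1) => /eqP.
Qed.

Lemma int_of_ZD (x y : Z) : int_of_Z (x + y)%Z = int_of_Z x + int_of_Z y.
Proof. exact: rmorphD. Qed.

Lemma int_of_ZM (x y : Z) : int_of_Z (x * y)%Z = int_of_Z x * int_of_Z y.
Proof. exact: rmorphM. Qed.

Lemma ltn_modZ (m : nat) (L : Z) :
  (0 < m)%N -> (Z.to_nat (L mod Z.of_nat m)%Z < m)%N.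
Proof. move=> m0; have := Z.mod_pos_bound L (Z.of_nat m); lia. Qed.

Lemma int_of_Z_divmod (m : nat) (L : Z) : (0 < m)%N ->
  int_of_Z L = m%:Z * int_of_Z (L / Z.of_nat m)%Z + (Z.to_nat (L mod Z.of_nat m)%Z)%:Z.
Proof.
move=> m0; rewrite {1}(Z.div_mod L (Z.of_nat m)); last by lia.
rewrite int_of_ZD int_of_ZM; congr (_ * _ + _).
  lia.
have := Z.mod_pos_bound L (Z.of_nat m); lia.
Qed.

(* With nodes zeta^i for a primitive m-th root of unity zeta, the discrete Fourier
   transform decouples the residue classes of the linear form. *)
Lemma solvable_torsion d m (A : seq point) (u v : Z) : (0 < m)%N ->
  (forall r : 'I_m, fits d [seq a <- A | (lin u v a mod Z.of_nat m)%Z == Z.of_nat r]) ->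
  solvable d m (mem A).
Proof.
move=> m0 hA; have [z hz] := C_prim_root_exists m0.
have zm := prim_expr_order hz.
have z0 : z != 0.
  by apply: contra_eq_neq zm => ->; rewrite expr0n gtn_eqF // eq_sym oner_eq0.
pose node (i : 'I_m) := ((z ^+ i) ^ int_of_Z u, (z ^+ i) ^ int_of_Z v).
exists A, [seq node i | i <- enum 'I_m]; split=> //.
- by rewrite size_map size_enum_ord.
- by apply/allP => _ /mapP [i _ ->]; rewrite /torus /= !expfz_neq0 ?expf_neq0.
move=> h.
have [q hq e] := fin_all_exists2 (fun r => hA r h).
(* The [Q i] are the inverse discrete Fourier transform of the interpolants [q r] of the residue
   classes. *)
pose Q (i : 'I_m) x y := \sum_(r <- enum 'I_m) (m%:R^-1 * (z ^+ (i * r))^-1) * q r x y.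
exists (fun a => \sum_(i <- enum 'I_m) mono (node i) a * Q i (zC a.1) (zC a.2)).
  by apply: expfun_big => i; apply: polyfun_sum.
move=> a aA /=.
pose rho := Z.to_nat (lin u v a mod Z.of_nat m)%Z.
have lt_rho : (rho < m)%N by apply: ltn_modZ.
(* The monomial of a torsion node sees only the residue [rho] of the linear form at [a]. *)
have monoE (i : 'I_m) : mono (node i) a = z ^+ (i * rho).
  rewrite /mono /node /= !exprz_exp -expfzDr ?expf_neq0 //.
  have -> : int_of_Z u * int_of_Z a.1 + int_of_Z v * int_of_Z a.2 =
    m%:Z * int_of_Z (lin u v a / Z.of_nat m)%Z + rho%:Z.
    by rewrite -int_of_Z_divmod // /lin int_of_ZD !int_of_ZM.
  by rewrite expfzDr ?expf_neq0 // -exprz_exp -!exprnP -!exprM mulnC exprM zm expr1n exp1rz mul1r.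
under eq_bigr => i _ do rewrite monoE /Q mulr_sumr.
rewrite exchange_big /= (bigD1_seq (Ordinal lt_rho)) ?mem_enum ?enum_uniq //=.
rewrite [X in _ + X]big1 => [|r rr]; last first.
  rewrite big_enum /=.
  under eq_bigr => i _.
    have -> : z ^+ (i * rho) * (m%:R^-1 * (z ^+ (i * r))^-1 * q r (zC a.1) (zC a.2)) =
      (m%:R^-1 * q r (zC a.1) (zC a.2)) * (z ^+ rho / z ^+ r) ^+ i.
      by rewrite expr_div_n -!exprM ![(_ * i)%N]mulnC; ring.
    over.
  rewrite -mulr_sumr sum_unity_root ?mulr0 //.
    by rewrite expr_div_n -!exprM ![(_ * m)%N]mulnC !exprM zm !expr1n divr1.
  apply: contra rr => /eqP/divr1_eq/eqP.
  by rewrite (eq_prim_root_expr hz) !modn_small // eq_sym.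
rewrite addr0 big_enum /= (eq_bigr (fun=> m%:R^-1 * q (Ordinal lt_rho) (zC a.1) (zC a.2))).
  2: by move=> i _; rewrite mulrA mulrCA mulfV ?expf_neq0 // mulr1.
rewrite sumr_const card_ord -[LHS]mulr_natl mulrA divff ?mul1r ?pnatr_eq0 -?lt0n //.
apply: e; rewrite mem_filter aA andbT /=; apply/eqP.
by have := Z.mod_pos_bound (lin u v a) (Z.of_nat m); rewrite /rho; lia.
Qed.

Lemma nonroot_neq0 (p : {poly algC}) : p != 0 -> exists2 s, s != 0 & p.[s] != 0.
Proof.
move=> p0; have : p * 'X != 0 by rewrite mulf_neq0 // polyX_eq0.
by case/closed_nonrootP => s; rewrite rootM negb_or rootX => /andP [ps s0]; exists s.
Qed.

(* The nodes of P2 are scaled by the one-parameter subgroup of (u, v).  After dividing out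
   powers of the parameter, the interpolation matrix tends to a block diagonal one. *)
Lemma solvable_cut d k1 k2 (P1 P2 : point -> bool) (u v c : Z) :
  (forall a, P1 a -> (lin u v a < c)%Z) -> (forall a, P2 a -> (c <= lin u v a)%Z) ->
  solvable d k1 P1 -> solvable d k2 P2 -> solvable d (k1 + k2) (fun a => P1 a || P2 a).
Proof.
move=> lt1 ge2 [A1 [ps1 [sA1 sz1 t1 h1]]] [A2 [ps2 [sA2 sz2 t2 h2]]].
pose low (a : point) := (lin u v a <? c)%Z.
(* [A1] and [A2] may reach across the line; a point is kept only if it belongs to the list of its
   own side. *)
pose A := [seq a <- undup (A1 ++ A2) | if low a then a \in A1 else a \in A2].
have uA : uniq A by rewrite filter_uniq // undup_uniq.
pose n := size A; pose pt (i : 'I_n) := nth (0%Z, 0%Z) A i.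
have ptA i : pt i \in A by rewrite mem_nth.
have pt_inj : injective pt.
  by move=> i j /eqP; rewrite nth_uniq // => /eqP /val_inj.
pose e i := low (pt i).
have Ae i : pt i \in if e i then A1 else A2.
  by have := ptA i; rewrite mem_filter /e; case: (low _) => /andP [].
(* [g i] is dual to the i-th point among the points on the same side of the line; its values on the
   other side are uncontrolled. *)
have /fin_all_exists [g hg] (i : 'I_n) : exists f : point -> algC,
    expfun d (if e i then ps1 else ps2) f /\
    forall j, e j = e i -> f (pt j) = (i == j)%:R.
  have [f hf ef] : exists2 f, expfun d (if e i then ps1 else ps2) f &
      {in if e i then A1 else A2, f =1 fun a => (pt i == a)%:R}.
    by case: (e i); [exact: h1|exact: h2].
  exists f; split=> // j ej; rewrite ef ?(inj_eq pt_inj) //.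
  by rewrite -ej Ae.
(* Doubling and adding 1 makes [w] odd, hence nowhere zero: its sign tells the side, and every
   exponent in the off-diagonal blocks of [M] is positive. *)
pose w (a : point) := (2 * (lin u v a - c) + 1)%Z.
have wlow a : (w a <? 0)%Z = low a by rewrite /w /low; lia.
pose M : 'M[{poly algC}]_n := \matrix_(i, j)
  if e i == e j then (i == j)%:R else g i (pt j) *: 'X^(Z.abs_nat (w (pt j))).
(* At X = 0 the off-diagonal blocks vanish and [M] becomes the identity, so its determinant is a
   nonzero polynomial. *)
have [s s0 Ms] : exists2 s, s != 0 & (\det M).[s] != 0.
  apply: nonroot_neq0; apply: contraTneq isT => M0.
  have : \det (map_mx (horner_eval 0) M) = 0.
    by rewrite det_map_mx M0 /= /horner_eval horner0.
  suff -> : map_mx (horner_eval 0) M = 1%:M by rewrite det1 => /eqP; rewrite oner_eq0.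
  apply/matrixP => i j; rewrite !mxE /horner_eval.
  case: eqP => [_|ne]; first by case: (i == j); rewrite ?hornerE ?horner0 ?hornerC.
  rewrite hornerZ hornerXn expr0n.
  have -> : (Z.abs_nat (w (pt j)) == 0)%N = false by rewrite /w; lia.
  by rewrite mulr0; case: eqP => // ij; case: ne; rewrite ij.
pose Ms' := map_mx (horner_eval s) M.
have uMs : Ms' \in unitmx by rewrite unitmxE unitfE det_map_mx.
(* With this [t], [mono t a] is s^(-2 lin(a)); the constant factor with exponent [1 - 2 * c] in [G]
   completes it to s^(-w(a)). *)
pose t : algC * algC := ((s^-1) ^ int_of_Z (2 * u)%Z, (s^-1) ^ int_of_Z (2 * v)%Z).
have tt : torus t by rewrite /torus /= !expfz_neq0 ?invr_eq0.
exists A, (ps1 ++ [seq (p.1 * t.1, p.2 * t.2) | p <- ps2]); split.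
- move=> a Pa; rewrite mem_filter mem_undup mem_cat /low.
  case/orP: Pa => Pa.
    by have /Z.ltb_lt -> := lt1 _ Pa; rewrite sA1.
  have /Z.ltb_ge -> := ge2 _ Pa; by rewrite sA2 // orbT.
- by rewrite size_cat size_map sz1 sz2.
- rewrite all_cat t1 all_map; apply/allP => p /(allP t2) /andP [p1 p2] /=.
  by case/andP: tt => ? ?; rewrite /torus /= !mulf_neq0.
move=> h.
(* After this scaling of the columns, the values of the low [g i], and of the high ones twisted by
   s^(-w), are exactly the entries of [Ms']. *)
pose scale (a : point) := if low a then 1 else s ^ int_of_Z (w a).
pose y := \row_j (h (pt j) * scale (pt j)).
pose x := y *m invmx Ms'.
pose G (a : point) := \sum_(i < n) (if e i then x 0 i * g i a else 0) +
  mono t a * (s^-1 ^ int_of_Z (1 - 2 * c)%Z * \sum_(i < n) (if e i then 0 else x 0 i * g i a)).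
exists G.
  apply: expfun_cat.
    apply: expfun_eq (expfun_sum (index_enum 'I_n) (fun i => if e i then x 0 i else 0)
      (g := fun i => if e i then g i else fun=> 0) _) => [a|i].
      by apply: eq_bigr => i _; case: (e i); rewrite ?mul0r.
    by case E: (e i); [have [] := hg i; rewrite E|exact: expfun0].
  apply: expfun_mono => //.
  pose r0 := s^-1 ^ int_of_Z (1 - 2 * c)%Z.
  apply: expfun_eq (expfun_sum (index_enum 'I_n) (fun i => if e i then 0 else r0 * x 0 i)
      (g := fun i => if e i then fun=> 0 else g i) _) => [a|i].
    by rewrite mulr_sumr; apply: eq_bigr => i _; case: (e i); rewrite ?mulr0 ?mulrA.
  by case E: (e i); [exact: expfun0|have [] := hg i; rewrite E].
move=> a aA.
have [j ->] : exists j, a = pt j.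
  by move/(nthP (0%Z, 0%Z)): aA => [i lti <-]; exists (Ordinal lti).
have monoE : mono t (pt j) * s^-1 ^ int_of_Z (1 - 2 * c)%Z = (s ^ int_of_Z (w (pt j)))^-1.
  have si0 : s^-1 != 0 by rewrite invr_eq0.
  rewrite /mono -[t.1]/(s^-1 ^ int_of_Z (2 * u)%Z) -[t.2]/(s^-1 ^ int_of_Z (2 * v)%Z).
  rewrite !exprz_exp -!expfzDr // invr_expz exprz_inv; congr (s ^ (- _)).
  rewrite -!int_of_ZM -!int_of_ZD; congr int_of_Z; rewrite /w /lin; lia.
have scale0 : scale (pt j) != 0 by rewrite /scale; case: (low _); rewrite ?oner_neq0 ?expfz_neq0.
have xM : (x *m Ms') 0 j = h (pt j) * scale (pt j) by rewrite mulmxKV // mxE.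
apply: (mulIf scale0); rewrite -xM mxE /G mulrA monoE.
rewrite mulrDl big_distrl /= mulr_sumr big_distrl -big_split /=.
apply: eq_bigr => i _; rewrite /Ms' /M !mxE /horner_eval.
have [eij|neij] := eqVneq (e i) (e j).
  have [_ /(_ j (esym eij)) ->] := hg i.
  rewrite eij /scale -/(e j); case: (e j).
    rewrite mulr0 mul0r addr0 mulr1; congr (_ * _).
    by case: (i == j); rewrite ?hornerE ?horner0 ?hornerC.
  rewrite mul0r add0r [X in X * _]mulrC mulfVK ?expfz_neq0 //.
  by congr (_ * _); case: (i == j); rewrite ?hornerE ?horner0 ?hornerC.
rewrite hornerZ hornerXn /scale -/(e j); move: neij (wlow (pt j)); rewrite -/(e j).
case: (e i); case: (e j) => // _ wj.
  rewrite mulr0 mul0r addr0 -mulrA; congr (_ * (_ * _)).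
  by rewrite exprnP; congr (s ^ _); lia.
rewrite mul0r add0r mulr1 mulrC -mulrA; congr (_ * (_ * _)).
by rewrite invr_expz exprnP; congr (s ^ _); lia.
Qed.

(** * Linear algebra modulo a prime *)

(** With exponent p - 2 this is inversion modulo p by Fermat; [insert_row] checks that the product
    with the pivot is 1. *)
Fixpoint pow_mod (p b : Z) (n : nat) : Z :=
  if n is n'.+1 then ((b * pow_mod p b n') mod p)%Z else 1%Z.

(* r + t u, where missing entries are zero. *)
Fixpoint add_row (t : Z) (u r : seq Z) : seq Z :=
  match u, r with
  | a :: u', b :: r' => (b + t * a)%Z :: add_row t u' r'
  | [::], _ => r
  | _, [::] => [seq (t * a)%Z | a <- u]
  end.

(* Gaussian elimination modulo p, row by row.  The entry of index j of the list us is the pivot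
   row of column j, if there is one, without its coefficients in the columns <= j, the last of
   which is 1. *)
Fixpoint insert_row (p : Z) (r : seq Z) (us : seq (option (seq Z))) :
    option (seq (option (seq Z))) :=
  match r, us with
  | x :: r', o :: us' =>
    let t := (x mod p)%Z in
    if (t =? 0)%Z then omap (cons o) (insert_row p r' us')
    else if o is Some u then omap (cons o) (insert_row p (add_row (p - t) u r') us')
    else
      let i := pow_mod p t (Z.to_nat (p - 2)) in
      if ((t * i) mod p =? 1)%Z then
        Some (Some [seq ((i * y) mod p)%Z | y <- r'] :: us')
      else None
  | _, _ => None
  end.

Fixpoint full_rank (p : Z) (rows : seq (seq Z)) (us : seq (option (seq Z))) : bool :=
  if rows is r :: rows' then
    if insert_row p r us is Some us' then full_rank p rows' us' else false
  else all isSome us.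

Section Independent.

Variable p : nat.
Hypothesis p_pr : prime p.

Definition zF (z : Z) : 'F_p := (int_of_Z z)%:~R.

Lemma zFD x y : zF (x + y)%Z = zF x + zF y.
Proof. by rewrite /zF int_of_ZD intrD. Qed.

Lemma zFM x y : zF (x * y)%Z = zF x * zF y.
Proof. by rewrite /zF int_of_ZM intrM. Qed.

Lemma zF_p : zF (Z.of_nat p) = 0.
Proof.
rewrite /zF (_ : int_of_Z (Z.of_nat p) = p%:Z); last by lia.
by apply/eqP; rewrite -pmulrn -(dvdn_pcharf (pchar_Fp p_pr)).
Qed.

Lemma zF_mod z : zF (z mod Z.of_nat p)%Z = zF z.
Proof.
rewrite [in RHS](Z.div_mod z (Z.of_nat p)); last by have := prime_gt0 p_pr; lia.
by rewrite zFD zFM zF_p mul0r add0r.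
Qed.


Lemma zFN x : zF (- x)%Z = - zF x.
Proof. by rewrite /zF -[(- x)%Z]/(- x) rmorphN /= mulrNz. Qed.

Fixpoint dot (r : seq Z) (v : seq 'F_p) : 'F_p :=
  match r, v with
  | x :: r', c :: v' => zF x * c + dot r' v'
  | _, _ => 0
  end.

Lemma dotE r v : dot r v = \sum_(j < size v) zF (nth 0%Z r j) * v`_j.
Proof.
elim: v r => [|c v IH] [|x r]; rewrite ?big_ord0 //= big_ord_recl /=; last by rewrite IH.
have z0 : zF 0%Z = 0 by [].
by rewrite !z0 mul0r add0r big1 // => j _; rewrite mul0r.
Qed.

Lemma dot_scale t r v : dot [seq (t * y)%Z | y <- r] v = zF t * dot r v.
Proof.
elim: r v => [|x r IH] [|c v] /=; rewrite ?mulr0 // IH zFM; ring.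
Qed.

Lemma dot_add_row t u r v : dot (add_row t u r) v = dot r v + zF t * dot u v.
Proof.
elim: u r v => [|a u IH] [|b r] [|c v] /=; rewrite ?mulr0 ?addr0 ?add0r //.
  by rewrite dot_scale zFM; ring.
by rewrite IH zFD zFM; ring.
Qed.

Lemma dot_mod r v : dot [seq (y mod Z.of_nat p)%Z | y <- r] v = dot r v.
Proof. by elim: r v => [|x r IH] [|c v] //=; rewrite IH zF_mod. Qed.

(** Orthogonality of [v] to all pivot rows; the summand [c] comes from their implicit leading 1. *)
Fixpoint kills (us : seq (option (seq Z))) (v : seq 'F_p) : Prop :=
  match us, v with
  | o :: us', c :: v' => (if o is Some u then c + dot u v' = 0 else True) /\ kills us' v'
  | _, _ => True
  end.

(** A new pivot row is a combination of [r] and older pivot rows, so it is orthogonal to whatever is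
    orthogonal to these. *)
Lemma insert_row_kills r us us' v : insert_row (Z.of_nat p) r us = Some us' ->
  kills us v -> dot r v = 0 -> kills us' v /\ size us' = size us.
Proof.
elim: us r us' v => [|o us IH] [|x r] // us' v; cbn [insert_row].
set t := (x mod _)%Z; have tE : zF t = zF x by rewrite zF_mod.
have step r' s w : omap (cons o) (insert_row (Z.of_nat p) r' us) = Some s ->
    kills (o :: us) w -> dot r' (behead w) = 0 -> kills s w /\ size s = (size us).+1.
  case E : (insert_row _ _ _) => [s'|] //= [<-] kw dw.
  have kw' : kills us (behead w) by case: (w) kw => [|c w'] //=; [case: (us) | case].
  have [k' <-] := IH _ _ _ E kw' dw; split=> //.
  by case: (w) kw k' => [|c w'] //= [].
case: (Z.eqb_spec t 0) => [t0 /step H kv dv|_].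
  apply: (H _ kv); case: v kv dv {H} => [|c v] /=; first by case: (r).
  by rewrite -tE t0 mul0r add0r.
case: o step => [u|] step; first move=> /step H kv dv.
  apply: (H _ kv); case: v kv dv {H} => [|c v] /=; first by case: (add_row _ _ _).
  case=> cu _ <-; rewrite dot_add_row /Z.sub zFD zF_p add0r zFN tE.
  by rewrite (_ : c = - dot u v); [ring | apply/eqP; rewrite -addr_eq0 cu].
case: (Z.eqb_spec _ 1) => // iE [<-] {step}.
case: v => [|c v] //= [_ kv] dv; split=> //; split=> //.
set i := pow_mod _ _ _ in iE *.
have xi : zF x * zF i = 1 by rewrite -tE -zFM -zF_mod iE.
rewrite (_ : [seq _ | y <- r] = [seq (y mod Z.of_nat p)%Z | y <- [seq (i * y)%Z | y <- r]]).
  rewrite dot_mod dot_scale -[c]mul1r -xi; rewrite -[RHS](mulr0 (zF i)) -dv; ring.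
by rewrite -map_comp.
Qed.

(** Once every column has a pivot, the stored system is triangular with 1 on the diagonal, and back
    substitution from the last coordinate leaves only zero. *)
Lemma full_rank_kills rows us v : full_rank (Z.of_nat p) rows us -> size v = size us ->
  kills us v -> {in rows, forall r, dot r v = 0} -> v = nseq (size v) 0.
Proof.
elim: rows us => [|r rows IH] us /=; last first.
  case E : (insert_row _ _ _) => [us'|] // full sv kv dv.
  have [kv' sE] := insert_row_kills E kv (dv _ (mem_head _ _)).
  apply: IH full _ kv' _; first by rewrite sE.
  by move=> r' hr'; apply: dv; rewrite inE hr' orbT.
move=> full + + _; elim: us v full => [|[u|] us IH] [|c v] //= /IH{}IH [/IH{}IH] [cu /IH vE].
rewrite {1}vE; congr (_ :: _); rewrite -[RHS]cu vE dotE big1 ?addr0 // => j _.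
by rewrite nth_nseq if_same mulr0.
Qed.

End Independent.

(** * Certificates for one node and for subdivisions *)

Lemma polyfun_leq d d' q : (d <= d')%N -> polyfun d q -> polyfun d' q.
Proof. by move/subnK <-; elim: (d' - d)%N => [//|n IH] /IH; apply: polyfunS. Qed.

Fixpoint triangle (d : nat) : nat := if d is d'.+1 then d + triangle d' else 0.

(* The values at (l, o) of acc (l - c_1) ... (l - c_i) o^j for i + j < d, where c_1, c_2, ...
   are the nodes. *)
Fixpoint newton (R : pzRingType) (d : nat) (nodes : seq R) (acc l o : R) : seq R :=
  if d is d'.+1 then
    mkseq (fun j => acc * o ^+ j) d ++
    newton d' (behead nodes) (acc * (l - head 0 nodes)) l o
  else [::].


Lemma newtonS (R : pzRingType) d nodes (acc l o : R) : newton d.+1 nodes acc l o =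
  mkseq (fun j => acc * o ^+ j) d.+1 ++ newton d (behead nodes) (acc * (l - head 0 nodes)) l o.
Proof. by []. Qed.

Lemma size_newton (R : pzRingType) d nodes (acc l o : R) :
  size (newton d nodes acc l o) = triangle d.
Proof.
by elim: d nodes acc => [//|d IH] nodes acc; rewrite newtonS size_cat IH size_mkseq.
Qed.

Lemma map_newton (R S : pzRingType) (f : {rmorphism R -> S}) d nodes acc l o :
  map f (newton d nodes acc l o) = newton d (map f nodes) (f acc) (f l) (f o).
Proof.
elim: d nodes acc => [//|d IH] nodes acc.
rewrite !newtonS map_cat IH; congr (_ ++ newton _ _ _ _ _).
- by rewrite /mkseq -map_comp; apply: eq_map => j /=; rewrite rmorphM rmorphXn.
- by case: nodes.
- by rewrite rmorphM rmorphB; case: nodes => [|? ?] //=; rewrite rmorph0.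
Qed.

Lemma newton0 (R : pzRingType) d nodes (l o : R) j : nth 0 (newton d nodes 0 l o) j = 0.
Proof.
elim: d nodes j => [|d IH] nodes j; first exact: nth_nil.
rewrite newtonS nth_cat mul0r IH size_mkseq; case: ifP => // lt_j.
by rewrite nth_mkseq // mul0r.
Qed.

(** The product [acc] grows along the recursion, so it enters only as a multiplier that raises the
    degree bound by [e]; each step trades one unit of [d] for one of [e]. *)
Lemma polyfun_newton d e nodes (acc L O : algC -> algC -> algC) j :
  (forall m q, polyfun m q -> polyfun (m + e) (fun x y => acc x y * q x y)) ->
  (forall m q c, polyfun m q -> polyfun m.+1 (fun x y => (L x y - c) * q x y)) ->
  (forall m q, polyfun m q -> polyfun m.+1 (fun x y => O x y * q x y)) ->
  polyfun (d + e) (fun x y => nth 0 (newton d nodes (acc x y) (L x y) (O x y)) j).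
Proof.
move=> + HL HO; elim: d e nodes acc j => [|d IH] e nodes acc j Hacc.
  by apply: polyfun_eq (polyfun0 e) => x y; rewrite nth_nil.
have [lt_j|ge_j] := ltnP j d.+1.
  apply: (@polyfun_eq _ (fun x y => acc x y * O x y ^+ j)) => [x y|].
    by rewrite newtonS nth_cat size_mkseq lt_j nth_mkseq.
  apply: Hacc; apply: polyfun_leq lt_j _.
  elim: j => [|j IHj]; first exact: polyfun_const.
  by apply: polyfun_eq (HO _ _ IHj) => x y; rewrite exprS.
apply: (@polyfun_eq _ (fun x y => nth 0 (newton d (behead nodes)
  (acc x y * (L x y - head 0 nodes)) (L x y) (O x y)) (j - d.+1))) => [x y|].
  by rewrite newtonS nth_cat size_mkseq ltnNge ge_j.
rewrite addSnnS; apply: IH => m q hq; rewrite addnS -addSn.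
by apply: polyfun_eq (Hacc _ _ (HL _ _ (head 0 nodes) hq)) => x y; rewrite mulrA.
Qed.

Fixpoint powers (p x acc : Z) (n : nat) : seq Z :=
  if n is n'.+1 then acc :: powers p x ((acc * x) mod p)%Z n' else [::].

(* Represents newton modulo p, without the trailing zeros; pows lists the powers of o. *)
Fixpoint newton_row (p : Z) (d : nat) (nodes : seq Z) (acc l : Z) (pows : seq Z) : seq Z :=
  if d is d'.+1 then
    if (acc =? 0)%Z then [::] else
    [seq ((acc * w) mod p)%Z | w <- pows] ++
    newton_row p d' (behead nodes) ((acc * (l - head 0%Z nodes)) mod p)%Z l (take d' pows)
  else [::].

Lemma size_powers p x acc n : size (powers p x acc n) = n.
Proof. by elim: n acc => //= n IH acc; rewrite IH. Qed.

Lemma nth_powers (p : nat) x acc n i : prime p -> (i < n)%N ->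
  zF p (nth 0%Z (powers (Z.of_nat p) x acc n) i) = zF p acc * zF p x ^+ i.
Proof.
move=> p_pr; elim: n acc i => [//|n IH] acc [|i] /= lt_i; first by rewrite mulr1.
by rewrite IH // zF_mod // zFM exprS mulrA.
Qed.

Lemma nth_newton_row (p : nat) d nodes acc l o pows j : prime p -> size pows = d ->
  (forall i, (i < d)%N -> zF p (nth 0%Z pows i) = zF p o ^+ i) ->
  zF p (nth 0%Z (newton_row (Z.of_nat p) d nodes acc l pows) j) =
    nth 0 (newton d (map (zF p) nodes) (zF p acc) (zF p l) (zF p o)) j.
Proof.
move=> p_pr; elim: d nodes acc pows j => [|d IH] nodes acc pows j sp hp.
  by rewrite !nth_nil.
rewrite [newton_row _ _ _ _ _ _]/=; case: Z.eqb_spec => [->|_].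
  by rewrite newton0 nth_nil.
rewrite newtonS !nth_cat size_mkseq size_map sp; case: ifP => lt_j.
  by rewrite nth_mkseq // (nth_map 0%Z) ?sp // zF_mod // zFM hp.
rewrite IH ?size_takel ?sp // => [|i lt_i]; last first.
  by rewrite nth_take // hp // ltnS ltnW.
rewrite zF_mod // zFM /Z.sub zFD zFN.
by congr (nth _ (newton _ _ (_ * (_ - _)) _ _) _); case: (nodes).
Qed.

(** The values of the Newton basis at the points form a square integer matrix. Full rank modulo [p]
    makes its determinant nonzero modulo [p], hence nonzero in [algC], and the inverse matrix gives
    the coefficients of the interpolant. *)
Lemma fits_newton d (p : nat) nodes (l o : point -> Z) A : prime p -> size A = triangle d ->
  (exists a b c, forall z, l z = (a * z.1 + b * z.2 + c)%Z) ->
  (exists a b c, forall z, o z = (a * z.1 + b * z.2 + c)%Z) ->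
  full_rank (Z.of_nat p)
    [seq newton_row (Z.of_nat p) d nodes 1 (l a)
      (powers (Z.of_nat p) (o a mod Z.of_nat p) 1 d) | a <- A]
    (nseq (triangle d) None) ->
  fits d A.
Proof.
move=> p_pr szA [al [bl [cl lE]]] [ao [bo [co oE]]] full h.
set n := triangle d in szA full.
pose a0 : point := (0%Z, 0%Z).
pose g (a : point) : seq int := newton d (map int_of_Z nodes) 1 (int_of_Z (l a)) (int_of_Z (o a)).
have sz_g a : size (g a) = n by rewrite size_newton.
pose B : 'M[int]_n := \matrix_(i, j) (g (nth a0 A i))`_j.
have zF_rmorph z : zF p z = (int_of_Z z)%:~R by [].
(* A row vector killed by the transpose is orthogonal to all rows of [B], and the elimination shows
   such a vector to be zero. *)
have unitB : map_mx (intr : int -> 'F_p) B \in unitmx.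
  rewrite -unitmx_tr -row_free_unit; apply: inj_row_free => v vB0.
  pose w := [seq v 0 i | i <- enum 'I_n].
  have szw : size w = n by rewrite size_map size_enum_ord.
  have nth_w (i : 'I_n) : w`_i = v 0 i.
    by rewrite (nth_map i) ?size_enum_ord // nth_ord_enum.
  have w0 : w = nseq (size w) 0.
    apply: (full_rank_kills p_pr full); first by rewrite size_nseq.
      by elim: (n) w {szw nth_w} => [|m IH] [|c w] //=; split.
    move=> _ /mapP [a aA ->]; rewrite dotE.
    have /(nthP a0) [i lt_i aE] := aA; rewrite szA in lt_i.
    have := congr1 (fun M : 'rV_n => M 0 (Ordinal lt_i)) vB0; rewrite !mxE => e0.
    rewrite -[RHS]e0 szw; apply: eq_bigr => j _; rewrite !mxE nth_w mulrC; congr (_ * _).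
    rewrite (@nth_newton_row p _ _ _ _ (o a)) ?size_powers //= => [|k lt_k]; last first.
      by rewrite nth_powers // zF_mod // (_ : zF p 1%Z = 1) ?mul1r.
    rewrite aE -(nth_map _ 0) ?sz_g // map_newton -map_comp; congr (nth _ (newton _ _ _ _ _) _).
  by apply/rowP => i; rewrite -nth_w w0 nth_nseq if_same mxE.
have unitC : map_mx (intr : int -> algC) B \in unitmx.
  move: unitB; rewrite !unitmxE !unitfE !det_map_mx intr_eq0.
  by apply: contra => /eqP ->.
pose w := invmx (map_mx (intr : int -> algC) B) *m (\col_i h (nth a0 A i)).
pose aff a b c x y : algC := zC a * x + zC b * y + zC c.
have affE f a b c z : (forall z : point, f z = (a * z.1 + b * z.2 + c)%Z) ->
    zC (f z) = aff a b c (zC z.1) (zC z.2).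
  by move=> ->; rewrite /aff !zCD !zCM.
exists (fun x y => \sum_(j <- enum 'I_n) w j 0 *
  (newton d (map zC nodes) 1 (aff al bl cl x y) (aff ao bo co x y))`_j).
  apply: polyfun_sum => j; rewrite -[X in polyfun X _]addn0.
  apply: (@polyfun_newton d 0 _ (fun _ _ => 1) (aff al bl cl) (aff ao bo co)).
  - by move=> m q hq; rewrite addn0; apply: polyfun_eq hq => x y; rewrite mul1r.
  - move=> m q c hq; apply: polyfun_eq (polyfun_affine (zC al) (zC bl) (zC cl - c) hq) => x y.
    by rewrite /aff addrA.
  - by move=> m q hq; apply: polyfun_affine.
move=> _ /(nthP a0) [i lt_i <-]; rewrite szA in lt_i.
have := mulKVmx unitC (\col_i h (nth a0 A i)); rewrite -/w.
move/(congr1 (fun M : 'cV_n => M (Ordinal lt_i) 0)); rewrite !mxE /= => <-.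
rewrite big_enum; apply: eq_bigr => j _; rewrite !mxE mulrC; congr (_ * _).
rewrite -(affE _ _ _ _ _ lE) -(affE _ _ _ _ _ oE) -[RHS](nth_map 0 0 intr) ?sz_g //.
by rewrite map_newton -map_comp rmorph1; congr (nth _ (newton _ _ _ _ _) _).
Qed.

Fixpoint tally_insert (v : Z) (t : seq (Z * nat)) : seq (Z * nat) :=
  if t is (w, n) :: t' then
    if (v =? w)%Z then (w, n.+1) :: t' else (w, n) :: tally_insert v t'
  else [:: (v, 1)].

Definition line_tally (A : seq point) (uv : Z * Z) : seq (Z * nat) :=
  foldl (fun t a => tally_insert (lin uv.1 uv.2 a) t) [::] A.

(* Once a direction has been used, it is tried first. *)
Fixpoint next_line (d : nat) (A : seq point) (dirs tried : seq (Z * Z)) :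
    option (Z * Z * Z * seq (Z * Z)) :=
  if dirs is uv :: dirs' then
    if [seq x.1 | x <- line_tally A uv & x.2 == d] is c :: _ then Some (uv, c, dirs ++ tried)
    else next_line d A dirs' (rcons tried uv)
  else None.

(* Gaussian elimination is fastest when the points lie on few parallel lines and the nodes of
   the basis run through these lines.  The determinants that occur below do not vanish mod 29. *)
Definition unisolvent (dirs : seq (Z * Z)) (d : nat) (A : seq point) : bool :=
  let best := foldl (fun x uv => let t := line_tally A uv in
    if (size t < size x.2)%N then (uv, t) else x) (0, 1, line_tally A (0, 1))%Z dirs in
  let: (u, v) := best.1 in
  let nodes := [seq x.1 | x <- sort (fun x y : Z * nat => (y.2 <= x.2)%N) best.2] in
  let rank a := find (Z.eqb (lin u v a)) nodes in
  let B := sort (fun a b => (rank a <= rank b)%N) A in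
  let o (a : point) := if (u =? 0)%Z then a.1 else a.2 in
  if size A == triangle d then
    full_rank 29
      [seq newton_row 29 d nodes 1 (lin u v a) (powers 29 (o a mod 29) 1 d) | a <- B]
      (nseq (triangle d) None)
  else false.

Lemma unisolvent_sound dirs d A : unisolvent dirs d A -> fits d A.
Proof.
rewrite /unisolvent; case: (foldl _ _ _).1 => u v.
case: eqP => // szA full.
apply: (fits_sub _ (@fits_newton d 29 _ _ _ _ _ _ _ _ full)) => //.
- by move=> a; rewrite mem_sort.
- by rewrite size_sort.
- by exists u, v, 0%Z => z; rewrite /lin; lia.
by case: (u =? 0)%Z; [exists 1%Z, 0%Z, 0%Z | exists 0%Z, 1%Z, 0%Z] => z; lia.
Qed.

(** Greedy peeling of lines with exactly d points. The number of removed points is tested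
    afterwards, so [next_line] acts only as a hint. When no listed direction has such a line,
    elimination decides about the remaining points in the remaining degree. *)
Fixpoint fitsb_rec (dirs : seq (Z * Z)) (d : nat) (A : seq point) : bool :=
  if d is d'.+1 then
    if next_line d A dirs [::] is Some (uv, c, dirs') then
      let B := [seq a <- A | negb (lin uv.1 uv.2 a =? c)%Z] in
      if (size A <= size B + d)%N then fitsb_rec dirs' d' B else false
    else unisolvent dirs d A
  else nilp A.

Lemma fitsb_rec_sound dirs d A : fitsb_rec dirs d A -> fits d A.
Proof.
elim: d A dirs => [|d IH] A dirs; first by move/nilP ->; apply: fits_size.
rewrite [fitsb_rec _ _ _]/=; case: (next_line _ _ _ _) => [[[uv c] dirs']|]; last first.
  exact: unisolvent_sound.
case: ifP => // szB /IH fB.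
apply: (@fits_peel d A uv.1 uv.2 c) => //.
have := count_predC (fun a => lin uv.1 uv.2 a == c) A.
move: szB; rewrite size_filter.
rewrite (eq_count (a2 := predC (fun a => lin uv.1 uv.2 a == c))) //; lia.
Qed.

Definition fitsb : nat -> seq point -> bool :=
  fitsb_rec [:: (0, 1); (1, 0); (1, -1); (1, 1); (1, -2); (2, -1); (1, 2); (2, 1);
      (1, -3); (3, -1); (3, -2); (2, -3); (1, 3); (3, 1)]%Z.

Lemma fitsb_sound d A : fitsb d A -> fits d A.
Proof. exact: fitsb_rec_sound. Qed.

(* Cut u v c t1 t2 uses t1 where u x + v y >= c and t2 elsewhere; Leaf m u v stands for
   m nodes, one for each residue class of u x + v y modulo m. *)
Inductive tree := Leaf (m : nat) (u v : Z) | Cut (u v c : Z) (t1 t2 : tree).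

Fixpoint tree_nodes (t : tree) : nat :=
  match t with
  | Leaf m _ _ => m
  | Cut _ _ _ t1 t2 => tree_nodes t1 + tree_nodes t2
  end.

Fixpoint tree_check (d : nat) (t : tree) (A : seq point) : bool :=
  match t with
  | Leaf m u v => (0 < m)%N && all (fun r =>
      fitsb d [seq a <- A | (lin u v a mod Z.of_nat m =? Z.of_nat r)%Z]) (iota 0 m)
  | Cut u v c t1 t2 =>
      tree_check d t1 [seq a <- A | (c <=? lin u v a)%Z] &&
      tree_check d t2 [seq a <- A | (lin u v a <? c)%Z]
  end.

Lemma tree_check_sound d t A : tree_check d t A -> solvable d (tree_nodes t) (mem A).
Proof.
elim: t A => [m u v|u v c t1 IH1 t2 IH2] A /=.
  case/andP => m0 /allP hA; apply: (solvable_torsion (u := u) (v := v)) => // r.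
  by apply: fitsb_sound; apply: hA; rewrite mem_iota /=.
case/andP => /IH1 h1 /IH2 h2; rewrite addnC.
apply: (solvable_sub _ (solvable_cut (u := u) (v := v) (c := c) _ _ h2 h1)).
- by move=> a /= aA; rewrite !mem_filter aA !andbT Z.ltb_antisym orNb.
- by move=> a /=; rewrite mem_filter => /andP [/Z.ltb_lt].
- by move=> a /=; rewrite mem_filter => /andP [/Z.leb_le].
Qed.

(** * Strips *)

Definition zrange (lo hi : Z) : seq Z :=
  [seq (lo + Z.of_nat i)%Z | i <- iota 0 (Z.to_nat (hi - lo + 1))].

Lemma mem_zrange lo hi x : (x \in zrange lo hi) = (lo <=? x)%Z && (x <=? hi)%Z.
Proof.
apply/mapP/andP => [[i]|[lo_x x_hi]].
  by rewrite mem_iota => lt_i ->; lia.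
exists (Z.to_nat (x - lo)); last by lia.
by rewrite mem_iota; lia.
Qed.

(* Rows 0..h, where row y is 0 <= x <= W + y, except that row 0 starts at p and row h
   stops before e. *)
Definition strip (h p e W : Z) (a : point) : bool :=
  [&& (0 <=? a.2)%Z && (a.2 <=? h)%Z, (0 <=? a.1)%Z, (a.1 <=? W + a.2)%Z,
      (a.2 =? 0)%Z ==> (p <=? a.1)%Z & (a.2 =? h)%Z ==> (a.1 <? e)%Z].

Definition strip_points (h p e W : Z) : seq point :=
  [seq (x, y) | y <- zrange 0 h,
    x <- zrange (if (y =? 0)%Z then p else 0%Z) (if (y =? h)%Z then (e - 1)%Z else (W + y)%Z)].

(* Rows y0..y1, with D points in each row. *)
Definition band (u v c D y0 y1 : Z) (a : point) : bool :=
  [&& (y0 <=? a.2)%Z, (a.2 <=? y1)%Z, (c <=? lin u v a)%Z & (lin u v a <? c + u * D)%Z].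

(** The quotient is the ceiling of (c - v y) / u, the first abscissa of row y in the band. *)
Definition band_points (u v c D y0 y1 : Z) : seq point :=
  [seq ((c - v * y + u - 1) / u + x, y)%Z | y <- zrange y0 y1, x <- zrange 0 (D - 1)].

Lemma mem_strip_points h p e W a : strip h p e W a -> a \in strip_points h p e W.
Proof.
case: a => x y /and5P [/= /andP [y0 yh] x0 xW xp xe]; apply/allpairsPdep; exists y, x.
by split=> //; rewrite mem_zrange; [lia|case: Z.eqb_spec xp; case: Z.eqb_spec xe => /=; lia].
Qed.

Lemma mem_band_points u v c D y0 y1 a : (0 <? u)%Z ->
  band u v c D y0 y1 a -> a \in band_points u v c D y0 y1.
Proof.
move=> u0; case: a => x y /and4P [/= yy0 yy1]; rewrite /lin /= => cx xD.
apply/allpairsPdep; exists y, (x - (c - v * y + u - 1) / u)%Z.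
rewrite !mem_zrange; have := Z.div_mod (c - v * y + u - 1) u.
have := Z.mod_pos_bound (c - v * y + u - 1) u.
set q := ((c - v * y + u - 1) / u)%Z; set r := (_ mod _)%Z => r_b q_r.
split; [lia| |by congr pair; lia].
by apply/andP; split; nia.
Qed.

Definition option_check (d : nat) (o : option tree) (A : seq point) : bool :=
  if o is Some t then tree_check d t A else nilp A.

Definition option_nodes (o : option tree) : nat :=
  if o is Some t then tree_nodes t else 0.

Lemma option_check_sound d o A : option_check d o A -> solvable d (option_nodes o) (mem A).
Proof.
by case: o => [t|] /=; [exact: tree_check_sound|move/nilP ->; apply: solvable0].
Qed.

Lemma band_shift d m u v c D y0 y1 s :
  solvable d m (band u v c D y0 y1) -> solvable d m (band u v (c + u * s) D y0 y1).
Proof.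
move/(solvable_shift (s, 0%Z)); apply: solvable_sub => a; rewrite /band /lin; cbn [fst snd]; lia.
Qed.

(** The new block leans along the slanted right end, from x - y = W + 1 on; it leaves out row [h],
    which ends at the fixed abscissa [e]. *)
Lemma strip_right d m h p e W D : (e <=? W + h + 1)%Z ->
  solvable d 2 (band 1 (-1) 0 D 0 (h - 1)) ->
  solvable d m (strip h p e W) -> solvable d (m + 2) (strip h p e (W + D)).
Proof.
move=> eW /(band_shift (W + 1)%Z) hB hS.
apply: solvable_sub (solvable_cut (u := 1) (v := -1) (c := (W + 1)%Z) _ _ hS hB).
- by move=> a; rewrite /strip /band /lin; lia.
- by move=> a; rewrite /strip /lin; lia.
- by move=> a; rewrite /band /lin; lia.
Qed.

(** The old strip is translated by [D] and an upright block fills the gap in rows 1, ..., h; row 0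
    gets no new points, its start moves instead. *)
Lemma strip_left d m h p e W D : (0 <=? p)%Z ->
  solvable d 2 (band 1 0 0 D 1 h) ->
  solvable d m (strip h p e W) -> solvable d (m + 2) (strip h (p + D) (e + D) (W + D)).
Proof.
move=> p0 hB /(solvable_shift (D, 0%Z)) hS; rewrite addnC.
apply: solvable_sub (solvable_cut (u := 1) (v := 0) (c := D) _ _ hB hS).
- by move=> a; rewrite /strip /band /lin; cbn [fst snd]; lia.
- by move=> a; rewrite /band /lin; lia.
- by move=> a; rewrite /strip /lin; cbn [fst snd]; lia.
Qed.

Lemma strip_grow d m h p e W D l n :
  (0 <=? p)%Z -> (0 <=? D)%Z -> (e <=? W + h + 1)%Z ->
  solvable d 2 (band 1 0 0 D 1 h) -> solvable d 2 (band 1 (-1) 0 D 0 (h - 1)) ->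
  solvable d m (strip h p e W) ->
  solvable d (m + 2 * (l + n)) (strip h (p + Z.of_nat l * D) (e + Z.of_nat l * D)
    (W + Z.of_nat (l + n) * D)).
Proof.
move=> p0 D0 eW hL hR hS.
have {hS} : solvable d (m + 2 * n) (strip h p e (W + Z.of_nat n * D)).
  elim: n => [|n IH]; first by rewrite addn0 Z.add_0_r.
  rewrite mulnS addnCA addnC Nat2Z.inj_succ Z.mul_succ_l Z.add_assoc.
  by apply: strip_right hR IH; nia.
elim: l => [|l IH]; first by rewrite !Z.add_0_r.
move=> /IH {}IH; rewrite addSn mulnS addnCA addnC !Nat2Z.inj_succ !Z.mul_succ_l !Z.add_assoc.
by apply: strip_left hL IH; nia.
Qed.

(** The second group of inequalities says that the line u x + v y = c crosses every row: the lattice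
    point just before a row is below the line, the one just after it is not. The ends of rows 1,
    ..., h on the left and 0, ..., h - 1 on the right are collinear, so extreme rows are enough.
    Hence [D] points can be inserted along the line in all h + 1 rows. *)
Lemma strip_stretchA d mL mR h p e W D u v c t :
  [&& (0 <? u), (0 <=? p), (0 <=? D), (e <=? W + h + 1) & (1 <=? h)]%Z ->
  [&& (c <=? u * (W + 1)) && (c <=? u * (W + h) + v * (h - 1)), (c <=? u * e + v * h),
      (u * (p - 1) <? c), (- u + v <? c) & (- u + v * h <? c)]%Z ->
  solvable d mL (fun a => strip h p e W a && (lin u v a <? c)%Z) ->
  solvable d 2 (band u v c D 0 h) ->
  solvable d mR (fun a => strip h p e W a && (c <=? lin u v a)%Z) ->
  solvable d (mL + (mR + 2 * t)) (strip h p (e + Z.of_nat t * D) (W + Z.of_nat t * D)).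
Proof.
case/and5P => u0 p0 D0 eW h1 /and5P [/andP [c1 c2] c3 c4 c5 c6] hL hB hR.
(* The part beyond the line grows by induction: one block along the line, then the previous part
   translated by [D]. *)
have {}hR : solvable d (mR + 2 * t) (fun a =>
    strip h p (e + Z.of_nat t * D) (W + Z.of_nat t * D) a && (c <=? lin u v a)%Z).
  elim: t => [|t IH]; first by rewrite addn0 !Z.add_0_r.
  rewrite mulnS addnCA.
  apply: solvable_sub (solvable_cut (u := u) (v := v) (c := (c + u * D)%Z) _ _ hB
    (solvable_shift (D, 0%Z) IH)).
  - move=> a; rewrite Nat2Z.inj_succ Z.mul_succ_l !Z.add_assoc /strip /band /lin /=.
    move=> /andP [/and5P [/andP [y0 yh] x0 xW xp xe] ca].
    have [lt_a|ge_a] := Z.ltb_spec (u * a.1 + v * a.2) (c + u * D).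
      by rewrite y0 yh ca.
    apply/orP; right.
    have xD : (u * (a.1 - D) + v * a.2 >= c)%Z by lia.
    have [y0'|y0'] := Z.eqb_spec a.2 0.
      have ? : (p <= a.1 - D)%Z by nia.
      by lia.
    have ? : (0 <= a.1 - D)%Z by nia.
    by lia.
  - by move=> a /and4P [_ _ _ /Z.ltb_lt].
  - by move=> a /andP [_]; rewrite /lin; cbn [fst snd]; lia.
apply: solvable_sub (solvable_cut (u := u) (v := v) (c := c) _ _ hL hR).
- move=> a Sa; rewrite Sa /=; case: Z.leb_spec => [_|lt_a]; first by rewrite orbT.
  rewrite orbF (proj2 (Z.ltb_lt _ _) lt_a) andbT.
  move: Sa lt_a; rewrite /strip /lin => /and5P [/andP [y0 yh] x0 xW xp xe] lt_a.
  have xe' : (a.2 =? h)%Z ==> (a.1 <? e)%Z.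
    by apply/implyP => /Z.eqb_spec y_h; move: lt_a; rewrite y_h; nia.
  rewrite y0 yh x0 xp xe' !andbT /=.
  have [y_h|y_h] := Z.eqb_spec a.2 h; first by move: xe'; rewrite y_h Z.eqb_refl /=; lia.
  apply/Z.leb_le/Znot_gt_le => gt_x.
  have : (c <= u * (W + 1 + a.2) + v * a.2)%Z by nia.
  by nia.
- by move=> a /andP [_ /Z.ltb_lt].
- by move=> a /andP [_ /Z.leb_le].
Qed.

(** Here row 0 lies entirely beyond the line and row [h] entirely before it, so both keep their
    lengths, row 0 being translated; points are inserted in rows 1, ..., h - 1. *)
Lemma strip_stretchT d mL mR h p e W D u v c t :
  [&& (0 <? u), (0 <=? p), (0 <=? D), (e <=? W + h + 1) & (2 <=? h)]%Z ->
  [&& (c <=? u * (W + 2) + v) && (c <=? u * (W + h) + v * (h - 1)), (c <=? u * p),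
      (u * (e - 1) + v * h <? c), (- u + v <? c) & (- u + v * (h - 1) <? c)]%Z ->
  solvable d mL (fun a => strip h p e W a && (lin u v a <? c)%Z) ->
  solvable d 2 (band u v c D 1 (h - 1)) ->
  solvable d mR (fun a => strip h p e W a && (c <=? lin u v a)%Z) ->
  solvable d (mL + (mR + 2 * t)) (strip h (p + Z.of_nat t * D) e (W + Z.of_nat t * D)).
Proof.
case/and5P => u0 p0 D0 eW h1 /and5P [/andP [c1 c2] c3 c4 c5 c6] hL hB hR.
have {}hR : solvable d (mR + 2 * t) (fun a =>
    strip h (p + Z.of_nat t * D) e (W + Z.of_nat t * D) a && (c <=? lin u v a)%Z).
  elim: t => [|t IH]; first by rewrite addn0 !Z.add_0_r.
  rewrite mulnS addnCA.
  apply: solvable_sub (solvable_cut (u := u) (v := v) (c := (c + u * D)%Z) _ _ hB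
    (solvable_shift (D, 0%Z) IH)).
  - move=> a; rewrite Nat2Z.inj_succ Z.mul_succ_l !Z.add_assoc /strip /band /lin /=.
    move=> /andP [/and5P [/andP [y0 yh] x0 xW xp xe] ca].
    have y_h : a.2 <> h.
      by move=> y_h; move: ca xe; rewrite y_h Z.eqb_refl /=; nia.
    have [lt_a|ge_a] := Z.ltb_spec (u * a.1 + v * a.2) (c + u * D).
      have y_0 : a.2 <> 0%Z.
        by move=> y_0; move: lt_a xp; rewrite y_0 /=; nia.
      by lia.
    apply/orP; right.
    have [y_0|y_0] := Z.eqb_spec a.2 0.
      have ? : (0 <= Z.of_nat t * D)%Z by apply: Z.mul_nonneg_nonneg; lia.
      by lia.
    have ? : (0 <= a.1 - D)%Z.
      apply/Znot_gt_le => lt_x.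
      (* A linear function of the row is largest in one of the extreme rows 1 and h - 1. *)
      have : (v * a.2 <= v * (h - 1) \/ v * a.2 <= v)%Z.
        by have [v0|v0] := Z.le_ge_cases 0 v; [left|right]; nia.
      have : (u * (a.1 - D + 1) <= 0)%Z by nia.
      by lia.
    by lia.
  - by move=> a /and4P [_ _ _ /Z.ltb_lt].
  - by move=> a /andP [_]; rewrite /lin; cbn [fst snd]; lia.
apply: solvable_sub (solvable_cut (u := u) (v := v) (c := c) _ _ hL hR).
- move=> a Sa; rewrite Sa /=; case: Z.leb_spec => [_|lt_a]; first by rewrite orbT.
  rewrite orbF (proj2 (Z.ltb_lt _ _) lt_a) andbT.
  move: Sa lt_a; rewrite /strip /lin => /and5P [/andP [y0 yh] x0 xW xp xe] lt_a.
  have tD0 : (0 <= Z.of_nat t * D)%Z by apply: Z.mul_nonneg_nonneg; lia.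
  have y_0 : a.2 <> 0%Z.
    move=> y_0; have p_x : (p <= a.1)%Z by lia.
    by move: lt_a; rewrite y_0; nia.
  rewrite y0 yh x0 xe /=.
  have [y_h|y_h] := Z.eqb_spec a.2 h; first by move: xe; rewrite y_h Z.eqb_refl /=; lia.
  have : (a.1 <= W + a.2)%Z.
    apply/Znot_gt_le => gt_x.
    have : ((u + v) * 1 <= (u + v) * a.2 \/ (u + v) * (h - 1) <= (u + v) * a.2)%Z.
      by have [v0|v0] := Z.le_ge_cases 0 (u + v); [left|right]; nia.
    have : (u * (W + a.2 + 1) <= u * a.1)%Z by nia.
    by lia.
  by lia.
- by move=> a /andP [_ /Z.ltb_lt].
- by move=> a /andP [_ /Z.leb_le].
Qed.

(** * Certificates for the two families of strips *)

Definition cut := (Z * Z * Z)%type.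

(** Modulo 1 there is only one residue class, so this is one node for one cell. *)
Definition single : tree := Leaf 1 0 0.

Definition cut_off (cs : seq cut) (t : tree) : tree :=
  foldr (fun c => Cut c.1.1 c.1.2 c.2 single) t cs.

Definition comb (cs : seq cut) : tree := cut_off cs single.

(* A line cutting a strip in two, the cells before it and after it, and the two cells
   inserted along it when the strip gets longer. *)
Definition stretch := (cut * option (seq cut) * seq cut * seq cut)%type.

(* The entries of baseA and baseT (j = 0) and of stretchA and stretchT (j > 0) are indexed by p,
   see shape; extra lists further strips (isA, p, j, i), and direct lists subdivisions of the
   strip between the diagrams for k' and for k nodes, as (k, k', tree). *)
Record certificate := Certificate {
  baseA : seq (seq cut);
  stretchA : seq stretch;
  baseT : seq (seq cut);
  stretchT : seq stretch;
  extra : seq (bool * Z * Z * nat * seq cut);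
  direct : seq (nat * nat * tree)
}.

Definition cells_check d (t : tree) (n : nat) (A : seq point) : bool :=
  (tree_nodes t == n) && tree_check d t A.

(** The candidate cuts are the two diagonals of the block, upright in the first list and sheared in
    the second, with offsets for D = h + 1 and D = h - 1. The matching diagonal leaves two triangles
    of d(d+1)/2 points. *)
Definition block_check d (h D : Z) : bool :=
  [&& has (fun c => cells_check d (comb [:: c]) 2 (band_points 1 0 0 D 1 h))
        [:: (1, 1, D); (1, -1, 0); (1, 1, D + 1); (1, -1, -1)]%Z
    & has (fun c => cells_check d (comb [:: c]) 2 (band_points 1 (-1) 0 D 0 (h - 1)))
        [:: (1, 0, D); (1, -2, 0); (1, 0, D - 1); (1, -2, 1)]%Z].

Definition halves_check d (s : stretch) (n : nat) (A : seq point) : bool :=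
  let: (u, v, c, l, _, r) := s in
  [&& option_check d (omap comb l) [seq a <- A | (lin u v a <? c)%Z],
      tree_check d (comb r) [seq a <- A | (c <=? lin u v a)%Z]
    & option_nodes (omap comb l) + tree_nodes (comb r) == n].

Definition stretchA_check d (h p e W D : Z) (n : nat) (s : stretch) : bool :=
  let: (u, v, c, _, m, _) := s in
  [&& [&& (0 <? u), (0 <=? p), (0 <=? D), (e <=? W + h + 1) & (1 <=? h)]%Z,
      [&& (c <=? u * (W + 1)) && (c <=? u * (W + h) + v * (h - 1)), (c <=? u * e + v * h),
          (u * (p - 1) <? c), (- u + v <? c) & (- u + v * h <? c)]%Z,
      halves_check d s n (strip_points h p e W)
    & cells_check d (comb m) 2 (band_points u v c D 0 h)].

Definition stretchT_check d (h p e W D : Z) (n : nat) (s : stretch) : bool :=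
  let: (u, v, c, _, m, _) := s in
  [&& [&& (0 <? u), (0 <=? p), (0 <=? D), (e <=? W + h + 1) & (2 <=? h)]%Z,
      [&& (c <=? u * (W + 2) + v) && (c <=? u * (W + h) + v * (h - 1)), (c <=? u * p),
          (u * (e - 1) + v * h <? c), (- u + v <? c) & (- u + v * (h - 1) <? c)]%Z,
      halves_check d s n (strip_points h p e W)
    & cells_check d (comb m) 2 (band_points u v c D 1 (h - 1))].

(* (h, p, e, W, D) for the strips with 2i+1 cells, of height d (isA) or d+1; D is the width
   of the blocks of two cells at both ends. *)
Definition shape (d : Z) (isA : bool) (p j i : Z) : Z * Z * Z * Z * Z :=
  if isA then (d, p, p + d * j, (d + 1) * i - j, d + 1)%Z
  else (d + 1, p + (d + 1) * j, p, d * i + j - 1, d)%Z.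

Definition shape_points (d : Z) isA p j i : seq point :=
  let: (h, p, e, W, _) := shape d isA p j i in strip_points h p e W.

(** Each [i] is the least for which row 0 has nonnegative length, that is p' <= W + 1. Residues of p
    modulo d + 1 (modulo d for height d + 1) and j = 0, 1 are checked; larger p and j are reached by
    inserting blocks. *)
Definition certificate_check (d : nat) (C : certificate) : bool :=
  let dz := Z.of_nat d in
  [&& block_check d dz (dz + 1) && block_check d (dz + 1) dz,
      all (fun p => let i := (if (1 < p)%N then 1 else 0)%N in
        cells_check d (comb (nth [::] (baseA C) p)) (2 * i + 1)
          (shape_points dz true (Z.of_nat p) 0 (Z.of_nat i))) (iota 0 d.+1)
      && all (fun p => let i := (if (0 < p)%N then 1 else 0)%N in
        let: (h, p', e, W, _) := shape dz true (Z.of_nat p) 1 (Z.of_nat i) in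
        stretchA_check d h p' e W dz (2 * i + 1)
          (nth (0%Z, 0%Z, 0%Z, None, [::], [::]) (stretchA C) p))
        (iota 0 d.+1),
      all (fun p => let i := (if (0 < p)%N then 1 else 0)%N in
        cells_check d (comb (nth [::] (baseT C) p)) (2 * i + 1)
          (shape_points dz false (Z.of_nat p) 0 (Z.of_nat i))) (iota 0 d)
      && all (fun p => let i := (if (0 < p)%N then 2 else 1)%N in
        let: (h, p', e, W, _) := shape dz false (Z.of_nat p) 1 (Z.of_nat i) in
        stretchT_check d h p' e W (dz + 1) (2 * i + 1)
          (nth (0%Z, 0%Z, 0%Z, None, [::], [::]) (stretchT C) p))
        (iota 0 d),
      all (fun x => let: (isA, p, j, i, cs) := x in
        let: (h, p', e, W, D) := shape dz isA p j (Z.of_nat i) in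
        [&& (0 <=? p')%Z, (e <=? W + h + 1)%Z &
          cells_check d (comb cs) (2 * i + 1) (strip_points h p' e W)]) (extra C)
    & (0 < d)%N].

Section Certificate.

Variables (d : nat) (C : certificate).
Hypothesis C_ok : certificate_check d C.
Let dz := Z.of_nat d.

Lemma d_gt0 : (0 < d)%N.
Proof. by case/and5P: C_ok. Qed.

Lemma cells_check_sound t n A : cells_check d t n A -> solvable d n (mem A).
Proof. by case/andP => /eqP <-; apply: tree_check_sound. Qed.

Lemma cells_check_strip t n h p e W :
  cells_check d t n (strip_points h p e W) -> solvable d n (strip h p e W).
Proof.
by move/cells_check_sound; apply: solvable_sub => a; apply: mem_strip_points.
Qed.

Lemma cells_check_band t n u v c D y0 y1 : (0 <? u)%Z ->
  cells_check d t n (band_points u v c D y0 y1) -> solvable d n (band u v c D y0 y1).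
Proof.
by move=> u0 /cells_check_sound; apply: solvable_sub => a; apply: mem_band_points.
Qed.

Lemma block_check_sound h D : block_check d h D ->
  solvable d 2 (band 1 0 0 D 1 h) /\ solvable d 2 (band 1 (-1) 0 D 0 (h - 1)).
Proof.
by case/andP => /hasP [c _ h1] /hasP [c' _ h2]; split; apply: cells_check_band; eauto.
Qed.

Lemma halves_check_sound u v c l m r n h p e W :
  halves_check d (u, v, c, l, m, r) n (strip_points h p e W) -> exists mL mR,
  [/\ n = (mL + mR)%N,
      solvable d mL (fun a => strip h p e W a && (lin u v a <? c)%Z) &
      solvable d mR (fun a => strip h p e W a && (c <=? lin u v a)%Z)].
Proof.
case/and3P => /option_check_sound hL /tree_check_sound hR /eqP <-.
exists (option_nodes (omap comb l)), (tree_nodes (comb r)); split=> //.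
  by apply: solvable_sub hL => a /andP [aS ac]; rewrite /= mem_filter ac mem_strip_points.
by apply: solvable_sub hR => a /andP [aS ac]; rewrite /= mem_filter ac mem_strip_points.
Qed.

Lemma stretchA_sound h p e W D n s t : stretchA_check d h p e W D n s ->
  solvable d (n + 2 * t) (strip h p (e + Z.of_nat t * D) (W + Z.of_nat t * D)).
Proof.
case: s => [[[[[u v] c] l] m] r] /and4P [h1 h2 /halves_check_sound [mL [mR [-> hL hR]]] hB].
rewrite -addnA; apply: (strip_stretchA _ h1 h2) => //.
by apply: cells_check_band hB; case/and5P: h1.
Qed.

Lemma stretchT_sound h p e W D n s t : stretchT_check d h p e W D n s ->
  solvable d (n + 2 * t) (strip h (p + Z.of_nat t * D) e (W + Z.of_nat t * D)).
Proof.
case: s => [[[[[u v] c] l] m] r] /and4P [h1 h2 /halves_check_sound [mL [mR [-> hL hR]]] hB].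
rewrite -addnA; apply: (strip_stretchT _ h1 h2) => //.
by apply: cells_check_band hB; case/and5P: h1.
Qed.

(** A strip has h W + h(h+1)/2 + e - p points. In both shapes this is (2i+1) d(d+1)/2: [j] trades
    the difference of [e] and [p] against the width. *)
Definition solvable_shape isA p j i :=
  let: (h, p, e, W, _) := shape dz isA p j (Z.of_nat i) in
  solvable d (2 * i + 1) (strip h p e W).

(** Row 0 starts at most one past its end, and row [h] stops no later than the slanted side; outside
    this range the count of points would be wrong. *)
Definition valid_shape isA p j i :=
  let: (h, p, e, W, _) := shape dz isA p j (Z.of_nat i) in
  [&& (0 <=? p), (p <=? W + 1) & (e <=? W + h + 1)]%Z.

(** The [l] blocks on the left move [p] and [e] alike and the [n] blocks on the right move neither,
    so [j] is unchanged. *)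
Lemma shape_grow isA p j i l n :
  (let: (h, p, e, W, _) := shape dz isA p j (Z.of_nat i) in
   (0 <=? p)%Z && (e <=? W + h + 1)%Z) ->
  solvable_shape isA p j i ->
  solvable_shape isA (p + Z.of_nat l * (if isA then dz + 1 else dz))%Z j (i + l + n).
Proof.
case/and5P: C_ok => /andP [/block_check_sound [hA1 hA2] /block_check_sound [hT1 hT2]] _ _ _ _.
rewrite /solvable_shape /shape -/dz; case: isA => /andP [p0 eW].
  move/(strip_grow l n (D := (dz + 1)%Z) p0 _ eW hA1 hA2) => H.
  have -> : (2 * (i + l + n) + 1 = 2 * i + 1 + 2 * (l + n))%N by lia.
  have -> : ((dz + 1) * Z.of_nat (i + l + n) - j =
    (dz + 1) * Z.of_nat i - j + Z.of_nat (l + n) * (dz + 1))%Z by lia.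
  have -> : (p + Z.of_nat l * (dz + 1) + dz * j = p + dz * j + Z.of_nat l * (dz + 1))%Z by lia.
  by apply: H; lia.
move/(strip_grow l n (D := dz) p0 _ eW hT1 hT2) => H.
have -> : (2 * (i + l + n) + 1 = 2 * i + 1 + 2 * (l + n))%N by lia.
have -> : (dz * Z.of_nat (i + l + n) + j - 1 =
  dz * Z.of_nat i + j - 1 + Z.of_nat (l + n) * dz)%Z by lia.
have -> : (p + Z.of_nat l * dz + (dz + 1) * j = p + (dz + 1) * j + Z.of_nat l * dz)%Z by lia.
by apply: H; lia.
Qed.

(** Write p = q + l (d + 1) with q <= d. Start from the certified strip for q with j = 0, or from
    the one with j = 1 and insert j - 1 blocks along its line; then add [l] blocks on the left and
    the remaining ones on the right. *)
Lemma shapeA_solvable p j i : (0 <=? j)%Z -> valid_shape true p j i -> solvable_shape true p j i.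
Proof.
case/and5P: C_ok => _ /andP [/allP hb /allP hs] _ _ d0.
move=> j0; rewrite /valid_shape /shape => /and3P [p0 pW eW].
pose l := Z.to_nat (p / (dz + 1)); pose q := Z.to_nat (p mod (dz + 1)).
have [r_b p_lq] : (q <= d)%N /\ p = (Z.of_nat q + Z.of_nat l * (dz + 1))%Z.
  have := Z.mod_pos_bound p (dz + 1); have := Z.div_mod p (dz + 1).
  have := Z.div_pos p (dz + 1); rewrite /q /l /dz; nia.
have q_in : q \in iota 0 d.+1 by rewrite mem_iota; lia.
have [-> | j1] := Z.eqb_spec j 0.
  move: (hb _ q_in) => /=; set i0 := if _ then _ else _ => /cells_check_strip; rewrite -/dz => hS.
  have li : (i0 + l <= i)%N by rewrite /i0; case: ifP; nia.
  rewrite p_lq -(subnKC li); apply: (@shape_grow true (Z.of_nat q) 0 i0 l (i - (i0 + l))) => //.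
  by rewrite /shape; apply/andP; split; [lia|rewrite /i0; case: ifP; nia].
move: (hs _ q_in) => /=; set i1 := if _ then _ else _.
move=> /(@stretchA_sound _ _ _ _ _ _ _ (Z.to_nat (j - 1))).
rewrite -/dz => hS; pose i0 := (i1 + Z.to_nat (j - 1))%N.
(* The condition p <= W + 1 of [valid_shape] leaves room for the insertions and for the [l]
   blocks. *)
have li : (i0 + l <= i)%N.
  suff : (Z.of_nat i0 + Z.of_nat l <= Z.of_nat i)%Z by lia.
  have H : (Z.of_nat q <= (dz + 1) * (Z.of_nat i - j + 1 - Z.of_nat l))%Z by nia.
  by rewrite /i0 /i1; case: ifP => ?; nia.
rewrite p_lq -(subnKC li); apply: (@shape_grow true (Z.of_nat q) j i0 l (i - (i0 + l))).
  by rewrite /shape; apply/andP; split; [lia|rewrite /i0 /i1; case: ifP; nia].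
rewrite /solvable_shape /shape.
have -> : (2 * i0 + 1 = 2 * i1 + 1 + 2 * Z.to_nat (j - 1))%N by rewrite /i0; lia.
have -> : (Z.of_nat q + dz * j = Z.of_nat q + dz * 1 + Z.of_nat (Z.to_nat (j - 1)) * dz)%Z.
  by rewrite Z2Nat.id; lia.
have -> : ((dz + 1) * Z.of_nat i0 - j =
  (dz + 1) * Z.of_nat i1 - 1 + Z.of_nat (Z.to_nat (j - 1)) * dz)%Z.
  by rewrite /i0 Nat2Z.inj_add Z2Nat.id; lia.
exact: hS.
Qed.

Lemma shapeT_solvable p j i :
  (0 <=? j)%Z -> (0 <=? p)%Z -> valid_shape false p j i -> solvable_shape false p j i.
Proof.
case/and5P: C_ok => _ _ /andP [/allP hb /allP hs] _ d0.
move=> j0 p0; rewrite /valid_shape /shape => /and3P [_ pW eW].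
pose l := Z.to_nat (p / dz); pose q := Z.to_nat (p mod dz).
have [r_b p_lq] : (q < d)%N /\ p = (Z.of_nat q + Z.of_nat l * dz)%Z.
  have := Z.mod_pos_bound p dz; have := Z.div_mod p dz.
  have := Z.div_pos p dz; rewrite /q /l /dz; nia.
have q_in : q \in iota 0 d by rewrite mem_iota; lia.
have [-> | j1] := Z.eqb_spec j 0.
  move: (hb _ q_in) => /=; set i0 := if _ then _ else _ => /cells_check_strip; rewrite -/dz => hS.
  have li : (i0 + l <= i)%N by rewrite /i0; case: ifP; nia.
  rewrite p_lq -(subnKC li); apply: (@shape_grow false (Z.of_nat q) 0 i0 l (i - (i0 + l))) => //.
  by rewrite /shape; apply/andP; split; [lia|rewrite /i0; case: ifP; nia].
move: (hs _ q_in) => /=; set i1 := if _ then _ else _.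
move=> /(@stretchT_sound _ _ _ _ _ _ _ (Z.to_nat (j - 1))).
rewrite -/dz => hS; pose i0 := (i1 + Z.to_nat (j - 1))%N.
have li : (i0 + l <= i)%N.
  suff : (Z.of_nat i0 + Z.of_nat l <= Z.of_nat i)%Z by lia.
  have H : (Z.of_nat q <= dz * (Z.of_nat i - j - Z.of_nat l))%Z by nia.
  by rewrite /i0 /i1; case: ifP => ?; nia.
rewrite p_lq -(subnKC li); apply: (@shape_grow false (Z.of_nat q) j i0 l (i - (i0 + l))).
  by rewrite /shape; apply/andP; split; [nia|rewrite /i0 /i1; case: ifP; nia].
rewrite /solvable_shape /shape.
have -> : (2 * i0 + 1 = 2 * i1 + 1 + 2 * Z.to_nat (j - 1))%N by rewrite /i0; lia.
have -> : (Z.of_nat q + (dz + 1) * j =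
  Z.of_nat q + (dz + 1) * 1 + Z.of_nat (Z.to_nat (j - 1)) * (dz + 1))%Z.
  by rewrite Z2Nat.id; lia.
have -> : (dz * Z.of_nat i0 + j - 1 =
  dz * Z.of_nat i1 + 1 - 1 + Z.of_nat (Z.to_nat (j - 1)) * (dz + 1))%Z.
  by rewrite /i0 Nat2Z.inj_add Z2Nat.id; lia.
exact: hS.
Qed.

End Certificate.

(** * From diagrams to strips *)

(* The diagram {|alpha| < a} + {|alpha| = a, alpha_2 < b} in the coordinates (alpha_2, |alpha|). *)
Definition diagram (a b : Z) (z : point) : bool :=
  [&& (0 <=? z.1)%Z, (z.1 <=? z.2)%Z & (z.2 <? a)%Z || (z.2 =? a)%Z && (z.1 <? b)%Z].

Definition fills (d k : nat) (a b : Z) : bool :=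
  [&& (0 <=? b), (b <=? a) & a * (a + 1) + 2 * b =? Z.of_nat k * (Z.of_nat d * (Z.of_nat d + 1))]%Z.

(** As 0 <= b <= a, the doubled size lies between a(a+1) and (a+1)(a+2) - 1, and these ranges are
    disjoint for different a. *)
Lemma fills_inj d k a b a' b' : fills d k a b -> fills d k a' b' -> a = a' /\ b = b'.
Proof.
case/and3P => b0 ba /Z.eqb_spec e /and3P [b0' ba' /Z.eqb_spec e'].
have aa' : (a = a')%Z.
  have [lt|[//|gt]] := Z.lt_total a a'; exfalso.
    have : ((a + 1) * (a + 2) <= a' * (a' + 1))%Z by nia.
    by lia.
  have : ((a' + 1) * (a' + 2) <= a * (a + 1))%Z by nia.
  by lia.
by split=> //; rewrite aa' in e; lia.
Qed.

Lemma diagram_step d k k' a b a' b' : fills d k a b -> fills d k' a' b' -> (a' <= a)%Z ->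
  solvable d (k - k') (strip (a - a') b' b a') -> (k' <= k)%N ->
  solvable d k' (diagram a' b') -> solvable d k (diagram a b).
Proof.
case/and3P => b0 ba _ /and3P [b0' ba' _] le_a hS le_k hD; rewrite -(subnKC le_k).
(* As x <= y <= a, the form x + (a + 1) y orders the points row by row, and the smaller diagram is
   the initial segment before (b', a'). *)
apply: solvable_sub (solvable_cut (u := 1) (v := (a + 1)%Z) (c := ((a + 1) * a' + b')%Z)
  _ _ hD (solvable_shift (0%Z, a') hS)).
- by move=> z; rewrite /diagram /strip; cbn [fst snd]; lia.
- move=> z; rewrite /diagram /lin => /and3P [x0 xy /orP [lt_y|]]; last by lia.
  have : ((a + 1) * z.2 <= (a + 1) * (a' - 1))%Z by nia.
  by lia.
- move=> z; rewrite /strip /lin; cbn [fst snd] => /and5P [/andP [y0 yh] x0 xW xp _].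
  have [y_a'|y_a'] := Z.eqb_spec (z.2 - a') 0; first by nia.
  have : ((a + 1) * (a' + 1) <= (a + 1) * z.2)%Z by nia.
  by lia.
Qed.

(** * Choice of the smaller diagram and induction on the number of nodes *)

(** The largest a with a(a+1) <= n, by the quadratic formula; [step_check] confirms the result
    through [fills]. *)
Definition side (n : Z) : Z * Z :=
  let a := ((Z.sqrt (4 * n + 1) - 1) / 2)%Z in (a, (n - a * (a + 1)) / 2)%Z.

Definition size2 (d k : nat) : Z := (Z.of_nat k * (Z.of_nat d * (Z.of_nat d + 1)))%Z.

Definition same_shape (d : nat) isA (p j i h p' e W : Z) : bool :=
  let: (h1, p1, e1, W1, _) := shape (Z.of_nat d) isA p j i in
  [&& (h1 =? h), (p1 =? p'), (e1 =? e) & (W1 =? W)]%Z.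

Definition shape_step (d m : nat) (isA : bool) (h p' e W : Z) : bool :=
  let dz := Z.of_nat d in
  let p := if isA then p' else e in
  let j := if isA then ((e - p') / dz)%Z else ((p' - e) / (dz + 1))%Z in
  let i := m./2 in
  [&& odd m, (0 <=? j)%Z, (0 <=? p)%Z, same_shape d isA p j (Z.of_nat i) h p' e W
    & valid_shape d isA p j i].

(** The strips in [extra] have negative [j], outside the two families; they are still enlarged by
    blocks at both ends, [l] of them on the left. *)
Definition extra_step (d : nat) (C : certificate) (m : nat) (h p' e W : Z) : bool :=
  has (fun x => let: (isA, p0, j, i0, _) := x in
    let dz := Z.of_nat d in
    let p := if isA then p' else e in
    let D := (if isA then dz + 1 else dz)%Z in
    let l := Z.to_nat ((p - p0) / D) in
    let i := m./2 in
    [&& odd m, (p =? p0 + Z.of_nat l * D)%Z, (i0 + l <= i)%N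
      & same_shape d isA p j (Z.of_nat i) h p' e W]) (extra C).

Definition direct_step (d : nat) (C : certificate) (k k' : nat) (h p' e W : Z) : bool :=
  let here (x : nat * nat * tree) := (x.1.1 == k) && (x.1.2 == k') in
  let x := nth (0%N, 0%N, Leaf 0 0 0) (direct C) (find here (direct C)) in
  if here x then cells_check d x.2 (k - k') (strip_points h p' e W) else false.

Definition step_check (d : nat) (C : certificate) (k k' : nat) : bool :=
  let: (a, b) := side (size2 d k) in
  let: (a', b') := side (size2 d k') in
  let h := (a - a')%Z in
  if [&& fills d k a b, fills d k' a' b', (k' <= k)%N & (a' <=? a)%Z] then
    if shape_step d (k - k') true h b' b a' || shape_step d (k - k') false h b' b a' ||
       extra_step d C (k - k') h b' b a'
    then true else direct_step d C k k' h b' b a'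
  else false.

Definition covered_by (d : nat) (C : certificate) (k k' : nat) : bool :=
  if (k' < k)%N && ((k' == 0) || (6 < k')%N) then step_check d C k k' else false.

(** Candidates k' are tried from k - 1 downwards until the side has dropped by roughly 2d; the last
    one is 0, a subdivision of the whole diagram. *)
Definition covered (d : nat) (C : certificate) (k : nat) : bool :=
  let a := ((side (size2 d k)).1 - 2 * Z.of_nat d)%Z in
  let k0 := Z.to_nat (a * a / (Z.of_nat d * (Z.of_nat d + 1))) in
  let s := rcons (rev (iota k0 (k - k0))) 0 in
  (find (covered_by d C k) s < size s)%N.

(** A side a beyond this value satisfies a - 2d >= d(d+1), which makes the range for k' in
    [solvable_large] long enough, and a - d - 1 >= (d+1)^2, which keeps k' above 6. *)
Definition large_side (d : nat) : Z := (Z.of_nat d * (Z.of_nat d + 1) + 2 * Z.of_nat d + 1)%Z.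

(** A diagram of side at most L has doubled size below (L+1)(L+2), so from this k on the side
    exceeds [large_side d]. *)
Definition bound (d : nat) : nat :=
  Z.to_nat ((large_side d + 1) * (large_side d + 2) / (Z.of_nat d * (Z.of_nat d + 1)) + 1).

Section Induction.

Variables (d : nat) (C : certificate).
Hypothesis C_ok : certificate_check d C.

Let d0 : (0 < d)%N. Proof. exact: d_gt0 C_ok. Qed.

Lemma same_shape_sound isA p j i h p' e W m : m = (2 * i + 1)%N ->
  same_shape d isA p j (Z.of_nat i) h p' e W -> solvable_shape d isA p j i ->
  solvable d m (strip h p' e W).
Proof.
move->; rewrite /same_shape /solvable_shape.
by case: (shape _ _ _ _ _) => [[[[h1 p1] e1] W1] D1] /and4P
  [/Z.eqb_spec -> /Z.eqb_spec -> /Z.eqb_spec -> /Z.eqb_spec ->].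
Qed.

Lemma shape_step_sound m isA h p' e W :
  shape_step d m isA h p' e W -> solvable d m (strip h p' e W).
Proof.
case/and5P => odd_m j0 p0 /same_shape_sound H v; apply: H; first by lia.
by case: isA j0 p0 v => j0 p0 v; [apply: shapeA_solvable C_ok _ _ _ j0 v|
  apply: shapeT_solvable C_ok _ _ _ j0 p0 v].
Qed.

Lemma extra_step_sound m h p' e W :
  extra_step d C m h p' e W -> solvable d m (strip h p' e W).
Proof.
rewrite /extra_step => /hasP [x]; case: x => [[[[isA p0] j] i0] cs] xC.
case/and4P => odd_m /Z.eqb_spec pE le_i.
move/same_shape_sound => H; apply: H; first by lia.
set l := Z.to_nat _ in pE le_i; rewrite pE -(subnKC le_i).
case/and5P: (C_ok) => _ _ _ /allP /(_ _ xC) /=.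
move: (@shape_grow d C C_ok isA p0 j i0 l (m./2 - (i0 + l))); rewrite /solvable_shape.
case: (shape _ _ _ _ (Z.of_nat i0)) => [[[[h1 p1] e1] W1] D1] G.
case/and3P => p10 eW /cells_check_strip hS _.
by apply: G => //; rewrite p10.
Qed.

Lemma direct_step_sound k k' h p' e W :
  direct_step d C k k' h p' e W -> solvable d (k - k') (strip h p' e W).
Proof.
by rewrite /direct_step /=; case: ifP => // _ /cells_check_strip.
Qed.

Lemma step_check_sound k k' : step_check d C k k' ->
  (forall a b, fills d k' a b -> solvable d k' (diagram a b)) ->
  forall a b, fills d k a b -> solvable d k (diagram a b).
Proof.
rewrite /step_check; case: (side (size2 d k)) => a b; case: (side (size2 d k')) => a' b'.
case: ifP => // /and4P [fab fab' le_k /Z.leb_le le_a] hS IH a1 b1 /(fills_inj fab) [<- <-].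
apply: (diagram_step fab fab') => //; last exact: IH.
move: hS; case: ifP => [|_ /direct_step_sound //].
by rewrite -orbA => /or3P [/shape_step_sound|/shape_step_sound|/extra_step_sound].
Qed.

Lemma fills0 a b : fills d 0 a b -> solvable d 0 (diagram a b).
Proof. by case/and3P => b0 ba /Z.eqb_spec e; apply: solvable0 => z; rewrite /diagram; nia. Qed.

(** The smaller diagram should have side a - d and b' <= b, or side a - d - 1 and b' > b. In terms
    of its doubled size these two ranges join up to the interval from [lo] (excluded) to [hi], whose
    length is at least 2d(d+1), so it contains k' d(d+1) for some k' with k - k' odd. *)
Lemma solvable_large k a b : fills d k a b -> (large_side d < a)%Z ->
  exists2 k', (6 < k' < k)%N &
    (forall a b, fills d k' a b -> solvable d k' (diagram a b)) -> solvable d k (diagram a b).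
Proof.
move=> fab la; case/and3P: (fab) => b0 ba /Z.eqb_spec sz.
pose D := Z.of_nat d; pose Q := (D * (D + 1))%Z.
have D1 : (1 <= D)%Z by rewrite /D; lia.
have QD : (2 * D <= Q)%Z by rewrite /Q; nia.
rewrite -/D -/Q in sz; rewrite /large_side -/D -/Q in la.
pose hi := ((a - D) * (a - D + 1) + 2 * Z.min b (a - D))%Z.
pose lo := ((a - D - 1) * (a - D) + 2 * b)%Z.
have lohi : (lo + 2 * Q <= hi)%Z by rewrite /lo /hi; lia.
pose r := (Z.of_nat k * Q - hi)%Z.
have r0 : (0 <= r)%Z.
  have ? : (0 <= D * (2 * a - D + 1))%Z by apply: Z.mul_nonneg_nonneg; lia.
  by rewrite /r -sz /hi; lia.
(* Then 2 iz + 1 is the least positive odd m with m Q >= r; as m Q < r + 2 Q, the doubled size (k -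
   m) Q stays above [lo]. *)
pose iz := ((r + Q - 1) / (2 * Q))%Z.
have iz_b : (2 * Q * iz <= r + Q - 1 < 2 * Q * iz + 2 * Q)%Z.
  have := Z.div_mod (r + Q - 1) (2 * Q); have := Z.mod_pos_bound (r + Q - 1) (2 * Q).
  rewrite -/iz; lia.
have iz0 : (0 <= iz)%Z by apply: Z.div_pos; lia.
pose i := Z.to_nat iz; have iE : Z.of_nat i = iz by rewrite /i; lia.
pose m := (2 * i + 1)%N.
have mE : (Z.of_nat m = 2 * iz + 1)%Z by rewrite /m; lia.
have mQ : (r <= Z.of_nat m * Q <= r + 2 * Q - 1)%Z by rewrite mE; lia.
have kmQ : (lo < (Z.of_nat k - Z.of_nat m) * Q <= hi)%Z by rewrite /r in mQ; lia.
have big : (7 * Q <= lo)%Z.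
  have e1 : ((D + 1) * (D + 1) <= a - D - 1)%Z by rewrite /Q in la; lia.
  have X0 : (0 <= (D + 1) * (D + 1))%Z by apply: Z.mul_nonneg_nonneg; lia.
  have e2 : ((D + 1) * (D + 1) * ((D + 1) * (D + 1)) <= (a - D - 1) * (a - D))%Z.
    by apply: Z.mul_le_mono_nonneg; lia.
  have e3 : (7 * D <= (D + 1) * (D + 1) * (D + 1))%Z.
    have h1 : (0 <= (D - 1) * D)%Z by apply: Z.mul_nonneg_nonneg; lia.
    have : (0 <= (D - 1) * D * (D - 1))%Z by apply: Z.mul_nonneg_nonneg; lia.
    by lia.
  have : (7 * D * (D + 1) <= (D + 1) * (D + 1) * (D + 1) * (D + 1))%Z.
    by apply: Z.mul_le_mono_nonneg_r; lia.
  by rewrite /Q /lo; lia.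
have lt7 : (7 < Z.of_nat k - Z.of_nat m)%Z by apply: (Zmult_lt_reg_r _ _ Q); lia.
have le_mk : (m <= k)%N by lia.
have szk : (Z.of_nat (k - m) = Z.of_nat k - Z.of_nat m)%Z by lia.
have k7 : (6 < k - m < k)%N.
  by rewrite /m in lt7 *; lia.
exists (k - m)%N => // IH.
have km : (k - (k - m) = m)%N by lia.
(* The doubled size decides whether the smaller diagram has side a - d or a - d - 1. *)
have [ge|lt] := Z.leb_spec ((a - D) * (a - D + 1)) ((Z.of_nat k - Z.of_nat m) * Q).
  pose j := ((D + 1) * iz - (a - D))%Z; pose b' := (b - D * j)%Z.
  have sz' : ((a - D) * (a - D + 1) + 2 * b' = (Z.of_nat k - Z.of_nat m) * Q)%Z.
    by rewrite (Z.mul_sub_distr_r (Z.of_nat k)) -sz mE /b' /j /Q; lia.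
  have b'0 : (0 <= b')%Z by lia.
  have b'b : (b' <= Z.min b (a - D))%Z by rewrite /hi in kmQ; lia.
  have j0 : (0 <=? j)%Z.
    apply/Z.leb_le/(Z.mul_nonneg_cancel_l D); first by lia.
    by rewrite /b' in b'b; lia.
  have fab' : fills d (k - m) (a - D) b'.
    by apply/and3P; split; [lia|lia|rewrite szk; apply/Z.eqb_spec].
  apply: (diagram_step fab fab') => //; [lia| |lia|exact: IH].
  rewrite km (_ : (a - (a - D))%Z = D); last by lia.
  apply: (@same_shape_sound true b' j i) => //.
    by rewrite /same_shape /shape -/D iE; apply/and4P; split; rewrite /b' /j; lia.
  apply: (shapeA_solvable C_ok) => //.
  by rewrite /valid_shape /shape -/D iE; apply/and3P; split; rewrite /b' /j; lia.
pose j := (a - D - D * iz)%Z; pose b' := (b + (D + 1) * j)%Z.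
have sz' : ((a - D - 1) * (a - D - 1 + 1) + 2 * b' = (Z.of_nat k - Z.of_nat m) * Q)%Z.
  by rewrite (Z.mul_sub_distr_r (Z.of_nat k)) -sz mE /b' /j /Q; lia.
have b'b : (b < b' <= a - D - 1)%Z by rewrite /lo in kmQ; lia.
have j0 : (0 <=? j)%Z.
  apply/Z.leb_le/(Z.mul_nonneg_cancel_l (D + 1)); first by lia.
  by rewrite /b' in b'b; lia.
have fab' : fills d (k - m) (a - D - 1) b'.
  by apply/and3P; split; [lia|lia|rewrite szk; apply/Z.eqb_spec].
apply: (diagram_step fab fab') => //; [lia| |lia|exact: IH].
rewrite km (_ : (a - (a - D - 1))%Z = D + 1)%Z; last by lia.
apply: (@same_shape_sound false b j i) => //.
  by rewrite /same_shape /shape -/D iE; apply/and4P; split; rewrite /b' /j; lia.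
apply: (shapeT_solvable C_ok) => //.
by rewrite /valid_shape /shape -/D iE; apply/and3P; split; rewrite /b' /j; lia.
Qed.

Lemma solvable_diagram : all (covered d C) (iota 7 (bound d - 7)) ->
  forall k a b, (6 < k)%N -> fills d k a b -> solvable d k (diagram a b).
Proof.
move=> /allP cov k; elim/ltn_ind: k => k IH a b k7 fab.
have [lt_k|ge_k] := ltnP k (bound d).
  have : covered d C k by apply: cov; rewrite mem_iota; lia.
  rewrite /covered -has_find => /hasP [k' _]; rewrite /covered_by.
  case: ifP => // /andP [lt_k' k'7] st.
  apply: (step_check_sound st) fab => a' b' fab'.
  case/orP: k'7 fab' => [/eqP -> | k'7]; first exact: fills0.
  exact: IH.
have la : (large_side d < a)%Z.
  case/and3P: fab => b0 ba /Z.eqb_spec sz; apply/Znot_ge_lt => le_a.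
  move: ge_k; rewrite /bound; set L := large_side d in le_a *.
  set Q := (Z.of_nat d * (Z.of_nat d + 1))%Z in sz *.
  have Q0 : (0 < Q)%Z by rewrite /Q; nia.
  have := Z.mul_succ_div_gt ((L + 1) * (L + 2)) Q Q0.
  have L0 : (0 <= L)%Z by rewrite /L /large_side; nia.
  have := Z.div_pos ((L + 1) * (L + 2)) Q; set q := Z.div _ _ => q0 qQ le_k.
  have kq : (q + 1 <= Z.of_nat k)%Z by nia.
  by nia.
have [k' /andP [k'7 lt_k'] H] := solvable_large fab la.
by apply: H => a' b'; apply: IH.
Qed.

End Induction.

(** * Determinants *)

Definition to_point (alpha : 'X_{1..2}) : point :=
  (Z.of_nat (alpha ord_max), Z.of_nat (mdeg alpha)).

Lemma int_of_Z_nat n : int_of_Z (Z.of_nat n) = n%:Z.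
Proof. lia. Qed.

Lemma mdeg2 (alpha : 'X_{1..2}) : mdeg alpha = (alpha ord0 + alpha ord_max)%N.
Proof. by rewrite mdegE big_ord_recl big_ord1; congr (_ + alpha _)%N; apply: val_inj. Qed.

Lemma mnm2P (alpha beta : 'X_{1..2}) :
  alpha ord0 = beta ord0 -> alpha ord_max = beta ord_max -> alpha = beta.
Proof.
move=> e0 e1; apply/mnmP => i; case: (unliftP ord0 i) => [j|] -> //.
by rewrite (_ : lift _ _ = ord_max) //; apply: val_inj => /=; rewrite ord1.
Qed.

(** The exponent with alpha_2 = x and degree y, inverting [to_point]; the truncated subtraction is
    harmless for x <= y. *)
Definition mnm2 (x y : nat) : 'X_{1..2} := [multinom (if i == ord0 then y - x else x)%N | i < 2].

Lemma mnm2_max x y : mnm2 x y ord_max = x.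
Proof. by rewrite mnmE. Qed.

Lemma mdeg_mnm2 x y : (x <= y)%N -> mdeg (mnm2 x y) = y.
Proof. by move=> le_xy; rewrite mdeg2 !mnmE /= subnK. Qed.

Lemma sum_succ a : (sumn [seq y.+1 | y <- iota 0 a] * 2 = a * a.+1)%N.
Proof.
elim: a => [//|a IH]; rewrite -addn1 iotaD map_cat sumn_cat mulnDl IH /= add0n; lia.
Qed.

Lemma size_one_step (s : seq 'X_{1..2}) a b : uniq s -> (b <= a)%N ->
  (forall alpha, (alpha \in s) =
    (mdeg alpha < a)%N || (mdeg alpha == a) && (alpha ord_max < b)%N) ->
  (size s * 2 = a * a.+1 + b * 2)%N.
Proof.
move=> us le_ba sP.
pose L := [seq (x, y) | y <- iota 0 a, x <- iota 0 y.+1] ++ [seq (x, a) | x <- iota 0 b].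
have sizeL : (size L * 2 = a * a.+1 + b * 2)%N.
  rewrite size_cat size_allpairs_dep size_map size_iota mulnDl -sum_succ; congr (_ * 2 + _)%N.
  by congr sumn; apply: eq_map => y; rewrite size_iota.
rewrite -sizeL; congr (_ * 2)%N; rewrite -(size_map (fun al : 'X_{1..2} => (al ord_max, mdeg al))).
apply/perm_size/uniq_perm.
- rewrite map_inj_uniq // => alpha beta [e1]; rewrite !mdeg2 => e; apply: mnm2P; lia.
- rewrite cat_uniq; apply/and3P; split.
  + apply: allpairs_uniq_dep => [|y _|]; rewrite ?iota_uniq //.
    by move=> [y x] [y' x'] _ _ /= [-> ->].
  + apply/hasPn => _ /mapP [x _ ->]; apply/negP => /allpairsPdep [y [x' [+ _ [_ e]]]].
    by rewrite mem_iota e; lia.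
  + by rewrite map_inj_uniq ?iota_uniq // => x x' [].
move=> [x y]; rewrite mem_cat; apply/mapP/orP => [[alpha]|].
  rewrite sP => h [-> ->]; case/orP: h => [lt_a|/andP [/eqP e lt_b]].
    left; apply/allpairsPdep; exists (mdeg alpha), (alpha ord_max).
    by rewrite !mem_iota; split=> //; rewrite ?mdeg2; lia.
  by right; apply/mapP; exists (alpha ord_max); rewrite ?mem_iota ?e.
move=> h; have le_xy : (x <= y)%N.
  case: h => [/allpairsPdep [y' [x' [_ + [-> ->]]]]|/mapP [x' + [-> ->]]]; rewrite mem_iota; lia.
exists (mnm2 x y); last by rewrite mnm2_max mdeg_mnm2.
rewrite sP mnm2_max mdeg_mnm2 //.
case: h => [/allpairsPdep [y' [x' [+ _ [_ ->]]]]|/mapP [x' + [-> ->]]]; rewrite mem_iota; lia.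
Qed.

Lemma card_bmultinom2 d : (#|{: 'X_{1..2 < d}}| * 2 = d * d.+1)%N.
Proof.
rewrite -[RHS]addn0 -(mul0n 2) cardT -(size_map val).
apply: size_one_step => // [|alpha].
  by rewrite map_inj_uniq ?enum_uniq //; apply: val_inj.
rewrite ltn0 andbF orbF; apply/mapP/idP => [[beta _ ->]|lt_d]; first exact: bmdeg.
by exists (BMultinom lt_d); rewrite ?mem_enum.
Qed.

Section Evaluation.

Variables (d k : nat) (F : {fset 'X_{1..2}}) (ps : seq (algC * algC)).
Hypotheses (size_ps : size ps = k) (torus_ps : all torus ps).

(* Coordinates (alpha_2, |alpha|) turn the node (s, t) into (t, s t). *)
Definition node_value (p : algC * algC) (j : 'I_2) : algC :=
  if j == ord0 then p.2 else p.1 * p.2.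

Definition node_values (i : 'I_(k * 2)) : algC :=
  mxvec (\matrix_(i < k, j < 2) node_value (nth (1, 1) ps i) j) 0 i.

Definition value_mx := map_mx (meval node_values) (interp_mx algC d k F).

(** The operator x^beta d^beta/dx^beta multiplies x^alpha by a product of falling factorials; so the
    left side is row (i, beta) rescaled by the monomial x^beta at the node. *)
Lemma value_mxE r c :
  let: (i, beta) := enum_val r : 'I_k * 'X_{1..2 < d} in
  let alpha := val (enum_val c : F) in
  let p := nth (1, 1) ps i in
  mono p (to_point alpha) *
    ((alpha ord0 ^_ beta ord0)%:R * (alpha ord_max ^_ beta ord_max)%:R) =
  (p.2 ^+ beta ord0 * (p.1 * p.2) ^+ beta ord_max) * value_mx r c.
Proof.
rewrite /value_mx /interp_mx !mxE; case: (enum_val r) => i beta; set alpha := val _.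
rewrite mderivmX comp_mpolyZ comp_mpolyX mevalZ !rmorph_prod /=.
set p := nth _ _ _.
have tp : torus p by apply: (allP torus_ps); rewrite mem_nth // size_ps.
case/andP: (tp) => p1 p2.
rewrite !big_ord_recl !big_ord0 !mulr1 !rmorphXn /= !tnth_mktuple !mevalXU.
rewrite /node_values !mxvecE !mxE.
rewrite (_ : lift _ _ = ord_max) //; last exact: val_inj.
rewrite /node_value /= -/p !mnmBE /mono /to_point /= mdeg2.
rewrite !int_of_Z_nat -!exprnP (_ : p.1 ^+ _ * p.2 ^+ _ =
  p.2 ^+ alpha ord0 * (p.1 * p.2) ^+ alpha ord_max); last first.
  by rewrite exprD exprMn mulrCA.
(* If an exponent of alpha is too small, the subtraction is truncated, but the falling factorial
   makes both sides vanish. *)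
have [lt0|le0] := ltnP (alpha ord0) (beta ord0); first by rewrite ffact_small // !mul0r !mulr0.
have [lt1|le1] := ltnP (alpha ord_max) (beta ord_max).
  by rewrite [_ ^_ beta ord_max]ffact_small // !(mulr0, mul0r).
rewrite -{1}(subnKC le0) -{1}(subnKC le1) !exprD.
have mulC5 (x1 x2 x3 x4 x5 : algC) :
  x1 * x2 * (x3 * x4) * x5 = x1 * x3 * (x5 * (x2 * x4)) by ring.
exact: mulC5.
Qed.

Definition spanned (f : 'X_{1..2} -> algC) : Prop :=
  exists x : 'rV[algC]_#|{: 'I_k * 'X_{1..2 < d}}|,
    forall c, (x *m value_mx) 0 c = f (val (enum_val c : F)).

Lemma spanned_eq f g : f =1 g -> spanned f -> spanned g.
Proof. by move=> e [x h]; exists x => c; rewrite h e. Qed.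

Lemma spanned_lin s t f g :
  spanned f -> spanned g -> spanned (fun alpha => s * f alpha + t * g alpha).
Proof.
move=> [x hx] [y hy]; exists (s *: x + t *: y) => c.
by rewrite mulmxDl -!scalemxAl !mxE -hx -hy !mxE.
Qed.

Lemma spanned0 : spanned (fun=> 0).
Proof. by exists 0 => c; rewrite mul0mx mxE. Qed.

Definition basic (p : algC * algC) b1 b2 (alpha : 'X_{1..2}) : algC :=
  mono p (to_point alpha) * ((alpha ord0 ^_ b1)%:R * (alpha ord_max ^_ b2)%:R).

Lemma spanned_basic p b1 b2 : p \in ps -> (b1 + b2 < d)%N -> spanned (basic p b1 b2).
Proof.
move=> /(nthP (1, 1)) [i lt_i <- {p}] lt_d; rewrite size_ps in lt_i.
have lt_beta : (mdeg (mnm2 b2 (b1 + b2)) < d)%N by rewrite mdeg_mnm2 ?leq_addl.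
pose r := enum_rank (Ordinal lt_i, BMultinom lt_beta) : 'I_#|{: 'I_k * 'X_{1..2 < d}}|.
set p := nth _ _ _.
exists ((p.2 ^+ b1 * (p.1 * p.2) ^+ b2) *: delta_mx 0 r) => c.
rewrite -scalemxAl -rowE mxE [row _ _ _ _]mxE /basic.
by have := value_mxE r c; rewrite enum_rankK /= mnm2_max mnmE /= addnK -/p => ->.
Qed.

(** With q = c + x q1 + y q2, the factors alpha_2 and alpha_1 + alpha_2 are absorbed by raising [b2]
    or [b1], up to a multiple of the same [basic]; the unit lost in [e] pays for the unit gained in
    [b1 + b2]. *)
Lemma spanned_polyfun e p b1 b2 q : p \in ps -> polyfun e q -> (b1 + b2 + e <= d)%N ->
  spanned (fun alpha => basic p b1 b2 alpha * q (zC (to_point alpha).1) (zC (to_point alpha).2)).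
Proof.
move=> pps; elim: e b1 b2 q => [|e IH] b1 b2 q /=.
  by move=> q0 _; apply: spanned_eq spanned0 => alpha; rewrite q0 mulr0.
case=> [c [q1 [q2 [h1 h2 qE]]]] le_d.
have zCn n : zC (Z.of_nat n) = n%:R by rewrite /zC int_of_Z_nat.
have ffS n m : (n ^_ m)%:R * n%:R = (n ^_ m.+1)%:R + m%:R * (n ^_ m)%:R :> algC.
  rewrite ffactnSr -!natrM -natrD; congr (_%:R).
  have [lt_nm|le_mn] := ltnP n m; first by rewrite ffact_small // !mul0n muln0.
  by rewrite -{2}(subnK le_mn) mulnDr [(m * _)%N]mulnC.
have B : spanned (basic p b1 b2) by apply: spanned_basic => //; lia.
have S0 q' : polyfun e q' -> spanned (fun alpha => basic p b1 b2 alpha *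
    q' (zC (to_point alpha).1) (zC (to_point alpha).2)) by move=> ?; apply: IH => //; lia.
have S1 q' : polyfun e q' -> spanned (fun alpha => basic p b1.+1 b2 alpha *
    q' (zC (to_point alpha).1) (zC (to_point alpha).2)) by move=> ?; apply: IH => //; lia.
have S2 q' : polyfun e q' -> spanned (fun alpha => basic p b1 b2.+1 alpha *
    q' (zC (to_point alpha).1) (zC (to_point alpha).2)) by move=> ?; apply: IH => //; lia.
have T1 := spanned_lin 1 b2%:R (S2 _ h1) (S0 _ h1).
have T2 := spanned_lin 1 (b1 + b2)%:R (spanned_lin 1 1 (S1 _ h2) (S2 _ h2)) (S0 _ h2).
apply: spanned_eq (spanned_lin 1 1 (spanned_lin c 0 B B) (spanned_lin 1 1 T1 T2)) => alpha.
rewrite qE /basic; move: (ffS (alpha ord0) b1) (ffS (alpha ord_max) b2).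
have -> : zC (to_point alpha).1 = (alpha ord_max)%:R by rewrite zCn.
have -> : zC (to_point alpha).2 = (alpha ord0)%:R + (alpha ord_max)%:R.
  by rewrite zCn mdeg2 natrD.
set x := (alpha ord0)%:R; set y := (alpha ord_max)%:R; rewrite [(b1 + b2)%:R]natrD.
set f1 := (_ ^_ b1)%:R; set f1' := (_ ^_ b1.+1)%:R; set f2 := (_ ^_ b2)%:R.
set f2' := (_ ^_ b2.+1)%:R => e1 e2.
have -> : f1' = f1 * x - b1%:R * f1 by rewrite e1 addrK.
have -> : f2' = f2 * y - b2%:R * f2 by rewrite e2 addrK.
ring.
Qed.

Lemma spanned_expfun ps' g : {subset ps' <= ps} -> expfun d ps' g ->
  spanned (fun alpha => g (to_point alpha)).
Proof.
elim: ps' g => [|p ps' IH] g sub /=.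
  by move=> g0; apply: spanned_eq spanned0 => alpha; rewrite g0.
move=> [q [g' [hq hg' e]]].
have S := spanned_polyfun (b1 := 0) (b2 := 0) (sub _ (mem_head _ _)) hq (leqnn _).
have sub' : {subset ps' <= ps} by move=> x xs; apply: sub; rewrite inE xs orbT.
apply: spanned_eq (spanned_lin 1 1 S (IH _ sub' hg')) => alpha.
by rewrite e /basic !ffactn0 !mulr1 !mul1r.
Qed.

(** Interpolating the indicator functions of the elements of [F] yields the rows of a left
    inverse. *)
Lemma value_mx_left_inverse :
  (forall h : 'X_{1..2} -> algC, exists2 g, expfun d ps g &
    forall alpha, alpha \in F -> g (to_point alpha) = h alpha) ->
  exists X, X *m value_mx = 1%:M.
Proof.
move=> hF.
have /fin_all_exists [x xP] (c : 'I_#|{: F}|) :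
    exists x : 'rV[algC]_#|{: 'I_k * 'X_{1..2 < d}}|, x *m value_mx = delta_mx 0 c.
  have [g hg e] := hF (fun alpha => (alpha == val (enum_val c : F))%:R).
  have [x hx] := spanned_expfun (fun _ => id) hg.
  exists x; apply/rowP => c'; rewrite hx e ?fsvalP // !mxE /=; congr (_%:R).
  by rewrite (inj_eq val_inj) (inj_eq enum_val_inj).
exists (\matrix_c x c); apply/row_matrixP => c.
by rewrite row_mul rowK xP rowE mulmx1.
Qed.

End Evaluation.

Lemma det_castmx_unit (L : fieldType) m n (e : n = m) (M : 'M[L]_(m, n)) :
  (exists X, X *m M = 1%:M) -> \det (castmx (erefl, e) M) != 0.
Proof.
case: m / e M => M [X XM]; rewrite castmx_id -unitfE -unitmxE.
by case: (mulmx1_unit XM).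
Qed.

(* The matrix has integer entries, so that it may be specialised over any field. *)
Definition interp_mxZ (d k : nat) (F : {fset 'X_{1..2}}) :
    'M[{mpoly int[k * 2]}]_(#|{: 'I_k * 'X_{1..2 < d}}|, #|{: F}|) :=
  \matrix_(r, c)
    let: (i, beta) := enum_val r : 'I_k * 'X_{1..2 < d} in
    let alpha := val (enum_val c : F) in
    (\prod_(j < 2) (alpha j ^_ beta j))%:R *:
      \prod_(j < 2) 'X_(mxvec_index i j) ^+ (alpha j - beta j).

Lemma interp_mx_int (L : fieldType) d k F :
  interp_mx L d k F = map_mx (map_mpoly (intr : int -> L)) (interp_mxZ d k F).
Proof.
apply/matrixP => r c; rewrite /interp_mx /interp_mxZ !mxE.
case: (enum_val r) => i beta; rewrite mderivmX comp_mpolyZ comp_mpolyX map_mpolyZ /=.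
congr (_ *: _); first by rewrite rmorph_nat.
rewrite [RHS]rmorph_prod; apply: eq_bigr => j _.
by rewrite rmorphXn /= map_mpolyX tnth_mktuple mnmBE.
Qed.

Lemma intr_eq0_pchar0 (K : fieldType) (z : int) : [pchar K] =i pred0 ->
  (z%:~R == 0 :> K) = (z == 0).
Proof.
move=> /pcharf0P charK; case: z => n; first by rewrite -pmulrn charK.
by rewrite NegzE mulrNz !oppr_eq0 -pmulrn charK.
Qed.

(** The determinant over [algC] is the image of an integer polynomial, which is then nonzero, and
    integers embed in [K]. The point of [algC] is that it contains the roots of unity used as
    nodes. *)
Lemma generically_correct_algC (K : fieldType) d k F : [pchar K] =i pred0 ->
  generically_correct algC d k F -> generically_correct K d k F.
Proof.
move=> charK [e De]; exists e; move: De.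
rewrite !interp_mx_int -!map_castmx !det_map_mx; apply: contra => /eqP D0.
suff -> : \det (castmx (erefl, e) (interp_mxZ d k F)) = 0 by rewrite rmorph0.
apply/mpolyP => m; have := congr1 (mcoeff m) D0.
by rewrite mcoeff_map_mpoly !mcoeff0 => /eqP; rewrite intr_eq0_pchar0 // => /eqP.
Qed.

Lemma generically_correct_diagram (K : fieldType) d k a b (F : {fset 'X_{1..2}}) :
  [pchar K] =i pred0 -> (0 < d)%N -> (b <= a)%N ->
  (forall alpha, (alpha \in F) =
    (mdeg alpha < a)%N || (mdeg alpha == a) && (alpha ord_max < b)%N) ->
  #|` F| = ((k * d * (d + 1)) %/ 2)%N ->
  (fills d k (Z.of_nat a) (Z.of_nat b) ->
    solvable d k (diagram (Z.of_nat a) (Z.of_nat b))) ->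
  generically_correct K d k F.
Proof.
move=> charK d0 le_ba FP szF hS; apply: (generically_correct_algC charK).
have sz2 : (#|` F| * 2 = a * a.+1 + b * 2)%N.
  by apply: size_one_step; rewrite ?fset_uniq.
(* As d(d+1) is even, the halving in the cardinality is exact. *)
have ev : (#|` F| * 2 = k * (d * d.+1))%N.
  rewrite szF addn1 -mulnA divnK // dvdn_mull // dvdn2 oddM /=; by case: (odd d).
have {hS} [] : solvable d k (diagram (Z.of_nat a) (Z.of_nat b)).
  by apply: hS; apply/and3P; split; nia.
move=> A [ps [sA szps tps hA]].
have e : #|{: F}| = #|{: 'I_k * 'X_{1..2 < d}}|.
  rewrite -cardfE card_prod card_ord; have := card_bmultinom2 d.
  set n := #|_|; rewrite -?/n => nE; nia.
exists e.
(* One specialization with nonzero value suffices: the nodes provided by [solvable]. *)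
suff : (\det (castmx (erefl, e) (interp_mx algC d k F))).@[node_values ps] != 0.
  by apply: contra => /eqP ->; rewrite meval0.
rewrite -[_.@[_]]/(meval _ _) -det_map_mx map_castmx; apply: det_castmx_unit.
apply: (@value_mx_left_inverse d k F ps szps tps) => h.
have inF alpha : alpha \in F -> to_point alpha \in A.
  rewrite FP => aF; apply: sA; rewrite /diagram /to_point /= mdeg2.
  by move: aF; rewrite mdeg2; lia.
have [g hg gA] := hA (fun z => h (mnm2 (Z.to_nat z.1) (Z.to_nat z.2))).
exists g => // alpha aF; rewrite gA ?inF //=; congr h.
rewrite !Nat2Z.id; apply: mnm2P; last by rewrite mnm2_max.
by rewrite mnmE /= mdeg2 addnK.
Qed.

(** * Subdivisions *)

Section Certificates.

Local Open Scope Z_scope.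

Definition certificate1 : certificate := Certificate
  [::
   [::]; [::]]
  [::
   ((1,0,0), None, [:: (0,1,1)], [::]); ((1,0,1), Some [::], [:: (0,1,1)], [:: (0,1,1)])]
  [::
   [::]]
  [::
   ((1,0,0), None, [:: (-1,0,0)], [:: (1,0,2); (1,0,1)])]
  [::]
  [::
   (6%N, 0%N, comb [:: (-1,1,2); (0,-1,0); (-1,0,0); (-1,1,1); (-1,0,-1)]);
   (7%N, 0%N, comb [:: (0,1,3); (-1,1,2); (0,-1,0); (-1,0,0); (0,-1,-1); (-1,0,-1)]); (8%N, 7%N,
     single);
   (9%N, 8%N, single); (10%N, 9%N, single); (11%N, 10%N, single)].

Definition certificate2 : certificate := Certificate
  [::
   [::]; [::]; [:: (1,2,5); (-1,0,-1)]]
  [::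
   ((1,0,0), None, [:: (1,1,2)], [::]); ((2,-1,1), Some [::], [:: (1,1,3)], [:: (-2,1,-2)]);
   ((2,-1,4), Some [:: (1,1,3)], [:: (1,1,5)], [::])]
  [::
   [::]; [:: (-1,2,3); (-1,0,-1)]]
  [::
   ((1,0,0), None, [:: (-1,-1,-2)], [:: (-1,1,1); (1,0,3)]);
   ((1,-1,1), Some [:: (-1,-1,-2)], [:: (-1,2,0)], [:: (-1,-1,-4); (1,0,5)])]
  [::]
  [::
   (6%N, 0%N, comb [:: (0,-1,-1); (-1,1,4); (-2,1,2); (-1,-1,-4); (-1,2,5)]);
   (7%N, 0%N, comb [:: (-1,1,4); (-1,2,7); (0,-1,-1); (-1,3,10); (-1,4,12); (-1,0,-1)]);
   (8%N, 0%N, comb [:: (0,-1,-1); (-1,1,5); (-1,3,13); (-1,-1,-3); (-1,0,-1); (-2,1,-1);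
     (-1,0,-3)]);
   (9%N, 0%N, comb [:: (2,-1,4); (1,1,9); (-1,1,5); (0,-1,-1); (1,-2,-3); (2,1,10); (-1,2,8);
     (-1,2,6)]);
   (10%N, 9%N, single); (11%N, 8%N, comb [:: (-1,-2,-3); (-1,-1,-4)])].

Definition certificate3 : certificate := Certificate
  [::
   [::]; [::]; [:: (-2,-3,-7); (-1,0,-3)]; [:: (-1,1,1); (1,0,4)]]
  [::
   ((1,0,0), None, [:: (1,1,3)], [::]); ((3,-1,7), Some [:: (-3,-2,-6)], [:: (-3,2,-9)], [::]);
   ((2,-1,5), Some [:: (2,1,5)], [:: (2,-1,8)], [::]); ((3,-1,9), Some [:: (-1,1,1)], [::
     (2,-3,6)], [::])]
  [::
   [::]; [:: (1,-3,-2); (-2,3,4)]; [:: (-2,-3,-8); (1,0,3)]]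
  [::
   ((1,0,0), None, [:: (-1,1,1)], [:: (1,0,4); (1,1,4)]);
   ((2,-1,5), Some [:: (-2,3,4)], [:: (2,1,13)], [:: (1,0,7); (-1,2,-1)]);
   ((2,-1,4), Some [:: (1,-2,-3)], [:: (-2,-1,-11)], [:: (-1,-1,-6); (-1,0,-6)])]
  [::
   (true, 3, -1, 1%N, [:: (-1,-1,-3); (-1,0,-4)])]
  [::
   (6%N, 0%N, comb [:: (0,-1,-2); (-1,-1,-5); (-1,-3,-17); (-1,-1,-8); (-1,0,-4)]);
   (7%N, 0%N, comb [:: (1,1,12); (3,-1,6); (-1,1,6); (1,2,14); (5,-3,0); (-1,2,7)]);
   (8%N, 0%N, comb [:: (-1,1,7); (0,-1,-2); (-2,1,4); (-2,-1,-8); (-3,2,4); (0,-1,-5); (-1,0,-5)]);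
   (9%N, 0%N, comb [:: (3,-1,12); (0,-1,-2); (-1,1,7); (5,-3,6); (-2,1,4); (1,-2,-6); (-2,3,16);
     (-1,3,16)]);
   (10%N, 0%N, comb [:: (0,-1,-2); (1,0,7); (3,2,31); (1,-2,-5); (2,1,16); (2,3,30); (2,-3,-10);
     (1,2,17); (-1,2,11)]);
   (11%N, 0%N, comb [:: (0,-1,-2); (1,0,8); (1,1,15); (1,2,22); (4,-1,13); (4,3,35); (-1,-1,-5);
     (1,-2,-7); (-1,-2,-14); (-1,-3,-24)])].

Definition certificate4 : certificate := Certificate
  [::
   [::]; [::]; [:: (1,0,5); (-2,3,2)]; [:: (1,0,5); (2,3,11)]; [:: (-4,-3,-15); (1,0,5)]]
  [::
   ((1,0,0), None, [:: (1,1,4)], [::]); ((4,-1,13), Some [:: (1,-1,0)], [:: (-3,4,-8)], [::]);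
   ((3,-1,10), Some [:: (-1,1,1)], [:: (-3,2,-13)], [::]); ((3,-1,11), Some [:: (1,-1,0)], [::
     (-2,3,-6)], [::]);
   ((4,-1,16), Some [:: (1,-1,0)], [:: (-3,4,-11)], [::])]
  [::
   [::]; [:: (-4,-3,-12); (-1,0,-3)]; [:: (-3,-2,-9); (1,0,4)]; [:: (-4,-3,-14); (1,0,4)]]
  [::
   ((1,0,0), None, [:: (1,-1,0)], [:: (1,0,5); (-1,1,1)]);
   ((3,-1,11), Some [:: (-3,4,5)], [:: (3,-2,16)], [:: (2,-5,7); (3,-4,11)]);
   ((2,-1,6), Some [:: (2,-3,-4)], [:: (2,1,16)], [:: (-1,-1,-8); (1,0,9)]);
   ((3,-1,9), Some [:: (1,1,5)], [:: (3,-2,14)], [:: (-1,-1,-8); (-1,0,-8)])]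
  [::
   (true, 4, -1, 1%N, [:: (-1,-1,-4); (1,0,6)])]
  [::
   (6%N, 0%N, comb [:: (0,-1,-3); (-1,-1,-7); (-3,2,11); (-1,-2,-17); (-1,0,-5)]);
   (7%N, 0%N, comb [:: (-1,1,8); (0,-1,-3); (-1,-1,-7); (1,0,7); (1,-2,-9); (-2,1,2)]);
   (8%N, 0%N, comb [:: (-2,3,26); (-5,3,14); (0,-1,-3); (-2,-1,-11); (-1,-3,-26); (-1,-1,-14);
     (-1,0,-7)]);
   (9%N, 0%N, comb [:: (4,-1,24); (-1,1,9); (-2,1,5); (1,1,17); (5,2,44); (0,-1,-3); (0,1,8);
     (-2,-1,-11)]);
   (10%N, 0%N, comb [:: (0,-1,-3); (1,-2,-7); (-1,-2,-15); (1,0,9); (-1,1,10); (1,1,18);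
     (2,-3,-14); (-1,-1,-11); (-3,2,9)]);
   (11%N, 0%N, comb [:: (-1,1,11); (0,-1,-3); (-2,1,7); (-3,4,32); (-5,2,5); (-1,2,16); (-2,7,60);
     (-5,7,33); (-2,3,12); (-1,2,8)]);
   (13%N, 0%N, comb [:: (0,-1,-3); (-1,-1,-7); (-1,-3,-23); (-1,-2,-19); (-3,-4,-47); (-2,-1,-16);
     (-3,-2,-34); (-4,-1,-31); (-3,-2,-41); (-2,1,-1); (-3,5,35); (-1,4,37)])].

Definition certificate5 : certificate := Certificate
  [::
   [::]; [::]; [:: (-3,-4,-16); (1,0,6)]; [:: (-2,3,3); (1,0,6)]; [:: (1,0,6); (-3,4,4)]; [::
     (-5,-6,-29); (1,0,6)]]
  [::
   ((1,0,0), None, [:: (1,1,5)], [::]); ((5,-1,21), Some [:: (5,4,21)], [:: (1,1,10)], [::]);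
   ((4,-1,17), Some [:: (4,3,17)], [:: (4,-3,22)], [::]); ((3,-1,13), Some [:: (3,2,13)], [::
     (-2,3,-7)], [::]);
   ((4,-1,19), Some [:: (-4,-3,-18)], [:: (3,-4,14)], [::]); ((5,-1,25), Some [:: (1,1,6)], [::
     (-1,-1,-10)], [::])]
  [::
   [::]; [:: (1,0,5); (3,-4,-4)]; [:: (-4,-3,-16); (1,0,5)]; [:: (1,0,5); (-2,-3,-13)]; [::
     (-3,4,8); (-4,9,9)]]
  [::
   ((1,0,0), None, [:: (1,-1,0)], [:: (-1,-1,-5); (-1,0,-5)]);
   ((4,-1,19), Some [:: (-1,-1,-5)], [:: (4,-3,25)], [:: (3,-7,14); (-4,5,-18)]);
   ((3,-1,13), Some [:: (-3,4,6)], [:: (-3,4,-12)], [:: (-3,4,-12); (-1,0,-10)]);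
   ((3,-1,12), Some [:: (1,1,6)], [:: (-3,-2,-29)], [:: (-3,4,-11); (3,-7,12)]);
   ((4,-1,16), Some [:: (3,-4,-7)], [:: (4,-3,22)], [:: (-4,5,-15); (-1,0,-10)])]
  [::
   (true, 5, -1, 1%N, [:: (1,0,7); (1,1,6)]); (false, 10, -1, 1%N, [:: (1,-2,-2); (-1,1,2)])]
  [::
   (6%N, 0%N, comb [:: (0,-1,-4); (-1,-1,-9); (-1,-3,-29); (-4,-5,-67); (-4,-1,-39)]);
   (7%N, 0%N, comb [:: (0,-1,-4); (1,-2,-9); (-1,1,9); (7,-10,-46); (-1,-2,-21); (-3,1,-7)]);
   (8%N, 0%N, comb [:: (-1,1,10); (-1,2,19); (-3,2,9); (0,-1,-4); (-3,-1,-21); (1,0,10);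
     (-1,-2,-26)]);
   (9%N, 0%N, comb [:: (-1,1,11); (-2,1,6); (-3,1,1); (-1,-1,-9); (-7,4,8); (-2,-3,-39);
     (-2,3,21); (-3,8,65)]);
   (10%N, 0%N, comb [:: (-1,1,12); (3,1,47); (3,4,80); (0,-1,-4); (-1,3,34); (3,-1,13); (-3,4,32);
     (-1,4,33); (3,-2,-3)]);
   (11%N, 0%N, comb [:: (0,-1,-4); (-1,-1,-9); (-1,-3,-29); (-4,-3,-44); (-7,-3,-61); (-2,1,5);
     (-1,-2,-28); (-2,-1,-28); (-3,-4,-84); (-4,-1,-60)]);
   (12%N, 0%N, comb [:: (-1,1,14); (0,-1,-4); (-3,7,95); (-3,2,17); (-5,3,17); (-3,-1,-18);
     (-1,-4,-42); (-3,-2,-43); (-2,3,27); (-1,-3,-47); (-1,0,-12)]);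
   (13%N, 0%N, comb [:: (-1,1,15); (-1,2,28); (0,-1,-4); (-3,2,18); (-8,5,31); (-3,-1,-17);
     (-1,-4,-40); (-4,7,75); (-2,-1,-24); (-3,4,29); (-1,-2,-34); (-2,5,50)])].

Definition certificate6 : certificate := Certificate
  [::
   [::]; [::]; [:: (1,0,7); (4,-5,-1)]; [:: (-4,-3,-20); (1,0,7)]; [:: (-4,-3,-21); (1,0,7)]; [::
     (1,0,7); (5,4,29)];
   [:: (1,0,7); (-1,1,1)]]
  [::
   ((1,0,0), None, [:: (1,1,6)], [::]); ((6,-1,31), Some [:: (1,-1,0)], [:: (1,1,12)], [::]);
   ((5,-1,26), Some [:: (1,-1,0)], [:: (-5,4,-31)], [::]); ((4,-1,21), Some [:: (4,3,21)], [::
     (4,-3,27)], [::]);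
   ((4,-1,22), Some [:: (1,-1,0)], [:: (4,3,46)], [::]); ((5,-1,29), Some [:: (1,-1,0)], [::
     (-5,-4,-58)], [::]);
   ((6,-1,36), Some [:: (1,-1,0)], [:: (-6,5,-41)], [::])]
  [::
   [::]; [:: (1,0,6); (-4,-5,-25)]; [:: (-3,-4,-20); (1,0,6)]; [:: (-4,-3,-20); (1,0,6)];
   [:: (-5,-4,-27); (-1,0,-5)]; [:: (5,-11,-10); (-4,5,10)]]
  [::
   ((1,0,0), None, [:: (-1,1,1)], [:: (-1,-1,-6); (-1,0,-6)]);
   ((5,-1,29), Some [:: (-1,-1,-6)], [:: (-5,4,-35)], [:: (-1,-1,-12); (-1,0,-12)]);
   ((4,-1,22), Some [:: (-1,-1,-6)], [:: (-4,-3,-49)], [:: (-1,-1,-12); (1,0,13)]);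
   ((3,-1,15), Some [:: (-1,-1,-6)], [:: (3,-4,15)], [:: (3,-7,15); (3,-4,15)]);
   ((4,-1,20), Some [:: (-3,4,8)], [:: (4,3,48)], [:: (1,0,13); (1,1,13)]);
   ((5,-1,25), Some [:: (4,-5,-9)], [:: (5,4,60)], [:: (-1,-1,-12); (1,0,13)])]
  [::
   (false, 12, -1, 1%N, [:: (-1,1,2); (-1,2,3)]);
   (false, 14, -2, 2%N, [:: (-1,-1,-5); (-5,1,-18); (-5,6,-13); (-3,-1,-32)]);
   (true, 18, -2, 3%N, [:: (-1,-1,-6); (-1,-2,-13); (-3,-2,-38); (-1,-2,-20); (-1,-1,-21);
     (-1,0,-22)]);
   (false, 9, -1, 1%N, [:: (-2,-3,-15); (-3,-1,-19)]); (true, 6, -1, 1%N, [:: (-1,-1,-6); (1,0,8)])]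
  [::
   (6%N, 0%N, comb [:: (0,-1,-5); (1,0,9); (-1,-1,-11); (3,4,64); (-1,-3,-35)]);
   (7%N, 0%N, comb [:: (0,-1,-5); (-1,-1,-11); (-1,-3,-35); (-5,-9,-134); (-4,-3,-65);
     (-4,-1,-51)]);
   (8%N, 0%N, comb [:: (0,-1,-5); (-1,-1,-11); (-1,-3,-35); (-4,-3,-53); (-7,-2,-68); (-4,-3,-74);
     (-4,1,-30)]);
   (9%N, 0%N, comb [:: (0,-1,-5); (-1,-1,-11); (-2,-1,-17); (-2,1,7); (-2,3,31); (-1,-1,-17);
     (-5,8,67); (-1,3,30)]);
   (10%N, 0%N, comb [:: (0,-1,-5); (-1,1,14); (-2,1,8); (-2,3,34); (-5,2,2); (1,0,14); (2,-1,8);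
     (3,2,52); (1,-2,-13)]);
   (11%N, 0%N, comb [:: (-1,1,15); (-1,2,29); (0,-1,-5); (-1,-1,-11); (-1,3,43); (-5,4,31);
     (-7,2,-19); (-3,2,0); (-8,3,-44); (-3,-2,-74)]);
   (12%N, 0%N, comb [:: (0,-1,-5); (-1,1,16); (-2,1,10); (-4,-3,-38); (-2,-5,-62); (-2,3,40);
     (-3,-1,-31); (-9,5,-2); (-2,-3,-62); (-2,3,28); (-3,8,93)]);
   (13%N, 0%N, comb [:: (0,-1,-5); (-1,1,17); (-2,1,11); (-4,3,31); (-14,9,64); (-13,10,67);
     (-3,-1,-23); (-1,-4,-52); (-3,1,-12); (-5,4,10); (-7,4,-26); (-4,1,-45)])].

Definition certificate7 : certificate := Certificate
  [::
   [::]; [::]; [:: (1,0,8); (5,6,37)]; [:: (1,0,8); (4,5,31)]; [:: (1,0,8); (4,3,25)]; [::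
     (1,0,8); (-5,-4,-32)];
   [:: (1,0,8); (-5,-6,-40)]; [:: (-7,-6,-48); (-1,0,-7)]]
  [::
   ((1,0,0), None, [:: (1,1,7)], [::]); ((7,-1,43), Some [:: (-1,1,1)], [:: (-6,7,-35)], [::]);
   ((6,-1,37), Some [:: (1,-1,0)], [:: (-6,5,-43)], [::]); ((5,-1,31), Some [:: (1,-1,0)], [::
     (5,4,66)], [::]);
   ((4,-1,25), Some [:: (-4,-3,-24)], [:: (3,-4,18)], [::]); ((5,-1,33), Some [:: (5,4,33)], [::
     (4,-5,26)], [::]);
   ((6,-1,41), Some [:: (1,-1,0)], [:: (-6,-5,-82)], [::]); ((7,-1,49), Some [:: (1,1,8)], [::
     (7,-6,56)], [::])]
  [::
   [::]; [:: (-7,-6,-42); (-1,0,-6)]; [:: (-6,-5,-36); (-1,0,-6)]; [:: (-3,-4,-24); (1,0,7)];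
   [:: (-5,-4,-31); (-1,0,-6)]; [:: (-5,-6,-40); (-1,0,-6)]; [:: (1,0,7); (-7,-6,-47)]]
  [::
   ((1,0,0), None, [:: (1,1,8)], [:: (1,0,8); (1,1,8)]);
   ((6,-1,41), Some [:: (-1,-1,-7)], [:: (6,-5,49)], [:: (-6,7,-40); (1,0,15)]);
   ((5,-1,33), Some [:: (5,-6,-7)], [:: (5,-6,33)], [:: (-1,-1,-14); (1,0,15)]);
   ((4,-1,25), Some [:: (4,-5,-7)], [:: (-4,-3,-56)], [:: (3,-7,18); (-4,5,-24)]);
   ((4,-1,24), Some [:: (-1,-1,-7)], [:: (-4,5,-23)], [:: (-4,5,-23); (1,0,15)]);
   ((5,-1,30), Some [:: (-1,-1,-7)], [:: (5,-4,38)], [:: (-5,6,-29); (-1,0,-14)]);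
   ((6,-1,36), Some [:: (1,1,8)], [:: (6,-5,44)], [:: (1,0,15); (-1,-1,-14)])]
  [::
   (false, 14, -1, 1%N, [:: (1,0,7); (1,-1,-1)]);
   (true, 11, -1, 2%N, [:: (-1,-1,-7); (1,0,17); (-4,-9,-62); (1,1,16)]);
   (false, 25, -3, 3%N, [:: (-1,1,2); (-1,2,3); (-1,3,4); (1,-2,11); (3,-2,38); (-4,7,-19)]);
   (false, 20, -2, 2%N, [:: (1,-2,5); (-5,-6,-41); (6,-5,38); (-6,-1,-43)]);
   (true, 21, -2, 3%N, [:: (-1,-1,-7); (-1,-2,-15); (-5,-16,-119); (-1,-2,-23); (-1,-1,-24);
     (-1,0,-25)]);
   (true, 7, -1, 1%N, [:: (-1,-1,-7); (-1,0,-8)])]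
  [::
   (6%N, 0%N, cut_off [:: (0,-1,-6)] (Cut 1 (-1) (-10) (Cut (-1) 2 14 (Cut 1 1 18 (comb [::
     (-2,1,-4)]) single) single) single));
   (7%N, 0%N, comb [:: (0,-1,-6); (1,-2,-13); (-5,6,78); (-6,13,156); (-4,13,152); (-2,1,0)]);
   (8%N, 0%N, comb [:: (0,-1,-6); (-1,1,14); (-1,-1,-13); (-1,-3,-41); (-1,2,27); (-4,5,41);
     (-3,7,70)]);
   (9%N, 0%N, comb [:: (6,1,105); (0,-1,-6); (-1,1,15); (1,-2,-13); (-1,2,29); (3,5,112);
     (-3,2,15); (-5,1,-20)]);
   (10%N, 0%N, comb [:: (-3,4,68); (0,-1,-6); (-4,9,144); (-3,2,18); (-5,-2,-44); (-1,-4,-57);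
     (-4,-3,-83); (-1,-2,-46); (-1,0,-15)]);
   (11%N, 0%N, comb [:: (-1,1,18); (0,-1,-6); (-1,-1,-13); (-1,-3,-41); (-4,-3,-64);
     (-11,-4,-142); (-7,-6,-166); (-3,-1,-50); (-1,-1,-32); (-1,0,-16)]);
   (12%N, 0%N, comb [:: (-1,1,19); (-2,1,12); (-3,1,5); (-17,4,-14); (-5,4,39); (-1,-3,-33);
     (-1,-1,-20); (-3,-7,-137); (-5,-2,-96); (-5,-6,-192); (-1,0,-17)]);
   (13%N, 0%N, comb [:: (1,0,19); (7,6,235); (7,2,131); (0,-1,-6); (-1,-1,-13); (1,-3,-27);
     (-5,-8,-136); (-1,1,20); (-3,1,7); (6,-5,-22); (2,-7,-111); (-5,3,25)])].

Definition certificate8 : certificate := Certificate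
  [::
   [::]; [::]; [:: (-7,-6,-49); (1,0,9)]; [:: (1,0,9); (-5,-6,-42)]; [:: (1,0,9); (5,4,36)];
   [:: (-5,-6,-44); (-1,0,-8)]; [:: (-6,-5,-45); (-1,0,-8)]; [:: (-7,-8,-62); (-1,0,-8)]; [::
     (1,0,9); (-7,-8,-63)]]
  [::
   ((1,0,0), None, [:: (1,1,8)], [::]); ((8,-1,57), Some [:: (1,-1,0)], [:: (8,-7,65)], [::]);
   ((7,-1,50), Some [:: (-7,-6,-49)], [:: (-7,-6,-105)], [::]);
   ((6,-1,43), Some [:: (1,-1,0)], [:: (-5,6,-34)], [::]); ((5,-1,36), Some [:: (1,-1,0)], [::
     (-5,-4,-75)], [::]);
   ((5,-1,37), Some [:: (-5,-4,-36)], [:: (-5,4,-44)], [::]); ((6,-1,46), Some [:: (6,5,46)], [::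
     (-6,5,-53)], [::]);
   ((7,-1,55), Some [:: (-1,1,1)], [:: (-7,-6,-110)], [::]); ((8,-1,64), Some [:: (-1,-1,-8)], [::
     (7,-8,56)], [::])]
  [::
   [::]; [:: (-8,-7,-56); (1,0,8)]; [:: (1,0,8); (5,-6,-7)]; [:: (1,0,8); (4,-5,-7)]; [::
     (-5,-4,-35); (-1,0,-7)];
   [:: (1,0,8); (4,5,38)]; [:: (-5,6,12); (1,0,8)]; [:: (7,-15,-14); (6,-7,-13)]]
  [::
   ((1,0,0), None, [:: (-1,-1,-8)], [:: (1,-2,0); (-1,1,1)]);
   ((7,-1,55), Some [:: (1,1,9)], [:: (-7,-6,-117)], [:: (-1,-1,-16); (1,0,17)]);
   ((6,-1,46), Some [:: (-1,-1,-8)], [:: (6,-7,46)], [:: (5,-11,38); (-6,7,-45)]);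
   ((5,-1,37), Some [:: (-1,-1,-8)], [:: (-5,4,-45)], [:: (-1,-1,-16); (-1,0,-16)]);
   ((4,-1,28), Some [:: (1,1,9)], [:: (-4,5,-27)], [:: (-4,5,-27); (-1,0,-16)]);
   ((5,-1,35), Some [:: (-1,-1,-8)], [:: (5,-4,44)], [:: (1,0,17); (1,1,17)]);
   ((6,-1,42), Some [:: (5,-6,-11)], [:: (-6,7,-41)], [:: (-6,7,-41); (-6,13,-41)]);
   ((7,-1,49), Some [:: (1,1,9)], [:: (-7,6,-57)], [:: (1,0,17); (-1,-1,-16)])]
  [::
   (true, 8, -1, 1%N, [:: (-1,-1,-8); (-1,0,-9)]); (false, 12, -1, 1%N, [:: (-3,-4,-28);
     (-4,-1,-33)]);
   (false, 29, -3, 3%N, [:: (-1,1,2); (-6,1,-36); (-5,4,-34); (-6,1,-80); (-6,7,-74); (-6,13,-70)]);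
   (false, 19, -2, 2%N, [:: (1,-2,6); (-1,1,2); (-1,2,3); (4,-3,28)]); (false, 16, -1, 1%N, [::
     (-1,1,2); (-1,2,3)]);
   (true, 24, -2, 3%N, [:: (-1,-1,-8); (-1,-2,-17); (-5,-4,-84); (-1,-2,-26); (-1,-1,-27);
     (-1,0,-28)])]
  [::
   (6%N, 0%N, Cut (-1) (-1) (-15) (Leaf 2 0 1) (cut_off [:: (1,0,12)] (Cut 1 3 48 (comb [::
     (-4,-5,-107)]) single)));
   (7%N, 0%N, Leaf 7 1 2);
   (8%N, 0%N, comb [:: (1,0,15); (6,5,157); (0,-1,-7); (-1,-1,-15); (-2,-1,-23); (11,4,159);
     (1,2,40)]);
   (9%N, 0%N, comb [:: (0,-1,-7); (-1,-1,-15); (1,-3,-31); (8,-1,112); (1,1,33); (4,-5,-48);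
     (3,-1,0); (-1,1,17)]);
   (10%N, 0%N, comb [:: (-1,1,19); (-7,15,271); (-7,20,347); (0,-1,-7); (-1,-1,-15); (-5,4,33);
     (-3,8,118); (-5,-4,-99); (-1,3,39)]);
   (11%N, 0%N, comb [:: (-1,1,20); (-2,1,12); (-4,3,34); (0,-1,-7); (-11,6,32); (-4,3,19);
     (-11,6,-8); (-15,11,10); (-2,1,-10); (-1,0,-18)]);
   (12%N, 0%N, comb [:: (-1,1,21); (-1,2,41); (0,-1,-7); (-1,3,61); (-7,9,133); (-7,-6,-97);
     (-3,-8,-129); (-5,-3,-95); (-5,8,105); (-3,-4,-115); (-4,11,172)]);
   (13%N, 0%N, comb [:: (-5,6,135); (-5,11,240); (-5,16,345); (0,-1,-7); (-1,-1,-15); (-1,-3,-47);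
     (-7,-5,-123); (-7,5,42); (-2,1,-3); (-2,3,36); (-1,3,49); (-1,-1,-32)]);
   (14%N, 7%N, comb [:: (-1,-1,-8); (-8,-1,-58); (-1,1,-5); (-1,2,-4); (-1,3,-3); (-7,15,-83)]);
   (20%N, 11%N, comb [:: (-1,-1,-8); (-7,1,-39); (-8,7,-42); (-6,13,-14); (-7,20,-22); (-1,4,-1);
     (-6,19,-59); (-1,2,-19)]);
   (21%N, 12%N, comb [:: (1,0,30); (-1,-1,-8); (1,1,31); (-1,-2,-17); (5,-1,105); (-6,-5,-87);
     (-6,1,-75); (-6,-5,-131)])].

Definition certificate9 : certificate := Certificate
  [::
   [::]; [::]; [:: (1,0,10); (8,7,65)]; [:: (-6,7,3); (1,0,10)]; [:: (1,0,10); (-6,-5,-48)];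
   [:: (-5,-6,-49); (-1,0,-9)]; [:: (1,0,10); (-6,-5,-50)]; [:: (-6,7,7); (-1,0,-9)]; [::
     (-8,-7,-70); (1,0,10)];
   [:: (1,0,10); (8,9,81)]]
  [::
   ((1,0,0), None, [:: (1,1,9)], [::]); ((9,-1,73), Some [:: (1,-1,0)], [:: (-1,-1,-17)], [::]);
   ((8,-1,65), Some [:: (-1,1,1)], [:: (8,-7,74)], [::]); ((7,-1,57), Some [:: (1,-1,0)], [::
     (7,-6,66)], [::]);
   ((6,-1,49), Some [:: (-1,1,1)], [:: (6,-5,58)], [::]); ((5,-1,41), Some [:: (-5,-4,-40)], [::
     (-4,5,-31)], [::]);
   ((6,-1,51), Some [:: (-1,1,1)], [:: (6,5,105)], [::]); ((7,-1,61), Some [:: (-1,1,1)], [::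
     (-7,-6,-123)], [::]);
   ((8,-1,71), Some [:: (8,7,71)], [:: (-8,-7,-142)], [::]);
   ((9,-1,81), Some [:: (-1,-1,-9)], [:: (-1,-1,-18)], [::])]
  [::
   [::]; [:: (-9,-8,-72); (-1,0,-8)]; [:: (1,0,9); (-6,-7,-56)]; [:: (-6,7,10); (-1,0,-8)];
   [:: (-6,-5,-48); (-1,0,-8)]; [:: (-4,5,10); (1,0,9)]; [:: (-5,6,12); (-1,0,-8)]; [::
     (7,-15,-14); (6,-7,-13)];
   [:: (-9,-8,-79); (1,0,9)]]
  [::
   ((1,0,0), None, [:: (1,-1,0)], [:: (-1,1,1); (1,-2,0)]);
   ((8,-1,71), Some [:: (-1,-1,-9)], [:: (8,-7,81)], [:: (7,-15,62); (8,-9,71)]);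
   ((7,-1,61), Some [:: (-1,-1,-9)], [:: (-7,6,-70)], [:: (1,0,19); (-1,-1,-18)]);
   ((6,-1,51), Some [:: (-1,-1,-9)], [:: (-6,7,-50)], [:: (-1,-1,-18); (-1,0,-18)]);
   ((5,-1,41), Some [:: (5,-6,-9)], [:: (-5,6,-40)], [:: (-5,6,-40); (1,0,19)]);
   ((5,-1,40), Some [:: (-1,-1,-9)], [:: (-5,-4,-89)], [:: (-1,-1,-18); (-1,0,-18)]);
   ((6,-1,48), Some [:: (-1,-1,-9)], [:: (6,-7,48)], [:: (6,-13,48); (6,-7,48)]);
   ((7,-1,56), Some [:: (1,1,10)], [:: (-7,6,-65)], [:: (-1,-1,-18); (-1,0,-18)]);
   ((8,-1,64), Some [:: (-1,-1,-9)], [:: (-8,-7,-143)], [:: (-1,-1,-18); (1,0,19)])]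
  [::
   (false, 33, -3, 3%N, [:: (-7,-6,-56); (-6,-1,-52); (-6,-5,-97); (-7,-1,-118); (-7,-8,-183);
     (-8,-1,-201)]);
   (true, 9, -1, 1%N, [:: (-1,-1,-9); (1,0,11)]);
   (true, 14, -1, 2%N, [:: (-1,-1,-9); (-5,1,-46); (-1,-1,-19); (-1,0,-20)]);
   (false, 26, -2, 2%N, [:: (-7,-6,-59); (-8,-1,-71); (-1,-1,-17); (-1,0,-16)]);
   (false, 18, -1, 1%N, [:: (-1,1,2); (-1,0,-8)]);
   (true, 27, -2, 3%N, [:: (1,0,32); (-1,-1,-9); (1,1,31); (1,2,30); (-1,-2,-19); (6,19,181)])]
  [::
   (6%N, 0%N, Cut (-1) (-3) (-53) (Leaf 3 1 1) (Cut (-4) (-1) (-69) (comb [:: (4,5,122)]) single));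
   (7%N, 0%N, cut_off [:: (0,-1,-8); (1,-2,-17)] (Leaf 5 1 2));
   (8%N, 0%N, comb [:: (0,-1,-8); (-1,-1,-17); (-1,-3,-53); (-7,-9,-215); (-1,-2,-49);
     (-7,-6,-206); (-1,0,-16)]);
   (9%N, 0%N, comb [:: (0,-1,-8); (-1,1,19); (-1,2,37); (-1,3,55); (-1,-1,-17); (-7,10,119);
     (-2,7,108); (-3,-2,-62)]);
   (10%N, 0%N, comb [:: (0,-1,-8); (1,0,20); (5,6,220); (3,-1,22); (-1,1,21); (-1,-1,-17);
     (8,-9,-77); (-11,4,24); (-1,-2,-52)]);
   (11%N, 0%N, comb [:: (9,-1,168); (17,-9,96); (25,-17,24); (3,-8,-64); (-1,1,22); (4,-9,-105);
     (-3,-5,-104); (-1,2,43); (5,1,90); (-3,4,61)]);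
   (12%N, 0%N, comb [:: (0,-1,-8); (-1,-1,-17); (-2,-1,-26); (-2,-7,-134); (-8,-5,-157);
     (-9,-2,-113); (-13,-7,-299); (-9,-2,-162); (-5,4,24); (-5,9,134); (-1,6,120)]);
   (13%N, 0%N, comb [:: (1,0,24); (-1,1,25); (0,-1,-8); (1,1,48); (3,1,77); (-2,1,16); (-4,7,152);
     (1,-2,-17); (-4,11,222); (-2,3,44); (11,-6,26); (3,-8,-106)]);
   (14%N, 7%N, comb [:: (-1,-1,-9); (-1,0,-8); (-7,-6,-122); (-7,1,-115); (-7,8,-108);
     (-6,13,-87)]);
   (19%N, 10%N, comb [:: (-1,1,3); (-9,1,-62); (-7,-8,-125); (-7,-13,-179); (-5,-16,-186);
     (-5,-9,-167); (-6,-7,-203); (-6,-1,-191)]);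
   (20%N, 11%N, comb [:: (-1,-1,-9); (-1,-2,-19); (-7,-6,-116); (-7,1,-102); (-7,8,-88);
     (-7,15,-74); (-5,6,-104); (-7,15,-138)]);
   (22%N, 13%N, comb [:: (-1,-1,-9); (-1,0,-8); (-1,-1,-18); (-5,-11,-144); (-7,-22,-267);
     (-1,-2,-36); (-1,-1,-35); (-1,0,-34)]);
   (30%N, 19%N, comb [:: (-1,-1,-9); (-9,-1,-74); (-8,-7,-135); (-7,-1,-116); (-6,-5,-149);
     (-6,-1,-150); (-7,-8,-244); (-1,-2,-43); (-1,-1,-42); (-1,0,-41)]);
   (31%N, 20%N, comb [:: (-1,-1,-9); (-1,-2,-19); (-1,-3,-29); (-7,-15,-200); (-6,-17,-221);
     (-6,-13,-222); (-7,-20,-314); (-1,-2,-44); (-1,-1,-43); (-1,0,-42)]);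
   (32%N, 21%N, comb [:: (-1,-1,-9); (-1,-2,-19); (-1,-3,-29); (1,0,44); (8,-9,264);
     (-7,-15,-200); (-6,-17,-221); (-8,-15,-286); (8,-1,271); (8,7,279)])].

Definition certificate10 : certificate := Certificate
  [::
   [::]; [::]; [:: (1,0,11); (9,8,82)]; [:: (1,0,11); (-8,-7,-72)]; [:: (1,0,11); (-6,7,4)];
   [:: (-5,6,5); (-1,0,-10)]; [:: (1,0,11); (-5,6,6)]; [:: (-6,7,7); (1,0,11)]; [:: (-7,8,8);
     (-1,0,-10)];
   [:: (1,0,11); (-8,9,9)]; [:: (1,0,11); (-1,1,1)]]
  [::
   ((1,0,0), None, [:: (1,1,10)], [::]); ((10,-1,91), Some [:: (1,-1,0)], [:: (-1,-1,-19)], [::]);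
   ((9,-1,82), Some [:: (1,-1,0)], [:: (-9,-8,-171)], [::]); ((8,-1,73), Some [:: (-1,1,1)], [::
     (7,-8,63)], [::]);
   ((7,-1,64), Some [:: (-1,1,1)], [:: (7,6,134)], [::]); ((6,-1,55), Some [:: (6,5,55)], [::
     (-6,5,-64)], [::]);
   ((6,-1,56), Some [:: (1,-1,0)], [:: (-5,6,-45)], [::]); ((7,-1,67), Some [:: (7,6,67)], [::
     (-7,6,-76)], [::]);
   ((8,-1,78), Some [:: (1,-1,0)], [:: (-7,8,-67)], [::]); ((9,-1,89), Some [:: (1,-1,0)], [::
     (9,8,179)], [::]);
   ((10,-1,100), Some [:: (-1,-1,-10)], [:: (1,1,21)], [::])]
  [::
   [::]; [:: (8,-17,-9); (9,-10,-10)]; [:: (-8,9,11); (-7,15,10)]; [:: (-8,-7,-72); (-1,0,-9)];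
   [:: (-6,7,11); (-5,11,10)]; [:: (-6,-5,-54); (1,0,10)]; [:: (1,0,10); (5,-6,-11)]; [::
     (1,0,10); (8,7,77)];
   [:: (-9,-8,-87); (-1,0,-9)]; [:: (-8,9,18); (1,0,10)]]
  [::
   ((1,0,0), None, [:: (1,-1,0)], [:: (1,0,11); (1,1,11)]);
   ((9,-1,89), Some [:: (-1,-1,-10)], [:: (9,-10,89)], [:: (8,-17,79); (9,-10,89)]);
   ((8,-1,78), Some [:: (1,1,11)], [:: (-8,7,-88)], [:: (7,-15,68); (8,-9,78)]);
   ((7,-1,67), Some [:: (1,1,11)], [:: (-7,-6,-143)], [:: (-1,-1,-20); (-1,0,-20)]);
   ((6,-1,56), Some [:: (1,1,11)], [:: (-6,7,-55)], [:: (1,0,21); (1,1,21)]);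
   ((5,-1,45), Some [:: (1,1,11)], [:: (5,-6,45)], [:: (5,-11,45); (-5,6,-44)]);
   ((6,-1,54), Some [:: (5,-6,-11)], [:: (-6,5,-64)], [:: (6,-13,54); (6,-7,54)]);
   ((7,-1,63), Some [:: (1,1,11)], [:: (-7,8,-62)], [:: (7,-15,63); (-7,8,-62)]);
   ((8,-1,72), Some [:: (-1,-1,-10)], [:: (-8,7,-82)], [:: (1,0,21); (1,1,21)]);
   ((9,-1,81), Some [:: (8,-9,-17)], [:: (-9,-8,-179)], [:: (9,-19,81); (-9,10,-80)])]
  [::
   (false, 29, -2, 2%N, [:: (-8,-7,-76); (-9,-1,-89); (-1,-1,-19); (-1,0,-18)]);
   (true, 10, -1, 1%N, [:: (-1,-1,-10); (-1,0,-11)]);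
   (true, 30, -2, 3%N, [:: (-1,-1,-10); (-1,-2,-21); (-8,-25,-263); (-1,-2,-32); (-1,-1,-33);
     (-1,0,-34)]);
   (false, 24, -2, 2%N, [:: (-1,1,2); (-1,2,3); (-6,5,-51); (-5,-1,-94)]);
   (false, 20, -1, 1%N, [:: (-1,1,2); (-1,2,3)]);
   (false, 55, -5, 5%N, [:: (1,-2,35); (9,-10,313); (-1,1,2); (8,-15,208); (-1,2,3); (-9,10,-63);
     (7,-8,178); (6,-11,102); (7,-8,113); (6,-13,35)]);
   (false, 44, -4, 4%N, [:: (-1,1,2); (-10,1,-80); (-9,8,-74); (-8,1,-136); (-7,6,-123);
     (-6,1,-156); (-6,7,-150); (-8,17,-198)]);
   (false, 42, -3, 4%N, [:: (-1,1,2); (-1,2,3); (-1,1,-8); (-1,2,-7); (-10,11,-170); (-8,17,-126);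
     (-8,25,-126); (-1,2,-26)]);
   (false, 15, -1, 1%N, [:: (-1,1,2); (-6,1,-48)]);
   (true, 38, -3, 4%N, [:: (-1,-1,-10); (-1,-2,-21); (-1,-3,-32); (1,0,47); (1,1,46); (1,2,45);
     (-5,-9,-160); (1,3,44)]);
   (true, 45, -4, 4%N, [:: (-1,-1,-10); (-1,-2,-21); (-1,-3,-32); (-1,-4,-43); (-1,-3,-44);
     (-1,-2,-45); (-1,-1,-46); (-1,0,-47)]);
   (false, 37, -3, 3%N, [:: (-7,-6,-63); (-6,-1,-59); (-7,-6,-128); (-8,-1,-151); (-8,-9,-233);
     (-9,-1,-253)])]
  [::
   (7%N, 0%N, Leaf 7 1 4);
   (8%N, 0%N, comb [:: (1,0,19); (1,1,37); (0,-1,-9); (-1,-1,-19); (-2,-1,-29); (-17,-4,-210);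
     (1,-4,-64)]);
   (9%N, 0%N, comb [:: (9,1,210); (0,-1,-9); (-1,1,21); (-1,-1,-19); (-3,-1,-39); (-4,-5,-139);
     (10,9,380); (1,3,81)]);
   (10%N, 0%N, comb [:: (-1,1,23); (0,-1,-9); (-1,-1,-19); (-1,-3,-59); (-7,-8,-224);
     (-3,-10,-258); (-4,1,-20); (-7,9,124); (-8,-1,-197)]);
   (11%N, 0%N, comb [:: (1,0,24); (1,1,47); (7,15,522); (0,-1,-9); (1,-2,-19); (-4,7,172);
     (10,7,311); (-1,-2,-39); (-5,-8,-199); (5,-3,-22)]);
   (12%N, 0%N, Cut (-4) (-13) (-297) (Cut (-1) (-1) (-19) (Leaf 2 0 1) (comb [:: (-3,1,-9)])) (Cut
     (-6) (-1) (-179) (Cut (-3) (-1) (-79) (comb [:: (-1,1,26); (-5,-2,-88); (-4,-7,-220);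
     (-9,-5,-260)]) (comb [:: (-6,-5,-269)])) single));
   (13%N, 0%N, comb [:: (-1,1,28); (0,-1,-9); (-2,1,18); (1,0,27); (1,1,53); (1,-2,-19); (3,1,85);
     (5,8,310); (-3,-5,-102); (-10,7,98); (-2,1,2); (2,-3,-35)]);
   (20%N, 11%N, Cut (-9) 17 (-143) (Cut (-8) 9 (-47) (Leaf 3 1 1) (Cut (-8) 9 (-124) (comb [::
     (-6,13,-28)]) single)) (Leaf 3 1 0));
   (21%N, 12%N, comb [:: (-1,-1,-10); (-1,-2,-21); (-8,-25,-263); (-6,-25,-265); (-9,-26,-366);
     (-9,-17,-348); (-10,-11,-382); (-1,0,-36)])].

Definition certificate11 : certificate := Certificate
  [::
   [::]; [::]; [:: (1,0,12); (9,-10,-1)]; [:: (-8,9,3); (1,0,12)]; [:: (1,0,12); (-7,-8,-80)];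
   [:: (1,0,12); (-6,7,5)]; [:: (-6,-7,-71); (-1,0,-11)]; [:: (-7,-6,-72); (1,0,12)]; [::
     (1,0,12); (7,8,85)];
   [:: (-9,-8,-96); (1,0,12)]; [:: (-10,-9,-108); (-1,0,-11)]; [:: (-1,1,1); (-1,0,-11)]]
  [::
   ((1,0,0), None, [:: (1,1,11)], [::]); ((11,-1,111), Some [:: (1,-1,0)], [:: (1,1,22)], [::]);
   ((10,-1,101), Some [:: (10,9,101)], [:: (-10,9,-111)], [::]);
   ((9,-1,91), Some [:: (1,-1,0)], [:: (-9,-8,-189)], [::]); ((8,-1,81), Some [:: (-1,1,1)], [::
     (8,-7,92)], [::]);
   ((7,-1,71), Some [:: (1,-1,0)], [:: (-7,6,-81)], [::]); ((6,-1,61), Some [:: (1,-1,0)], [::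
     (-6,-5,-126)], [::]);
   ((7,-1,73), Some [:: (-1,1,1)], [:: (-7,6,-83)], [::]); ((8,-1,85), Some [:: (8,7,85)], [::
     (-8,-7,-172)], [::]);
   ((9,-1,97), Some [:: (-9,-8,-96)], [:: (-9,8,-107)], [::]);
   ((10,-1,109), Some [:: (1,-1,0)], [:: (10,-9,120)], [::]);
   ((11,-1,121), Some [:: (1,-1,0)], [:: (-1,-1,-22)], [::])]
  [::
   [::]; [:: (-9,-10,-100); (1,0,11)]; [:: (-10,-9,-100); (1,0,11)]; [:: (7,-15,-10); (-8,9,12)];
   [:: (6,-13,-10); (-7,8,12)]; [:: (1,0,11); (-7,-6,-70)]; [:: (1,0,11); (5,-6,-11)]; [::
     (-7,-8,-84); (1,0,11)];
   [:: (1,0,11); (7,8,86)]; [:: (-10,-9,-107); (-1,0,-10)]; [:: (1,0,11); (11,10,120)]]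
  [::
   ((1,0,0), None, [:: (-1,-1,-11)], [:: (-1,-1,-11); (-1,0,-11)]);
   ((10,-1,109), Some [:: (-1,-1,-11)], [:: (-10,9,-120)], [:: (9,-19,98); (-10,11,-108)]);
   ((9,-1,97), Some [:: (1,1,12)], [:: (9,-10,97)], [:: (1,0,23); (-1,-1,-22)]);
   ((8,-1,85), Some [:: (-1,-1,-11)], [:: (8,-9,85)], [:: (-1,-1,-22); (1,0,23)]);
   ((7,-1,73), Some [:: (1,1,12)], [:: (-7,-6,-156)], [:: (1,0,23); (-1,-1,-22)]);
   ((6,-1,61), Some [:: (-1,-1,-11)], [:: (-6,-5,-132)], [:: (-1,-1,-22); (-1,0,-22)]);
   ((6,-1,60), Some [:: (1,1,12)], [:: (-6,-5,-131)], [:: (1,0,23); (-6,7,-59)]);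
   ((7,-1,70), Some [:: (1,1,12)], [:: (7,-6,82)], [:: (1,0,23); (-7,8,-69)]);
   ((8,-1,80), Some [:: (-1,-1,-11)], [:: (8,7,176)], [:: (-8,9,-79); (-1,0,-22)]);
   ((9,-1,90), Some [:: (-1,-1,-11)], [:: (9,-8,102)], [:: (-9,10,-89); (1,0,23)]);
   ((10,-1,100), Some [:: (9,-10,-19)], [:: (10,9,220)], [:: (1,0,23); (1,1,23)])]
  [::
   (true, 11, -1, 1%N, [:: (-1,-1,-11); (-1,0,-12)]); (false, 22, -1, 1%N, [:: (-1,1,2);
     (-1,0,-10)]);
   (true, 17, -1, 2%N, [:: (-1,-1,-11); (-7,-13,-154); (-1,-1,-23); (-1,0,-24)]);
   (true, 33, -2, 3%N, [:: (-1,-1,-11); (-1,-2,-23); (-8,-7,-183); (-1,-2,-35); (-1,-1,-36);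
     (-1,0,-37)]);
   (false, 32, -2, 2%N, [:: (1,-2,9); (11,-12,98); (1,-2,-2); (1,-1,-1)]);
   (false, 49, -4, 4%N, [:: (-1,1,2); (-1,2,3); (-1,3,4); (-1,4,5); (-6,17,-46); (-6,11,-112);
     (-6,5,-178); (-5,-1,-205)]);
   (false, 41, -3, 3%N, [:: (-1,1,2); (-7,1,-64); (-8,7,-79); (-9,1,-176); (-10,9,-199);
     (-11,1,-328)]);
   (false, 67, -5, 6%N, [:: (7,-1,421); (-1,1,2); (-1,2,3); (-9,8,-89); (8,-7,405); (-9,17,-81);
     (9,-1,451); (9,-10,352); (9,-19,253); (9,-28,154); (11,-23,198); (11,-12,209)]);
   (true, 42, -3, 4%N, [:: (-1,-1,-11); (-1,-2,-23); (-1,-3,-35); (-5,-9,-174); (-1,-3,-47);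
     (-1,-2,-48); (-1,-1,-49); (-1,0,-50)])]
  [::
   (7%N, 0%N, Cut 1 (-2) (-36) (Leaf 5 1 1) (Leaf 2 1 0));
   (8%N, 0%N, Cut (-3) (-1) (-58) (Cut (-9) (-7) (-232) (cut_off [:: (0,-1,-10)] (Cut (-19) (-9)
     (-298) (Leaf 2 1 1) single)) single) (Leaf 3 1 1));
   (9%N, 0%N, comb [:: (-1,1,23); (-2,1,12); (-4,3,34); (0,-1,-10); (-11,5,-10); (-2,3,45);
     (-6,17,308); (-1,-1,-33)]);
   (10%N, 0%N, comb [:: (7,-1,139); (6,5,259); (3,1,74); (-1,1,25); (0,-1,-10); (9,10,363);
     (5,14,360); (7,-2,33); (5,-7,-99)]);
   (11%N, 0%N, Cut (-2) (-1) (-32) (Leaf 3 0 1) (Cut (-9) (-10) (-493) (cut_off [:: (8,17,651);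
     (-4,5,122)] (Cut 1 1 37 (comb [:: (2,-1,8)]) (comb [:: (-1,2,30)]))) (comb [:: (-1,0,-25)])));
   (12%N, 0%N, Cut (-3) (-1) (-86) (Cut (-6) 13 225 (Cut (-2) 1 18 (Leaf 2 0 1) (Cut (-4) (-7)
     (-270) (comb [:: (-8,3,7)]) single)) (Cut (-11) 4 (-31) (Leaf 2 0 1) (Leaf 2 0 1))) (Leaf 3 1
     1));
   (13%N, 0%N, Cut (-1) 3 88 (Cut 1 (-1) (-29) (comb [:: (-1,2,59)]) single) (Cut (-1) 12 253 (Cut
     (-3) (-1) (-67) (comb [:: (3,-2,-32)]) (Cut 5 7 294 (Cut 2 (-3) (-52) (comb [:: (3,-8,-177)])
     single) single)) (Cut (-1) 0 (-11) (Cut (-2) 1 0 (comb [:: (1,-1,-10)]) single) single)));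
   (14%N, 7%N, comb [:: (1,0,31); (8,-9,144); (9,-1,171); (9,-10,63); (9,-19,-47); (1,-1,-2)]);
   (19%N, 0%N, Cut 3 1 44 (Cut (-15) (-22) (-1006) (Cut (-8) 5 67 (comb [:: (1,-3,-98)]) (comb [::
     (-2,-3,-87); (10,-3,113); (6,-11,-215)])) (Cut (-21) (-10) (-868) (Cut (-3) 5 134 (cut_off [::
     (4,-3,-70)] (Leaf 2 1 1)) single) (Leaf 5 1 2))) (Leaf 4 0 1));
   (20%N, 11%N, Cut (-10) 9 (-83) (Leaf 3 1 1) (Cut 7 (-22) 98 (Leaf 2 1 0) (cut_off [::
     (7,-15,105)] (Leaf 3 1 0))));
   (21%N, 12%N, cut_off [:: (-7,8,24); (-8,1,-71)] (Cut (-10) 19 (-189) (cut_off [:: (-7,8,-54)]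
     (Cut (-9) 10 (-167) (comb [:: (-6,13,-40)]) single)) (Leaf 3 1 0)));
   (22%N, 13%N, Cut (-11) 1 (-98) (Leaf 2 1 1) (Cut 8 (-9) 54 (Cut 9 (-10) 261 (Leaf 2 1 0) (Cut 9
     (-17) 67 (Leaf 3 1 0) single)) single));
   (30%N, 19%N, Cut 9 (-10) 258 (cut_off [:: (1,-2,39)] (Cut (-10) 9 (-401) (comb [::
     (9,-19,251)]) single)) (Cut 10 (-9) 84 (cut_off [:: (-9,1,-170)] (Leaf 3 1 1)) (Leaf 3 1 1)));
   (31%N, 20%N, comb [:: (-1,-1,-11); (-11,-1,-112); (-10,-9,-209); (-9,-1,-184); (-8,-7,-247);
     (-5,1,-142); (-6,-5,-245); (-6,1,-239); (-6,7,-233); (-5,11,-189)]);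
   (41%N, 28%N, comb [:: (1,0,62); (-6,7,19); (11,-10,561); (9,1,470); (-7,1,-64); (-7,8,-57);
     (9,10,479); (9,19,488); (8,7,334); (8,-1,246); (8,-9,158); (-9,19,-70)]);
   (58%N, 43%N, comb [:: (-1,1,2); (-1,2,3); (-1,1,-9); (-1,0,-21); (-1,-1,-33); (-1,-2,-45);
     (-1,-3,-57); (-1,-2,-56); (-1,-1,-55); (-1,0,-54); (-9,-8,-590); (-9,1,-581); (-9,10,-572);
     (-8,17,-501)])].

Definition certificate12 : certificate := Certificate
  [::
   [::]; [::]; [:: (1,0,13); (-10,-11,-121)]; [:: (1,0,13); (9,-10,-2)]; [:: (-9,-8,-99);
     (-1,0,-12)];
   [:: (-7,-8,-88); (1,0,13)]; [:: (-7,-6,-77); (-1,0,-12)]; [:: (1,0,13); (7,6,79)]; [::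
     (1,0,13); (8,7,92)];
   [:: (1,0,13); (-8,9,9)]; [:: (-10,-11,-129); (-1,0,-12)]; [:: (-10,11,11); (1,0,13)]; [::
     (1,0,13); (1,-1,0)]]
  [::
   ((1,0,0), None, [:: (1,1,12)], [::]); ((12,-1,133), Some [:: (-1,1,1)], [:: (12,-11,145)], [::]);
   ((11,-1,122), Some [:: (1,-1,0)], [:: (-10,11,-109)], [::]);
   ((10,-1,111), Some [:: (1,-1,0)], [:: (-10,-9,-230)], [::]);
   ((9,-1,100), Some [:: (-1,1,1)], [:: (9,-8,112)], [::]);
   ((8,-1,89), Some [:: (-8,-7,-88)], [:: (-8,7,-100)], [::]);
   ((7,-1,78), Some [:: (-7,-6,-77)], [:: (6,-7,66)], [::]); ((7,-1,79), Some [:: (-1,1,1)], [::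
     (-7,6,-90)], [::]);
   ((8,-1,92), Some [:: (1,-1,0)], [:: (-7,8,-79)], [::]); ((9,-1,105), Some [:: (9,8,105)], [::
     (-9,8,-116)], [::]);
   ((10,-1,118), Some [:: (-1,1,1)], [:: (-10,9,-129)], [::]);
   ((11,-1,131), Some [:: (1,-1,0)], [:: (11,10,263)], [::]);
   ((12,-1,144), Some [:: (-1,-1,-12)], [:: (-11,12,-131)], [::])]
  [::
   [::]; [:: (-12,-11,-132); (-1,0,-11)]; [:: (9,-19,-11); (10,-11,-12)]; [:: (-10,-9,-110);
     (1,0,12)];
   [:: (1,0,12); (7,8,89)]; [:: (-6,-7,-77); (1,0,12)]; [:: (-6,7,13); (6,-13,-12)]; [:: (1,0,12);
     (6,-7,-13)];
   [:: (8,-17,-16); (-7,8,16)]; [:: (-8,9,18); (-9,19,19)]; [:: (-11,-10,-129); (-1,0,-11)];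
   [:: (-12,-11,-142); (1,0,12)]]
  [::
   ((1,0,0), None, [:: (-1,1,1)], [:: (-1,1,1); (-1,0,-12)]);
   ((11,-1,131), Some [:: (1,1,13)], [:: (11,-10,144)], [:: (-1,-1,-24); (-1,0,-24)]);
   ((10,-1,118), Some [:: (1,1,13)], [:: (10,-9,131)], [:: (-1,-1,-24); (-1,0,-24)]);
   ((9,-1,105), Some [:: (-9,10,13)], [:: (-9,8,-117)], [:: (-1,-1,-24); (-1,0,-24)]);
   ((8,-1,92), Some [:: (-8,9,13)], [:: (8,7,196)], [:: (1,0,25); (1,1,25)]);
   ((7,-1,79), Some [:: (7,-8,-12)], [:: (7,6,170)], [:: (-7,8,-78); (1,0,25)]);
   ((6,-1,66), Some [:: (1,1,13)], [:: (-6,5,-78)], [:: (-6,7,-65); (1,0,25)]);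
   ((7,-1,77), Some [:: (-1,-1,-12)], [:: (-7,-6,-167)], [:: (1,0,25); (1,1,25)]);
   ((8,-1,88), Some [:: (-7,8,16)], [:: (8,-9,88)], [:: (-1,-1,-24); (1,0,25)]);
   ((9,-1,99), Some [:: (1,1,13)], [:: (-9,-8,-215)], [:: (1,0,25); (-1,-1,-24)]);
   ((10,-1,110), Some [:: (-1,-1,-12)], [:: (10,-11,110)], [:: (1,0,25); (1,1,25)]);
   ((11,-1,121), Some [:: (1,1,13)], [:: (11,10,264)], [:: (-11,12,-120); (-11,23,-120)])]
  [::
   (false, 18, -1, 1%N, [:: (-1,1,2); (-5,11,17)]); (true, 12, -1, 1%N, [:: (-1,-1,-12);
     (-1,0,-13)]);
   (false, 24, -1, 1%N, [:: (-1,1,2); (1,-2,-2)]);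
   (true, 36, -2, 3%N, [:: (-1,-1,-12); (-1,-2,-25); (-10,-31,-389); (-1,-2,-38); (-1,-1,-39);
     (-1,0,-40)]);
   (false, 29, -2, 2%N, [:: (-1,1,2); (-1,2,3); (-7,6,-74); (-6,-1,-137)]);
   (false, 54, -4, 4%N, [:: (-1,1,2); (-1,2,3); (-9,10,-81); (-8,15,-77); (-7,8,-140);
     (-7,15,-133); (-10,31,-188); (-1,2,-31)]);
   (false, 39, -3, 3%N, [:: (-1,-1,-11); (-11,1,-108); (1,-2,21); (9,-10,181); (10,-21,79);
     (-11,12,-97)]);
   (false, 35, -2, 2%N, [:: (-9,-10,-116); (-10,-21,-251); (-1,-1,-23); (-1,0,-22)]);
   (true, 46, -3, 4%N, [:: (1,0,55); (1,1,54); (1,2,53); (-1,-1,-12); (1,3,52); (-1,-2,-25);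
     (6,11,228); (1,3,39)]);
   (false, 45, -3, 3%N, [:: (-7,-6,-77); (-8,-1,-95); (-9,-8,-202); (-10,-1,-229); (-10,-11,-351);
     (-11,-1,-375)])]
  [::
   (7%N, 0%N, Cut 0 1 12 (cut_off [:: (1,-2,-23)] (Leaf 5 1 2)) single);
   (8%N, 0%N, comb [:: (0,-1,-11); (7,-1,127); (7,6,281); (17,6,369); (-1,-1,-23); (-21,-10,-361);
     (4,7,212)]);
   (9%N, 0%N, Cut (-2) (-1) (-35) (Leaf 3 0 1) (Cut (-23) 11 (-155) (Cut (-13) (-1) (-179) (Leaf 2
     1 1) (Leaf 2 1 1)) (Leaf 2 0 1)));
   (10%N, 0%N, cut_off [:: (-1,1,27)] (Cut (-6) (-17) (-608) (Cut (-8) (-9) (-353) (Cut (-1) (-1)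
     (-23) (Leaf 2 0 1) (Cut (-4) (-13) (-357) (comb [:: (-3,1,-11)]) single)) single) (Leaf 3 1
     1)));
   (11%N, 0%N, Cut 12 (-35) (-839) (Cut 3 (-1) 25 (Leaf 2 0 1) (Cut (-1) (-1) (-23) (Leaf 2 0 1)
     (comb [:: (7,-6,-59)]))) (cut_off [:: (-7,-11,-395); (-11,-4,-247)] (Leaf 3 1 1)));
   (12%N, 0%N, Cut (-13) (-3) (-278) (Cut (-1) (-1) (-23) (Leaf 2 0 1) (comb [:: (-1,1,31);
     (-1,-3,-71); (-7,-9,-288); (-2,9,262)])) (Cut (-19) 9 (-182) (Cut (-15) 4 (-191) (Leaf 2 1 1)
     single) (Leaf 2 0 1)));
   (13%N, 0%N, Cut (-2) (-1) (-35) (Leaf 3 0 1) (Cut (-2) 1 (-19) (Cut (-9) (-5) (-389) (Cut (-11)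
     (-17) (-762) (Cut (-2) 1 10 (comb [:: (-3,-7,-262)]) (comb [:: (-7,10,167); (-3,-5,-153)]))
     (Leaf 2 1 0)) single) (Leaf 2 0 1)));
   (14%N, 7%N, comb [:: (-10,11,33); (-11,21,31); (1,0,34); (11,-12,231); (10,1,232); (9,-10,81)]);
   (19%N, 0%N, Cut (-1) (-12) (-299) (Cut (-1) 0 (-11) (Leaf 3 1 1) single) (Cut 12 (-13) (-389)
     (cut_off [:: (9,1,420)] (Cut (-15) (-1) (-473) (Leaf 7 1 4) (cut_off [:: (10,9,777)] (Leaf 2 0
     1)))) (Leaf 4 1 1)));
   (20%N, 0%N, Cut (-34) 23 127 (Cut (-3) 1 20 (cut_off [:: (-1,1,44)] (Leaf 2 0 1)) (Cut (-1)
     (-2) (-90) (Cut (-1) 2 35 (comb [:: (-5,8,209); (-5,-3,-126)]) single) (Cut (-3) (-1) (-116)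
     (Cut (-7) (-11) (-648) (comb [:: (-13,-7,-506)]) single) single))) (Cut (-1) (-1) (-37) (Leaf 2
     0 1) (Cut (-2) 1 (-30) (Cut (-1) 3 62 (comb [:: (-5,-4,-261); (-19,6,-314); (-4,7,175)])
     single) (Leaf 2 0 1))));
   (21%N, 12%N, Cut 10 (-31) 47 (Cut (-10) 29 (-180) (Leaf 2 1 0) (Leaf 2 1 0)) (Cut 1 (-2) (-4)
     (Cut 1 (-3) (-6) (comb [:: (-5,21,48)]) single) (Leaf 2 1 0)));
   (22%N, 13%N, comb [:: (-1,-1,-12); (-7,1,-70); (-8,-7,-186); (-9,-1,-215); (-10,-9,-346);
     (-11,-1,-384); (-1,-1,-46); (-1,0,-45)]);
   (29%N, 18%N, comb [:: (1,0,54); (-1,1,3); (-11,-1,-122); (-11,-12,-265); (-10,1,-207);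
     (11,-12,451); (-10,11,-187); (11,-23,319); (-10,21,-167); (4,-3,130)]);
   (30%N, 19%N, comb [:: (-1,1,3); (-1,2,5); (-11,12,-87); (-10,19,-74); (-9,10,-170);
     (-8,15,-150); (-7,8,-209); (-8,15,-240); (-9,10,-372); (-8,17,-318)]);
   (31%N, 20%N, comb [:: (-1,-1,-12); (-9,1,-94); (-8,-7,-184); (-7,-1,-167); (-8,-7,-274);
     (-9,-1,-314); (-10,-9,-456); (-11,-1,-505); (-1,-1,-57); (-1,0,-56)]);
   (32%N, 21%N, Cut (-11) 1 (-241) (cut_off [:: (-10,11,33); (-11,23,46)] (Leaf 2 1 0)) (Cut (-12)
     11 (-551) (cut_off [:: (-10,11,-208)] (Cut (-11) 1 (-503) (Leaf 3 1 1) single)) (Leaf 2 1 0)));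
   (42%N, 29%N, Cut (-12) 13 (-658) (Cut (-1) 2 5 (Leaf 2 1 0) (Cut (-10) 19 (-193) (comb [::
     (-11,12,-87); (-9,19,-51); (-10,11,-189)]) (cut_off [:: (-10,11,-309); (-9,19,-268)] (Cut (-10)
     (-1) (-571) (Leaf 2 1 0) single)))) (Leaf 2 1 0));
   (43%N, 30%N, Cut (-7) (-6) (-398) (cut_off [:: (7,1,322)] (Cut 1 1 13 (Cut (-7) (-6) (-314)
     (Cut (-9) (-8) (-305) (Cut 11 10 253 (comb [:: (-10,-1,-224)]) (comb [:: (12,1,135)])) (comb
     [:: (8,1,271)])) single) single)) (cut_off [:: (-6,1,-334)] (Cut (-1) 0 (-68) (comb [::
     (-5,6,-273)]) single)))].

Definition certificate13 : certificate := Certificate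
  [::
   [::]; [::]; [:: (1,0,14); (12,11,145)]; [:: (-10,11,3); (-1,0,-13)]; [:: (-9,10,4); (-1,0,-13)];
   [:: (-8,-9,-108); (1,0,14)]; [:: (-8,-7,-96); (-1,0,-13)]; [:: (1,0,14); (-6,-7,-84)]; [::
     (1,0,14); (8,7,99)];
   [:: (1,0,14); (8,9,113)]; [:: (-10,-11,-139); (-1,0,-13)]; [:: (-10,11,11); (-1,0,-13)];
   [:: (1,0,14); (-11,12,12)]; [:: (-1,1,1); (-1,0,-13)]]
  [::
   ((1,0,0), None, [:: (1,1,13)], [::]); ((13,-1,157), Some [:: (-13,-12,-156)], [:: (-1,-1,-25)],
     [::]);
   ((12,-1,145), Some [:: (-12,-11,-144)], [:: (-12,11,-157)], [::]);
   ((11,-1,133), Some [:: (1,-1,0)], [:: (11,10,276)], [::]);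
   ((10,-1,121), Some [:: (1,-1,0)], [:: (-9,10,-107)], [::]);
   ((9,-1,109), Some [:: (-9,-8,-108)], [:: (8,-9,96)], [::]);
   ((8,-1,97), Some [:: (-1,1,1)], [:: (-8,-7,-200)], [::]); ((7,-1,85), Some [:: (1,-1,0)], [::
     (7,6,176)], [::]);
   ((8,-1,99), Some [:: (-8,-7,-98)], [:: (8,-7,112)], [::]);
   ((9,-1,113), Some [:: (9,8,113)], [:: (9,8,230)], [::]);
   ((10,-1,127), Some [:: (-1,1,1)], [:: (10,-9,140)], [::]);
   ((11,-1,141), Some [:: (-11,-10,-140)], [:: (11,-10,154)], [::]);
   ((12,-1,155), Some [:: (-12,-11,-154)], [:: (12,11,311)], [::]);
   ((13,-1,169), Some [:: (1,-1,0)], [:: (-1,-1,-26)], [::])]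
  [::
   [::]; [:: (-13,-12,-156); (1,0,13)]; [:: (1,0,13); (-12,-11,-144)]; [:: (9,-19,-12);
     (10,-11,-13)];
   [:: (-9,10,14); (-1,0,-12)]; [:: (1,0,13); (-7,-8,-96)]; [:: (-8,-7,-96); (1,0,13)]; [::
     (-8,-7,-97); (1,0,13)];
   [:: (-7,8,16); (-8,17,17)]; [:: (9,-19,-18); (-8,9,18)]; [:: (10,-21,-20); (-9,10,20)];
   [:: (-12,-11,-153); (1,0,13)]; [:: (12,-25,-24); (11,-12,-23)]]
  [::
   ((1,0,0), None, [:: (1,1,14)], [:: (1,0,14); (1,1,14)]);
   ((12,-1,155), Some [:: (-12,13,14)], [:: (12,-11,169)], [:: (-1,-1,-26); (1,0,27)]);
   ((11,-1,141), Some [:: (1,1,14)], [:: (11,10,295)], [:: (1,0,27); (10,-11,128)]);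
   ((10,-1,127), Some [:: (1,1,14)], [:: (10,-9,141)], [:: (9,-19,114); (10,-11,127)]);
   ((9,-1,113), Some [:: (1,1,14)], [:: (-9,10,-112)], [:: (-9,10,-112); (-1,0,-26)]);
   ((8,-1,99), Some [:: (-8,9,14)], [:: (-8,7,-112)], [:: (7,-15,86); (8,-9,99)]);
   ((7,-1,85), Some [:: (7,-8,-13)], [:: (7,-6,99)], [:: (6,-13,72); (7,-8,85)]);
   ((7,-1,84), Some [:: (1,1,14)], [:: (7,-6,98)], [:: (7,-15,84); (-7,8,-83)]);
   ((8,-1,96), Some [:: (-1,-1,-13)], [:: (8,7,208)], [:: (-1,-1,-26); (-1,0,-26)]);
   ((9,-1,108), Some [:: (-1,-1,-13)], [:: (-9,10,-107)], [:: (-1,-1,-26); (1,0,27)]);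
   ((10,-1,120), Some [:: (-1,-1,-13)], [:: (-10,11,-119)], [:: (-1,-1,-26); (1,0,27)]);
   ((11,-1,132), Some [:: (-10,11,22)], [:: (-11,10,-145)], [:: (-1,-1,-26); (-1,0,-26)]);
   ((12,-1,144), Some [:: (-1,-1,-13)], [:: (12,-13,144)], [:: (1,0,27); (-1,-1,-26)])]
  [::
   (false, 49, -3, 3%N, [:: (-8,-7,-97); (-9,-1,-116); (-10,-9,-245); (-11,-1,-274);
     (-11,-12,-419); (-12,-1,-445)]);
   (false, 26, -1, 1%N, [:: (1,-2,-2); (1,-1,-1)]);
   (true, 50, -3, 4%N, [:: (-1,-1,-13); (-1,-2,-27); (-1,-3,-41); (-7,-13,-286); (-1,-3,-55);
     (-1,-2,-56); (-1,-1,-57); (-1,0,-58)]);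
   (false, 81, -5, 6%N, [:: (-12,-11,-153); (-13,-1,-168); (-13,-14,-337); (-13,-25,-493);
     (-14,-15,-532); (-12,-25,-612); (-12,-11,-586); (-12,1,-574); (-12,13,-562); (-12,25,-550);
     (-7,22,-316); (-1,2,-59)]);
   (false, 59, -4, 4%N, [:: (-1,1,2); (-1,2,3); (-1,3,4); (-1,4,5); (-8,25,-65); (-1,4,-8);
     (-1,3,-21); (-1,2,-34)]);
   (true, 20, -1, 2%N, [:: (-1,-1,-13); (-7,-15,-194); (1,0,29); (1,1,28)]);
   (true, 39, -2, 3%N, [:: (-1,-1,-13); (-1,-2,-27); (-11,-34,-461); (-1,-2,-41); (-1,-1,-42);
     (-1,0,-43)]);
   (true, 43, -3, 3%N, [:: (1,0,45); (1,1,44); (1,2,43); (1,3,42); (1,2,28); (1,1,14)]);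
   (true, 13, -1, 1%N, [:: (-1,-1,-13); (-1,0,-14)]);
   (true, 32, -2, 3%N, [:: (1,0,44); (1,1,43); (-1,-1,-13); (1,2,42); (-1,-2,-27); (9,28,373)]);
   (false, 38, -2, 2%N, [:: (-1,1,2); (-1,2,3); (-11,34,46); (-1,2,-10)])]
  [::
   (7%N, 0%N, Leaf 7 1 2);
   (8%N, 0%N, Cut (-19) (-6) (-425) (Cut 0 1 13 (comb [:: (-1,-1,-25); (-23,-11,-430);
     (-3,-5,-165)]) single) (comb [:: (-13,-12,-587); (-12,1,-251)]));
   (9%N, 0%N, comb [:: (-1,1,27); (-1,2,53); (-1,3,79); (0,-1,-12); (-1,-1,-25); (-7,6,66);
     (-7,20,429); (-1,3,52)]);
   (10%N, 0%N, comb [:: (0,-1,-12); (-6,7,210); (-13,7,119); (1,0,29); (-23,17,261); (2,-1,16);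
     (-23,11,27); (-19,5,-148); (3,-5,-94)]);
   (11%N, 0%N, Cut (-2) 1 (-17) (Cut 14 (-1) 209 (Leaf 2 1 1) (cut_off [:: (7,8,374); (27,-13,57)]
     (Leaf 5 1 3))) (Leaf 2 0 1));
   (12%N, 0%N, Cut (-2) (-1) (-38) (Leaf 3 0 1) (Cut (-23) 15 100 (Cut (-1) 8 255 (cut_off [::
     (-10,-13,-585)] (Leaf 2 1 0)) single) (Cut (-1) 0 (-32) (Cut (-4) 1 (-57) (comb [::
     (-14,5,-112)]) (Leaf 2 0 1)) single)));
   (13%N, 0%N, Cut (-25) (-13) (-798) (Cut 0 1 13 (cut_off [:: (-1,-1,-25)] (Cut (-7) 13 377 (comb
     [:: (-6,-13,-545)]) (Cut (-6) (-11) (-359) (comb [:: (-7,4,16)]) single))) single) (Cut (-13)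
     (-1) (-307) (comb [:: (-11,-12,-639)]) (Cut (-2) 1 (-21) (comb [:: (-1,1,14)]) (comb [::
     (-1,0,-34)]))));
   (18%N, 9%N, Cut (-13) (-14) (-614) (Cut (-13) (-38) (-531) (Leaf 3 1 1) (Cut (-12) (-25) (-616)
     (Cut (-12) (-37) (-664) (comb [:: (-5,-8,-176)]) single) single)) (comb [:: (-1,0,-42)]));
   (19%N, 10%N, Cut (-13) (-40) (-679) (Cut (-9) 2 (-90) (comb [:: (-7,10,40)]) (Leaf 3 1 2)) (Cut
     (-1) (-1) (-46) (Leaf 2 1 0) (Leaf 2 1 0)));
   (20%N, 11%N, comb [:: (-11,-12,-153); (10,1,466); (10,11,486); (-11,-23,-296); (-11,-34,-439);
     (10,21,506); (10,31,526); (-6,-11,-219)]);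
   (21%N, 12%N, Cut (-12) 25 (-249) (Cut (-6) 13 33 (Leaf 2 1 1) (comb [:: (-8,9,-73);
     (-8,17,-65); (-7,22,-50)])) (Leaf 3 1 0));
   (23%N, 14%N, comb [:: (1,0,51); (1,1,52); (-1,-1,-13); (1,2,53); (-12,1,-129); (12,11,456);
     (-13,-12,-324); (1,2,40)]);
   (28%N, 17%N, Cut (-10) (-29) (-500) (Cut (-10) (-19) (-370) (comb [:: (-8,-7,-97); (10,9,241);
     (9,-1,98)]) single) (Cut 7 (-1) 306 (comb [:: (9,-1,504); (6,-7,250)]) (Leaf 3 1 0)));
   (30%N, 19%N, Cut (-13) 40 (-89) (cut_off [:: (-1,1,3)] (Cut (-1) 2 (-8) (Cut (-9) 28 59 (Leaf 2
     1 0) single) single)) (Cut (-1) 2 (-45) (Cut (-13) 14 (-596) (Cut (-11) 34 (-218) (comb [::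
     (-10,19,-221)]) (Leaf 2 1 0)) single) single));
   (31%N, 20%N, Cut 11 (-21) 93 (Cut (-10) 11 (-465) (Cut (-9) 19 (-292) (cut_off [::
     (-10,11,-209)] (Leaf 3 1 0)) single) (Leaf 2 1 0)) (Cut (-1) 2 5 (Leaf 2 1 0) (comb [::
     (-12,13,-107)])));
   (33%N, 22%N, comb [:: (-1,-1,-13); (-1,-2,-27); (-1,-3,-41); (-1,-2,-40); (-1,-1,-39);
     (-1,0,-38); (-1,1,-37); (-1,2,-36); (-11,34,-383); (-1,2,-49)]);
   (40%N, 27%N, Cut (-1) 3 (-30) (cut_off [:: (-1,1,3)] (Cut (-8) 17 (-248) (Cut (-1) 3 7 (Leaf 2
     1 0) (cut_off [:: (-11,23,-76)] (Cut (-8) 23 (-151) (Cut (-9) 19 (-170) (comb [::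
     (-10,29,-65)]) single) single))) single)) (Cut (-1) 3 (-43) (comb [:: (-10,19,-451)]) (Leaf 2 1
     0)));
   (41%N, 28%N, comb [:: (-1,1,3); (-1,2,5); (-1,3,7); (-11,23,-76); (-10,29,-65); (-9,19,-170);
     (-8,23,-151); (-8,17,-248); (-7,22,-202); (-8,17,-345); (-8,9,-457); (-7,15,-393)]);
   (45%N, 32%N, comb [:: (1,0,77); (13,-12,832); (-1,1,2); (-1,2,3); (12,-1,766); (-1,1,-11);
     (-1,2,-10); (-1,1,-24); (1,-1,51); (-1,0,-38); (1,0,52); (1,-1,38)]);
   (57%N, 42%N, comb [:: (7,-15,504); (-1,-1,-13); (-13,-1,-158); (-12,-11,-299); (8,-9,584);
     (8,-15,487); (-11,-1,-268); (8,-7,495); (8,-1,488); (8,-9,376); (-10,-9,-369); (8,-15,279);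
     (-7,1,-242); (8,-9,271)]);
   (58%N, 43%N, Cut (-11) 1 (-538) (cut_off [:: (11,-10,400)] (Cut 12 13 316 (Cut 9 19 365 (Cut 10
     11 386 (Leaf 2 1 0) single) single) (Leaf 3 1 2))) (Cut (-1) 0 (-88) (Cut (-10) 21 (-468) (Leaf
     2 1 0) (cut_off [:: (-11,12,-670)] (Leaf 3 1 1))) single));
   (59%N, 44%N, comb [:: (-1,1,3); (-1,2,4); (1,0,90); (1,1,91); (-13,14,-129); (-1,0,-24);
     (-1,-1,-38); (-13,-1,-495); (-13,-12,-662); (-12,1,-598); (-13,12,-651); (12,-1,912);
     (13,12,1001); (13,-1,819)])].

End Certificates.

Definition certificate_of (d : nat) : certificate :=
  nth certificate1 [:: certificate1; certificate2; certificate3; certificate4; certificate5;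
    certificate6; certificate7; certificate8; certificate9; certificate10; certificate11;
    certificate12; certificate13] d.-1.

Definition certificates_valid (d : nat) : bool :=
  if certificate_check d (certificate_of d) then
    all (covered d (certificate_of d)) (iota 7 (bound d - 7))
  else false.

Lemma certificates_ok : all certificates_valid (iota 1 13).
Proof. by vm_cast_no_check (erefl true). Qed.

(** Six is even, so the strips with 2i+1 cells do not apply; for d <= 9 the list [direct] contains a
    subdivision of the whole diagram. *)
Lemma six_nodes_ok : all (fun d => step_check d (certificate_of d) 6 0) (iota 1 9).
Proof. by vm_cast_no_check (erefl true). Qed.

Local Open Scope fset_scope.

Theorem theorem13 (K : fieldType) (charK : [pchar K] =i pred0)
    (d : nat) (hd : (1 <= d <= 13)%N) :
  (forall (k : nat) (F : {fset 'X_{1..2}}),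
      (6 < k)%N -> at_most_one_step F ->
      #|` F| = ((k * d * (d + 1)) %/ 2)%N ->
      generically_correct K d k F) /\
  ((d <= 9)%N ->
    forall F : {fset 'X_{1..2}},
      at_most_one_step F ->
      #|` F| = ((6 * d * (d + 1)) %/ 2)%N ->
      generically_correct K d 6 F).
Proof.
case/andP: (hd) => d0 d13.
have d_range : d \in iota 1 13 by rewrite mem_iota; lia.
have := allP certificates_ok d d_range; rewrite /certificates_valid.
case: ifP => // C_ok C_covered; split=> [k F k6|d9 F] [a [b [le_ba FP]]] szF;
  apply: (generically_correct_diagram charK d0 le_ba FP szF).
  exact: (solvable_diagram C_ok).
have six : step_check d (certificate_of d) 6 0.
  by apply: (allP six_nodes_ok); rewrite mem_iota d0.
exact: (step_check_sound C_ok six (@fills0 _ _ C_ok)).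
Qed.
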